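(* Let $\Gamma$ be an oriented graph in which every vertex has exactly $g$ outgoing edges, let $D\subset\Gamma$ be a subgraph whose Green's function is finite, and let $F_1,F_2$ be two disjoint finite sets of vertices of $D$. Consider the soup of oriented unrooted loops in $D$ with intensity $\alpha=1$ (a Poisson point process with intensity $\mu$). Let $\eta_{1\to2}$ (resp. $\eta_{2\to1}$) be the collection of crossings from $F_1$ to $F_2$ (resp. from $F_2$ to $F_1$) by the loops of the soup. Let $\mathcal X$ (resp. $\mathcal X'$) be the vector of endpoints of the crossings in $\eta_{1\to2}$ (resp. $\eta_{2\to1}$), and $\mathcal Y$ (resp. $\mathcal Y'$) the vector of starting points of the crossings in $\eta_{2\to1}$ (resp. $\eta_{1\to2}$), so that $\mathcal X,\mathcal Y$ consist of points of $F_2$ and $\mathcal X',\mathcal Y'$ of points of $F_1$. Then, conditionally on $\eta_{1\to2}$ and $\eta_{2\to1}$, the missing parts of the loops that these crossings are part of (these are the loops of the soup that intersect both $F_1$ and $F_2$) are described by two independent unordered bridges, with conditional distributions $B^{D\setminus F_1}_{\mathcal X,\mathcal Y}$ and $B^{D\setminus F_2}_{\mathcal X',\mathcal Y'}$.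
   Context: **Graph, loops.** $\Gamma$ is a discrete oriented graph; parallel edges and edges from a vertex to itself are allowed, and there may be an edge from $x$ to $y$ but none from $y$ to $x$. A rooted loop with $n=|l|\ge 1$ steps is $l=(l_0,e_1,l_1,\dots,e_n,l_n)$ with $l_0=l_n$ and $e_i$ an edge from $l_{i-1}$ to $l_i$ (so the edges used are part of the information). Put $p(l)=g^{-n}$ and $\rho(l)=p(l)/n$. An unrooted (oriented) loop is an equivalence class of rooted loops modulo rerooting (cyclic shift). The measure $\mu$ on unrooted oriented loops in $D$ is the image of $\rho$, restricted to loops in $D$, under the map sending a rooted loop to its class. Equivalently $\mu(L)=p(l)/J(l)$ for $l\in L$, where $J(l)$ is the maximal $J$ such that $l$ is the concatenation of $J$ copies of the same loop. The loop-soup with intensity $\alpha$ is a Poisson point process of unrooted loops with intensity $\alpha\mu$. **Bridges.** For a subgraph $D'$ and vertices $x,y$ of $D'$, a bridge $b$ from $x$ to $y$ in $D'$ is a finite nearest-neighbour path in $D'$ from $x$ to $y$ (keeping track of the oriented edges used); $n(b)$ is its number of steps, and $n(b)=0$ is allowed if $x=y$. The Green's function is $G_{D'}(x,y)=\sum_b g^{-n(b)}$, summed over all bridges from $x$ to $y$ in $D'$; ''the Green's function of $D$ is finite'' means $G_D(x,y)<\infty$ for all $x,y$ in $D$. If $G_{D'}(x,y)>0$, the bridge probability measure gives mass $g^{-n(b)}/G_{D'}(x,y)$ to each bridge $b$. For $X=(x_1,\dots,x_N)$, $Y=(y_1,\dots,y_N)$, an unordered bridge from $X$ to $Y$ in $D'$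 is a permutation $s$ of $\{1,\dots,N\}$ together with bridges $b^j$ from $x_j$ to $y_{s(j)}$ in $D'$, $j=1,\dots,N$. The unordered bridge measure $B^{D'}_{X,Y}$ is the probability measure obtained by first sampling $\sigma$ with $P(\sigma=s)$ proportional to $\prod_{j=1}^N G_{D'}(x_j,y_{s(j)})$, and then, given $\sigma$, sampling independent bridges from $x_j$ to $y_{\sigma(j)}$ in $D'$ according to the bridge probability measures. Equivalently, each unordered bridge has probability proportional to $g^{-K}$, with $K$ the total length of its $N$ bridges. (It is defined when $\prod_j G_{D'}(x_j,y_{s(j)})>0$ for some $s$.) $D\setminus F_i$ is $D$ with the vertices of $F_i$ removed. **Crossings and missing parts.** A crossing from $F_1$ to $F_2$ is a portion $(a_0,e_1,a_1,\dots,e_n,a_n)$, $n\ge1$, of a loop with $a_0\in F_1$, $a_n\in F_2$ and $a_1,\dots,a_{n-1}\in D\setminus(F_1\cup F_2)$; crossings from $F_2$ to $F_1$ are defined by exchanging the roles of $F_1$ and $F_2$. $\eta_{1\to2}$ and $\eta_{2\to1}$ list all such crossings by all loops of the soup, counted with multiplicity, each ordered by a fixed deterministic rule; they have the same (a.s. finite) number of elements. Removing all crossings from the loops of the soup that intersect both $F_1$ and $F_2$ leaves paths (possibly of length zero) of two types: paths in $D\setminus F_1$ joining the endpoint of a crossing of $\eta_{1\to2}$ to the starting point of the next crossing (of $\eta_{2\to1}$) on the same loop, which form an unordered bridge from $\mathcal X$ to $\mathcal Y$ in $D\setminus F_1$; and paths in $D\setminus F_2$ joining the endpoint of a crossing of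 $\eta_{2\to1}$ to the starting point of the next crossing (of $\eta_{1\to2}$), which form an unordered bridge from $\mathcal X'$ to $\mathcal Y'$ in $D\setminus F_2$. When some crossings coincide, this pair of unordered bridges is only determined up to relabelling identical crossings; it is then chosen uniformly at random among all pairs of unordered bridges which, concatenated with $\eta_{1\to2}$ and $\eta_{2\to1}$, give the collection of loops of the soup intersecting both $F_1$ and $F_2$. *)

(* Defs.v *)
From HB Require Import structures.
From mathcomp Require Import all_boot all_order all_fingroup all_algebra.
From mathcomp Require Import generic_quotient finmap.
From mathcomp Require Import all_classical all_reals all_analysis.
From mathcomp Require Import measurable_realfun.

Set Implicit Arguments.
Unset Strict Implicit.
Unset Printing Implicit Defensive.

Import Order.TTheory GRing.Theory Num.Theory.

Local Open Scope quotient_scope.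
Local Open Scope classical_set_scope.
Local Open Scope ring_scope.

Record ograph := OGraph {
  vertex : choiceType;
  edge : choiceType;
  src : edge -> vertex;
  tgt : edge -> vertex }.

Definition out_regular (G : ograph) (g : nat) : Prop :=
  forall x : vertex G, ([set e | src e = x] #= `I_g)%card.

Record subgraph (G : ograph) := Subgraph {
  vset : set (vertex G);
  eset : set (edge G);
  eset_src : forall e, eset e -> vset (src e);
  eset_tgt : forall e, eset e -> vset (tgt e) }.

Section Remove.
Variables (G : ograph) (D : subgraph G) (F : set (vertex G)).

Definition remove_eset : set (edge G) :=
  eset D `&` [set e | ~ F (src e) /\ ~ F (tgt e)].

Lemma remove_src e : remove_eset e -> (vset D `\` F) (src e).
Proof. by move=> [De [Fs _]]; split => //; apply: eset_src. Qed.

Lemma remove_tgt e : remove_eset e -> (vset D `\` F) (tgt e).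
Proof. by move=> [De [_ Ft]]; split => //; apply: eset_tgt. Qed.

Definition remove : subgraph G := Subgraph remove_src remove_tgt.

End Remove.

(* [walk x b y]: the edges listed in [b] form a nearest-neighbour path from
   [x] to [y]; the intermediate vertices are determined by the edges. *)
Fixpoint walk (G : ograph) (x : vertex G) (b : seq (edge G)) (y : vertex G)
    : bool :=
  if b is e :: b' then (src e == x) && walk (tgt e) b' y else x == y.

Definition closed_walk (G : ograph) (l : seq (edge G)) : bool :=
  if l is e :: _ then walk (src e) l (src e) else false.

(* A rooted loop (l_0, e_1, l_1, ..., e_n, l_n) is encoded by (e_1, ..., e_n),
   its root being the source of e_1. *)
Definition rloop (G : ograph) := {l : seq (edge G) | closed_walk l}.

Definition reroot (G : ograph) : rel (rloop G) :=
  fun l l' => [exists i : 'I_(size (val l)), val l' == rot i (val l)].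

Section RerootEquiv.
Variable G : ograph.

Let rloop_gt0 (l : rloop G) : (0 < size (val l))%N.
Proof. by case: l => -[]. Qed.

Lemma rerootP (l l' : rloop G) :
  reflect (exists i, val l' = rot i (val l)) (reroot l l').
Proof.
apply: (iffP existsP) => [[i /eqP ->]|[i e]]; first by exists i.
have [lt_i|le_i] := ltnP i (size (val l)).
  by exists (Ordinal lt_i); apply/eqP.
exists (Ordinal (rloop_gt0 l)); apply/eqP.
by rewrite e rot_oversize //= rot0.
Qed.

Lemma reroot_refl : reflexive (@reroot G).
Proof. by move=> l; apply/rerootP; exists 0%N; rewrite rot0. Qed.

Let reroot_symW (l l' : rloop G) : reroot l l' -> reroot l' l.
Proof.
move=> /rerootP[i e]; apply/rerootP; exists (size (val l) - i)%N.
by rewrite e -[size (val l)](size_rot i) -/(rotr _ _) rotK.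
Qed.

Lemma reroot_sym : symmetric (@reroot G).
Proof. by move=> l l'; apply/idP/idP; apply: reroot_symW. Qed.

Lemma reroot_trans : transitive (@reroot G).
Proof.
move=> l2 l1 l3 /rerootP[i e12] /rerootP[j e23]; apply/rerootP.
by exists (rot_add (val l1) i j); rewrite e23 e12 rot_rot_add.
Qed.

Definition reroot_equiv : equiv_rel (rloop G) :=
  EquivRel (@reroot G) reroot_refl reroot_sym reroot_trans.

End RerootEquiv.

Definition uloop (G : ograph) := {eq_quot (reroot_equiv G)}.

Definition uclass (G : ograph) (l : rloop G) : uloop G := \pi_(uloop G) l.

(* [uedges L] is one of the rooted loops in the class [L]; it is only used
   below through rerooting-invariant properties. *)
Definition uedges (G : ograph) (L : uloop G) : seq (edge G) := val (repr L).

Definition rloop_in (G : ograph) (D : subgraph G) (l : rloop G) : Prop :=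
  forall e, e \in val l -> eset D e.

Definition uloop_in (G : ograph) (D : subgraph G) (L : uloop G) : Prop :=
  exists2 l : rloop G, rloop_in D l & uclass l = L.

Definition visits (G : ograph) (F : set (vertex G)) (L : uloop G) : Prop :=
  exists2 e, e \in uedges L & F (src e).

Definition meets_both (G : ograph) (D : subgraph G) (F1 F2 : set (vertex G))
    : set (uloop G) :=
  [set L | [/\ uloop_in D L, visits F1 L & visits F2 L]].

Definition rho (R : realType) (G : ograph) (g : nat) (l : rloop G) : R :=
  g%:R ^- size (val l) / (size (val l))%:R.

Definition loop_measure (R : realType) (G : ograph) (g : nat) (D : subgraph G)
    (A : set (uloop G)) : \bar R :=
  \esum_(l in [set l : rloop G | rloop_in D l /\ A (uclass l)])
    (rho R g l)%:E.

(* A point configuration on a discrete space [T] is given by the multiplicity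
   of each point. *)
Definition npoints (R : realType) (T : choiceType) (nu : T -> nat) (A : set T)
    : \bar R :=
  \esum_(t in A) (nu t)%:R%:E.

(* The counts of disjoint sets of finite mass are independent Poisson variables;
   as every point of a loop space has finite mass, this determines the law.
   [poisson_prob] is used instead of [poisson_pmf] because the latter is
   constantly 1 at rate 0; the second argument of [poisson_prob] is a
   dummy. *)
Definition poisson_point_process (R : realType) (d : measure_display)
    (Omega : measurableType d) (P : probability Omega R) (T : choiceType)
    (m : set T -> \bar R) (N : Omega -> T -> nat) : Prop :=
  [/\ forall A : set T, (m A < +oo)%E ->
        measurable_fun setT (fun w => npoints R (N w) A),
      forall A : set T, (m A < +oo)%E -> forall k : nat,
        P [set w | npoints R (N w) A = k%:R%:E]
        = poisson_prob (fine (m A)) 0%N [set k]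
    & forall (n : nat) (A : 'I_n -> set T),
        trivIset setT A -> (forall i, (m (A i) < +oo)%E) ->
        forall k : 'I_n -> nat,
        P [set w | forall i, npoints R (N w) (A i) = (k i)%:R%:E]
        = (\prod_(i < n) P [set w | npoints R (N w) (A i) = (k i)%:R%:E])%E].

Definition loop_soup (R : realType) (G : ograph) (g : nat) (D : subgraph G)
    (alpha : R) (d : measure_display) (Omega : measurableType d)
    (P : probability Omega R) (N : Omega -> uloop G -> nat) : Prop :=
  poisson_point_process P (fun A => (alpha%:E * loop_measure R g D A)%E) N.

Definition bridges (G : ograph) (D : subgraph G) (x y : vertex G)
    : set (seq (edge G)) :=
  [set b | [/\ vset D x, vset D y, walk x b y
             & forall e, e \in b -> eset D e]].

Definition green (R : realType) (G : ograph) (g : nat) (D : subgraph G)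
    (x y : vertex G) : \bar R :=
  \esum_(b in bridges D x y) (g%:R ^- size b)%:E.

Definition bridge_prob (R : realType) (G : ograph) (g : nat) (D : subgraph G)
    (x y : vertex G) (b : seq (edge G)) : R :=
  if b \in bridges D x y then g%:R ^- size b / fine (green R g D x y) else 0.

Definition ubridge (G : ograph) (n : nat) : Type :=
  ('S_n * n.-tuple (seq (edge G)))%type.

Definition ubridges (G : ograph) (D : subgraph G) (n : nat)
    (X Y : n.-tuple (vertex G)) : set (ubridge G n) :=
  [set b : ubridge G n |
    forall j, bridges D (tnth X j) (tnth Y (b.1 j)) (tnth b.2 j)].

Definition perm_weight (R : realType) (G : ograph) (g : nat) (D : subgraph G)
    (n : nat) (X Y : n.-tuple (vertex G)) (s : 'S_n) : R :=
  \prod_(j < n) fine (green R g D (tnth X j) (tnth Y (s j))).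

Definition ubridge_defined (R : realType) (G : ograph) (g : nat)
    (D : subgraph G) (n : nat) (X Y : n.-tuple (vertex G)) : Prop :=
  exists s : 'S_n, 0 < perm_weight R g D X Y s.

(* Mass function of the unordered bridge measure: first the permutation, then
   independent bridges. *)
Definition ubridge_prob (R : realType) (G : ograph) (g : nat) (D : subgraph G)
    (n : nat) (X Y : n.-tuple (vertex G)) (b : ubridge G n) : R :=
  perm_weight R g D X Y b.1 / (\sum_(s : 'S_n) perm_weight R g D X Y s)
  * \prod_(j < n)
      bridge_prob R g D (tnth X j) (tnth Y (b.1 j)) (tnth b.2 j).

(* The portion (a_0, e_1, a_1, ..., e_n, a_n) is encoded by
   (a_0, (e_1, ..., e_n)). *)
Definition portion (G : ograph) : Type := (vertex G * seq (edge G))%type.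

Definition pstart (G : ograph) (a : portion G) : vertex G := a.1.

Definition pend (G : ograph) (a : portion G) : vertex G :=
  last a.1 [seq tgt e | e <- a.2].

(* The sources of the edges other than the first one are the interior vertices
   a_1, ..., a_(n-1). *)
Definition crossing (G : ograph) (F F' : set (vertex G)) : set (portion G) :=
  [set a | [/\ a.2 != [::], walk (pstart a) a.2 (pend a),
               F (pstart a), F' (pend a)
             & forall e, e \in behead a.2 -> ~ F (src e) /\ ~ F' (src e)]].

(* Number of positions, along one full turn of the loop [L], at which the
   portion [a] starts. Comparing with one turn is enough for crossings between
   disjoint sets: they are always shorter than the loop. *)
Definition occurrences (G : ograph) (a : portion G) (L : uloop G) : nat :=
  count (fun i => prefix a.2 (rot i (uedges L))) (iota 0 (size (uedges L))).

Definition crossing_mult (R : realType) (G : ograph) (D : subgraph G)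
    (nu : uloop G -> nat) (a : portion G) : \bar R :=
  \esum_(L in uloop_in D) (nu L * occurrences a L)%:R%:E.

Definition ordering_rule (T : eqType) (ord : seq T -> seq T) : Prop :=
  (forall s, perm_eq (ord s) s) /\
  (forall s t, perm_eq s t -> ord s = ord t).

(* [c] is the ordered list of all crossings from [F] to [F'], counted with
   multiplicity, by the loops of the configuration [nu]. *)
Definition lists_crossings (R : realType) (G : ograph) (D : subgraph G)
    (ord : seq (portion G) -> seq (portion G)) (F F' : set (vertex G))
    (nu : uloop G -> nat) (c : seq (portion G)) : Prop :=
  [/\ ord c = c,
      forall a, a \in c -> crossing F F' a
    & forall a, crossing F F' a ->
        (count_mem a c)%:R%:E = crossing_mult R D nu a].

Section Missing.
Variables (G : ograph) (D : subgraph G) (F1 F2 : set (vertex G)) (n : nat).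
Variables (c12 c21 : n.-tuple (portion G)).

Definition starts (c : n.-tuple (portion G)) : n.-tuple (vertex G) :=
  map_tuple (@pstart G) c.

Definition ends (c : n.-tuple (portion G)) : n.-tuple (vertex G) :=
  map_tuple (@pend G) c.

Definition glue_piece (xi : ubridge G n * ubridge G n) (j : 'I_n)
    : seq (edge G) :=
  (tnth c12 j).2 ++ tnth xi.1.2 j ++
  (tnth c21 (xi.1.1 j)).2 ++ tnth xi.2.2 (xi.1.1 j).

(* Index of the crossing of [c12] following the [j]-th one on its loop; the
   product of permutations applies its left factor first. *)
Definition glue_next (xi : ubridge G n * ubridge G n) : 'S_n :=
  (xi.1.1 * xi.2.1)%g.

Definition glued_loop (xi : ubridge G n * ubridge G n) (j : 'I_n)
    : seq (edge G) :=
  flatten [seq glue_piece xi i | i <- fingraph.orbit (glue_next xi) j].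

(* Multiplicity of [L] in the collection of the glued loops: each cycle of
   [glue_next xi] yields one unrooted loop. *)
Definition glued_mult (xi : ubridge G n * ubridge G n) (L : uloop G) : nat :=
  #|[pred C in porbits (glue_next xi) |
      [exists j in C, exists i : 'I_(size (uedges L)),
         glued_loop xi j == rot i (uedges L)]]|.

Definition missing_parts (nu : uloop G -> nat)
    : set (ubridge G n * ubridge G n) :=
  [set xi | [/\ ubridges (remove D F1) (ends c12) (starts c21) xi.1,
                ubridges (remove D F2) (ends c21) (starts c12) xi.2
              & forall L, meets_both D F1 F2 L -> nu L = glued_mult xi L]].

End Missing.

Definition ubridge_pair (G : ograph) : Type :=
  {n : nat & (ubridge G n * ubridge G n)%type}.

(* Meant for a finite set [C]: [fset_set] is empty on infinite sets. *)
Definition uniform_mass (R : realType) (T : choiceType) (C : set T) (t : T)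
    : R :=
  if t \in C then (#|` fset_set C|%fset)%:R^-1 else 0.

Definition eta_event (R : realType) (G : ograph) (D : subgraph G)
    (ord : seq (portion G) -> seq (portion G)) (F1 F2 : set (vertex G))
    (Omega : Type) (N : Omega -> uloop G -> nat)
    (c12 c21 : seq (portion G)) : set Omega :=
  [set w | lists_crossings R D ord F1 F2 (N w) c12 /\
           lists_crossings R D ord F2 F1 (N w) c21].

(* Given that the loops of the soup meeting both sets are described by [kappa],
   [Xi] is uniform among the pairs of unordered bridges that produce them when
   glued with the two lists of crossings. *)
Definition uniform_missing_parts (R : realType) (G : ograph) (D : subgraph G)
    (ord : seq (portion G) -> seq (portion G)) (F1 F2 : set (vertex G))
    (d : measure_display) (Omega : measurableType d) (P : probability Omega R)
    (N : Omega -> uloop G -> nat) (Xi : Omega -> ubridge_pair G) : Prop :=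
  (forall xi : ubridge_pair G, measurable [set w | Xi w = xi]) /\
  forall (kappa : uloop G -> nat) (n : nat) (c12 c21 : n.-tuple (portion G)),
    lists_crossings R D ord F1 F2 kappa c12 ->
    lists_crossings R D ord F2 F1 kappa c21 ->
    forall xi : ubridge G n * ubridge G n,
    let same_loops :=
      [set w | forall L, meets_both D F1 F2 L -> N w L = kappa L] in
    P (same_loops `&` [set w | Xi w = existT _ n xi])
    = (P same_loops *
       (uniform_mass R (missing_parts D F1 F2 c12 c21 kappa) xi)%:E)%E.

(* Main.v *)
(* Cutting a loop that meets F1 and F2 along its crossings presents it, in a
   unique way, as a cyclic sequence of pieces (crossing, bridge in D \ F1,
   crossing, bridge in D \ F2). A pair of unordered bridges that is compatible
   with the two lists of crossings is therefore a permutation of the crossings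
   together with a labelling by pieces, and its cycles are the loops of a
   configuration kappa. The configuration kappa has probability
   e^(-M) prod_L mu(L)^kappa(L) / kappa(L)!, with mu(L) = g^(-|L|) / J(L) and M
   the total mass of the loops meeting both sets. The number of pairs of
   unordered bridges producing kappa, multiplied by the number
   prod_L J(L)^kappa(L) kappa(L)! of automorphisms of the labelled permutation,
   is the number of ways to permute identical crossings, which does not depend
   on kappa. Hence a uniform choice among these pairs gives each pair a
   probability proportional to g^(-K), K being the total length of its bridges,
   and such a product weight is that of the product of the two unordered bridge
   measures. *)
Require Import Defs.
From HB Require Import structures.
From mathcomp Require Import all_boot all_order all_fingroup all_algebra.
From mathcomp Require Import generic_quotient finmap.
From mathcomp Require Import all_classical all_reals all_analysis.
From mathcomp Require Import measurable_realfun zify ring.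

Set Implicit Arguments.
Unset Strict Implicit.
Unset Printing Implicit Defensive.

(** * Cyclic words cut into blocks *)

Section Blocks.

(** The factor [J(L)] is defined by rotations of the edge word, whereas automorphisms of a labelled
    permutation see rotations of the sequence of pieces. To identify the two, block boundaries must
    be read off the cyclic word in a way that commutes with rotation: a block begins at an edge
    leaving [F1] after which [F2] is visited before [F1] is visited again. The pairs are counted
    through numberings of the crossings by the entries of the two lists. Each numbering yields a
    pair, and each fibre of this map is a set of isomorphisms of labelled permutations, whose size
    is the same for all pairs producing the same configuration. On the probabilistic side, different
    pairs may glue to the same configuration, so the corresponding events overlap; they become
    disjoint only once the value of [Xi] is added, and [Xi] has to be shown to be compatible almost
    surely. Moreover the law of the soup speaks of finitely many disjoint sets at a time, while a
    configuration is prescribed on infinitely many loops: all loops of multiplicity zero are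
    gathered into one set. *)

Fixpoint block_marks (s : seq nat) : seq bool :=
  if s is n :: s' then true :: nseq n.-1 false ++ block_marks s' else [::].

Lemma size_block_marks s : all (leq 1) s -> size (block_marks s) = sumn s.
Proof.
elim: s => //= -[|n] s IH //= /IH e; by rewrite size_cat size_nseq e.
Qed.

Lemma block_marks_cat s t : block_marks (s ++ t) =
  block_marks s ++ block_marks t.
Proof. by elim: s => //= n s ->; rewrite catA. Qed.

Lemma find_block_marks n s : find id (nseq n false ++ block_marks s) = n.
Proof. by elim: n => [|n /= ->] //; case: s. Qed.

Lemma block_marks_inj s t : all (leq 1) s -> all (leq 1) t ->
  block_marks s = block_marks t -> s = t.
Proof.
elim: s t => [|[|n] s IH] [|[|m] t] //= s1 t1 [e].
have := congr1 (find id) e; rewrite !find_block_marks => nm.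
move: e; rewrite nm => /(congr1 (drop m)).
by rewrite !drop_size_cat ?size_nseq // => /IH ->.
Qed.

Lemma nth_block_marks s i : all (leq 1) s -> nth false (block_marks s) i ->
  exists2 k, k < size s & i = sumn (take k s).
Proof.
elim: s i => [|[|n] s IH] [|i] //= s1; first by exists 0.
rewrite nth_cat size_nseq; case: ltnP => [lt|le]; first by rewrite nth_nseq lt.
move/IH => /(_ s1) [k ks ek]; exists k.+1 => //=.
by rewrite -ek addSn subnKC.
Qed.

Lemma nth_block_marks_off s k : all (leq 1) s -> k < size s ->
  nth false (block_marks s) (sumn (take k s)).
Proof.
by elim: s k => [|[|n] s IH] [|k] //= s1 /IH;
  rewrite nth_cat size_nseq ltnNge leq_addr addKn; apply.
Qed.

(** This makes counts over the edges of a loop comparable with counts over its pieces. *)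
Lemma count_block_marks s (P : pred nat) : all (leq 1) s ->
  (forall i, P i -> i < sumn s -> nth false (block_marks s) i) ->
  count P (iota 0 (sumn s)) =
  count (fun k => P (sumn (take k s))) (iota 0 (size s)).
Proof.
elim: s P => //= -[|n] s IH P //= s1 h.
have e m : iota 1 m = map succn (iota 0 m) by rewrite -[1]/(1 + 0) iotaDl.
rewrite !e !count_map; congr (_ + _); rewrite iotaD count_cat add0n.
rewrite (_ : count _ (iota 0 n) = 0) ?add0n; last first.
  apply/eqP; rewrite -leqn0 leqNgt -has_count; apply/hasPn => i.
  rewrite mem_iota add0n => /andP[_ lt]; apply/negP => /= Pi.
  have := h _ Pi; rewrite addSn /= ltnS ltn_addr //= => /(_ isT).
  by rewrite nth_cat size_nseq lt nth_nseq lt.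
rewrite -[n in iota n _]addn0 iotaDl count_map.
rewrite (eq_count (a2 := fun i => P (n.+1 + i))) //.
rewrite IH //; last first.
  move=> i Pi lt; have := h _ Pi; rewrite /= addSn ltnS ltn_add2l => /(_ lt).
  by rewrite /= nth_cat size_nseq ltnNge leq_addr /= addKn.
Qed.

(** Position [i] becomes the first letter, which is marked in [block_marks t]; so it was already
    marked, and [i] is a partial sum of block lengths. *)
Lemma rot_block_marks s t i : all (leq 1) s -> all (leq 1) t ->
  i < sumn s -> rot i (block_marks s) = block_marks t ->
  exists k, [/\ k < size s, i = sumn (take k s) & t = rot k s].
Proof.
move=> s1 t1 lt e.
have : nth false (block_marks s) i.
  have := congr1 (nth false ^~ 0) e.
  rewrite /rot nth_cat size_drop size_block_marks // subn_gt0 lt nth_drop addn0.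
  move=> ->; case: t t1 e => // _ /(congr1 size).
  by rewrite size_rot size_block_marks //= => e0; rewrite e0 in lt.
case/nth_block_marks => // k ks ek; exists k; split => //.
apply: block_marks_inj => //.
  by move: s1; rewrite -{1}(cat_take_drop k s) !all_cat andbC.
rewrite -e /rot block_marks_cat -[in LHS](cat_take_drop k s) block_marks_cat.
have sz : size (block_marks (take k s)) = i.
  rewrite size_block_marks // -?ek //; apply/allP => x /mem_take;
    exact: (allP s1).
by rewrite drop_size_cat // take_size_cat.
Qed.

Lemma flatten_rot (T : Type) k (ss : seq (seq T)) :
  flatten (rot k ss) = rot (sumn (take k (shape ss))) (flatten ss).
Proof.
rewrite /rot flatten_cat -[in RHS](cat_take_drop k ss) flatten_cat.
have -> : sumn (take k (shape (take k ss ++ drop k ss))) =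
  size (flatten (take k ss)).
  by rewrite cat_take_drop size_flatten /shape -map_take.
by rewrite drop_size_cat // take_size_cat.
Qed.

End Blocks.

Section Marks.
Variables (T : Type) (f1 f2 : pred T).
Hypothesis f12 : forall e, f1 e -> ~~ f2 e.

(* In a cyclic product of blocks, this holds exactly at the first letters of the
   blocks, so the cutting into blocks can be read off the cyclic word. *)
Definition crossing_head (w : seq T) : bool :=
  if w is e :: w' then f1 e && (find f2 w' < find f1 w') else false.

(** Deciding whether a letter is a head needs a look ahead, so [u] is what is read after [w]. A
    cyclic word is marked by [crossing_marks w w]. *)
Fixpoint crossing_marks (w u : seq T) : seq bool :=
  if w is e :: w' then crossing_head (w ++ u) :: crossing_marks w' u else [::].

Lemma size_crossing_marks w u : size (crossing_marks w u) = size w.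
Proof. by elim: w => //= e w ->. Qed.

Lemma crossing_marks_cat w1 w2 u :
  crossing_marks (w1 ++ w2) u =
    crossing_marks w1 (w2 ++ u) ++ crossing_marks w2 u.
Proof. by elim: w1 => //= e w1 ->; rewrite catA. Qed.

Lemma nth_crossing_marks w u i : i < size w ->
  nth false (crossing_marks w u) i = crossing_head (drop i w ++ u).
Proof. by elim: w i => //= e w IH [|i] //= /IH. Qed.

(** The answer is settled at the first letter of either kind after the head; later letters cannot
    change it. *)
Lemma crossing_head_cat w u : has (predU f1 f2) (behead w) ->
  crossing_head (w ++ u) = crossing_head w.
Proof.
case: w => //= e w; rewrite has_predU => hw; congr (_ && _).
rewrite !find_cat; case: ifP => h2; case: ifP => h1 //.
- by move/negbT/hasNfind: h1 => ->;
    rewrite -has_find h2 ltn_addr // -has_find h2.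
- move/negbT/hasNfind: h2 => ->; rewrite [in LHS]ltnNge [in RHS]ltnNge;
    congr (~~ _).
  by rewrite find_size (leq_trans (find_size _ _)) // leq_addr.
- by rewrite h1 h2 in hw.
Qed.

Lemma crossing_marks_weak w u v : has (predU f1 f2) u ->
  crossing_marks w (u ++ v) = crossing_marks w u.
Proof.
move=> hu; elim: w => //= e w ->; congr (_ :: _).
rewrite catA; apply: (@crossing_head_cat (e :: w ++ u)).
by rewrite /= has_cat hu orbT.
Qed.

(** One more turn of the cyclic word settles every mark, and each of its rotations serves equally
    well as that extra turn. *)
Lemma crossing_marks_rot l i : has (predU f1 f2) l ->
  crossing_marks (rot i l) (rot i l) = rot i (crossing_marks l l).
Proof.
move=> hl; have h2 x y : l = x ++ y ->
  crossing_marks (y ++ x)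
    (y ++ x) = crossing_marks y l ++ crossing_marks x (y ++ x).
  by move=> e; rewrite crossing_marks_cat (catA x y x) -e crossing_marks_weak.
case: (leqP (size l) i) => [le|lt].
  by rewrite !rot_oversize // size_crossing_marks.
have e := cat_take_drop i l.
rewrite {2 3}/rot -[X in crossing_marks X l]e crossing_marks_cat.
have hs : size (crossing_marks (take i l) (drop i l ++ l)) = i.
  by rewrite size_crossing_marks size_takel // ltnW.
rewrite drop_size_cat // take_size_cat // (h2 _ _ (esym e)).
rewrite (_ : drop i l ++ l = (drop i l ++ take i l) ++ drop i l);
  last by rewrite -catA e.
congr (_ ++ _); rewrite [RHS]crossing_marks_weak //.
by move: hl; rewrite -{1}e !has_cat orbC.
Qed.

Lemma crossing_marksN1 w u : ~~ has f1 w ->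
  crossing_marks w u = nseq (size w) false.
Proof. by elim: w => //= e w IH;
  rewrite negb_or => /andP[/negbTE-> /IH ->]. Qed.

Lemma crossing_marksN2 w u : ~~ has f2 w -> head false (map f1 u) ->
  crossing_marks w u = nseq (size w) false.
Proof.
move=> + hu; elim: w => //= e w IH; rewrite negb_or => /andP[_ h2].
rewrite IH //; congr (_ :: _); apply/negbTE; rewrite negb_and; apply/orP; right.
rewrite -leqNgt !find_cat (negbTE h2).
case: ifP => [h1|_]; first by rewrite (leq_trans (find_size _ _)) // leq_addr.
by case: u hu {IH} => //= x u ->; rewrite addn0 leq_addr.
Qed.

(** In use, [f1] and [f2] select the edges whose source is in [F1] and [F2]; [a] and [a'] are
    crossings, [b] and [b'] bridges. A nonempty bridge starts where the crossing before it ended,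
    hence the conditions on heads. *)
Record block (a b a' b' : seq T) : Prop := Block {
  block_a : head false (map f1 a);
  block_a0 : ~~ has (predU f1 f2) (behead a);
  block_b : ~~ has f1 b;
  block_b0 : nilp b || head false (map f2 b);
  block_a' : head false (map f2 a');
  block_a'0 : ~~ has (predU f1 f2) (behead a');
  block_b' : ~~ has f2 b';
  block_b'0 : nilp b' || head false (map f1 b') }.

Lemma find_cat_head (p : pred T) u v : ~~ has p u -> head false (map p v) ->
  find p (u ++ v) = size u.
Proof. by move=> h; case: v => //= x v px;
  rewrite find_cat (negbTE h) /= px addn0. Qed.

(** After the head of [a] there is no [f1] up to the end of [a']; inside [b'] an [f1] comes back, at
    the latest with [u], before any [f2]. *)
Lemma crossing_marks_block a b a' b' u : block a b a' b' ->
  head false (map f1 u) ->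
  crossing_marks (a ++ b ++ a' ++ b') u =
  true :: nseq (size (a ++ b ++ a' ++ b')).-1 false.
Proof.
case=> + + hb hb0 + + hb' hb'0 hu.
case: a => // e a /= fe ha; case: a' => // e' a' /= fe' ha'.
have ne' : ~~ f1 e' by apply/negP => /f12; rewrite fe'.
congr (_ :: _).
- rewrite fe /= -!catA.
  move: ha; rewrite has_predU negb_or => /andP[ha1 ha2].
  set v := b ++ _.
  have hv : head false (map f2 v) by rewrite /v; case: (b) hb0.
  rewrite (find_cat_head ha2 hv) find_cat (negbTE ha1) -addn1 leq_add2l.
  by case: (v) hv => //= x v' fx; case: ifP => // /f12; rewrite fx.
- rewrite !crossing_marks_cat [crossing_marks (e' :: _) _]/= crossing_marks_cat.
  move: ha ha'; rewrite !has_predU !negb_or => /andP[ha1 ha2] /andP[ha1' ha2'].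
  rewrite (crossing_marksN1 _ ha1) (crossing_marksN1 _ hb)
    (crossing_marksN1 _ ha1').
  rewrite (negbTE ne') crossing_marksN2 //=.
  rewrite -[_ :: _ ++ _]/(nseq (size a').+1 false ++ _) -!nseqD !size_cat /=.
  by rewrite size_cat addSn.
Qed.

Lemma block_find2 a b a' b' : block a b a' b' ->
  find f2 (a ++ b ++ a' ++ b') = size a.
Proof.
case=> + + hb hb0 + _ _ _; case: a => // e a fe ha.
case: a' => // e' a' fe'.
rewrite find_cat_head //=; last by case: (b) hb0.
by rewrite (negbTE (f12 fe)) /=; move: ha; rewrite has_predU negb_or => /andP[].
Qed.

Lemma block_find1 a b a' b' : block a b a' b' ->
  find f1 ((b ++ a') ++ b') = size (b ++ a').
Proof.
case=> _ _ hb hb0 + + hb' hb'0; case: a' => // e' a' /= fe' ha'.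
have h : ~~ has f1 (b ++ e' :: a').
  rewrite has_cat negb_or hb /= negb_or; apply/andP; split.
    by apply/negP => /f12; rewrite fe'.
  by move: ha'; rewrite has_predU negb_or => /andP[].
case: b' hb' hb'0 => [|x b'] _ /= hx; first by rewrite cats0 hasNfind.
by rewrite find_cat_head.
Qed.

Lemma block_find2_rev a b a' b' : block a b a' b' ->
  find f2 (rev (b ++ a')) = (size a').-1.
Proof.
case=> _ _ _ _ + + _ _; case: a' => // e' a' fe' /=.
rewrite has_predU negb_or => /andP[_ h].
by rewrite rev_cat rev_cons cat_rcons find_cat_head ?size_rev // has_rev.
Qed.

(** The lengths can be read off the word: [a] stops before the first [f2], [b ++ a'] stops before
    the next [f1] or at the end, and [a'] starts at the last [f2] of [b ++ a']. *)
Lemma block_inj a b a' b' c d c' d' : block a b a' b' -> block c d c' d' ->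
  a ++ b ++ a' ++ b' = c ++ d ++ c' ++ d' ->
  [/\ a = c, b = d, a' = c' & b' = d'].
Proof.
move=> H K e.
have cat_eq (x y z t : seq T) : size x = size z -> x ++ y = z ++ t ->
  x = z /\ y = t.
  move=> sz exy; split;
    first by rewrite -(take_size_cat y sz) exy take_size_cat.
  by rewrite -(drop_size_cat y sz) exy drop_size_cat.
have sz := congr1 (find f2) e; rewrite (block_find2 H) (block_find2 K) in sz.
have [-> {}e] := cat_eq _ _ _ _ sz e; rewrite !(catA _ _ b', catA _ _ d') in e.
have {}sz := congr1 (find f1) e; rewrite (block_find1 H) (block_find1 K) in sz.
have [{}e ->] := cat_eq _ _ _ _ sz e.
have {}sz := congr1 (find f2 \o rev) e.
rewrite /= (block_find2_rev H) (block_find2_rev K) in sz.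
(* Both words are nonempty, so equal predecessors give equal lengths. *)
have {}sz : size a' = size c'.
  by move: sz (block_a' H) (block_a' K);
    case: (a') (c') => [|? ?] [|? ?] //= ->.
have [|-> ->] // := cat_eq _ _ _ _ _ e.
by move/(congr1 size): e; rewrite !size_cat sz => /addIn.
Qed.

Definition is_block (w : seq T) : Prop :=
  exists a b a' b', w = a ++ b ++ a' ++ b' /\ block a b a' b'.

Lemma is_block_gt0 w : is_block w -> 0 < size w.
Proof. by case=> a [b [a' [b' [-> /block_a]]]]; case: a. Qed.

Lemma is_block_head w u : is_block w -> head false (map f1 (w ++ u)).
Proof. by case=> a [b [a' [b' [-> /block_a]]]]; case: a. Qed.

Lemma is_block_has w : is_block w -> has f2 w.
Proof.
case=> a [b [a' [b' [-> /block_a']]]]; case: a' => //= e a' h.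
by rewrite !has_cat /= h !orbT.
Qed.

Lemma is_block_marks w u : is_block w -> head false (map f1 u) ->
  crossing_marks w u = true :: nseq (size w).-1 false.
Proof. by case=> a [b [a' [b' [-> /crossing_marks_block]]]]; apply. Qed.

Lemma crossing_head_catl w u : crossing_head w -> crossing_head (w ++ u).
Proof.
case: w => // e w h; rewrite crossing_head_cat // has_predU.
move: h => /= /andP[_ lt]; rewrite orbC has_find (leq_trans lt) //.
exact: find_size.
Qed.

End Marks.

Section BlockSeq.
Variables (T : eqType) (f1 f2 : pred T).
Hypothesis f12 : forall e, f1 e -> ~~ f2 e.
Implicit Types ps qs : seq (seq T).

Let blocks ps := forall w, w \in ps -> is_block f1 f2 w.

Let blocks_shape ps : blocks ps -> all (leq 1) (shape ps).
Proof. by move=> h; rewrite all_map; apply/allP => w /h /is_block_gt0. Qed.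

Let blocks_marks ps u : blocks ps -> head false (map f1 u) ->
  crossing_marks f1 f2 (flatten ps) u = block_marks (shape ps).
Proof.
move=> + hu; elim: ps => //= w ps IH h.
rewrite crossing_marks_cat IH => [|v vps]; last by apply: h;
  rewrite inE vps orbT.
rewrite (is_block_marks f12) //; first by apply: h; rewrite inE eqxx.
case: (ps) h => [|v s] // /(_ v); rewrite !inE eqxx orbT => /(_ isT) hv.
by rewrite -catA (is_block_head _ hv).
Qed.

Let blocks_cyclic_marks ps : blocks ps ->
  crossing_marks f1 f2 (flatten ps) (flatten ps) = block_marks (shape ps).
Proof.
case: ps => // w ps h; apply: blocks_marks => //=.
by apply: is_block_head; apply: h; rewrite inE eqxx.
Qed.

Let blocks_has ps : blocks ps -> 0 < size (flatten ps) ->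
  has (predU f1 f2) (flatten ps).
Proof.
case: ps => //= w ps /(_ w); rewrite inE eqxx => /(_ isT) /is_block_has h _.
by rewrite has_cat has_predU h orbT.
Qed.

(** Marks are intrinsic to the cyclic word, so the rotation carries block boundaries to block
    boundaries. *)
Lemma flatten_blocks_rot ps qs i : blocks ps -> blocks qs ->
  i < size (flatten ps) -> rot i (flatten ps) = flatten qs ->
  exists k, [/\ k < size ps, i = sumn (take k (shape ps)) & qs = rot k ps].
Proof.
move=> hp hq lt e.
have := crossing_marks_rot i (blocks_has hp (leq_ltn_trans (leq0n i) lt)).
rewrite e !blocks_cyclic_marks // => /esym.
case/rot_block_marks; rewrite ?blocks_shape // -?size_flatten //.
move=> k [lk ek et]; exists k; rewrite size_map in lk; split => //.
rewrite -[qs]flattenK et -e ek.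
have -> : rot k (shape ps) = shape (rot k ps) by rewrite /shape map_rot.
by rewrite -flatten_rot flattenK.
Qed.

Lemma count_crossing_head ps (P : pred nat) : blocks ps ->
  (forall i, P i -> crossing_head f1 f2 (rot i (flatten ps))) ->
  count P (iota 0 (size (flatten ps))) =
  count (fun k => P (sumn (take k (shape ps)))) (iota 0 (size ps)).
Proof.
move=> hp hP; rewrite size_flatten count_block_marks ?blocks_shape // ?size_map
  //.
move=> i Pi lt; rewrite -blocks_cyclic_marks // nth_crossing_marks ?size_flatten
  //.
rewrite -{2}(cat_take_drop i (flatten ps)) catA; exact/crossing_head_catl/hP.
Qed.

(** For [qs = ps]: the word and its sequence of blocks have the same rotational multiplicity. *)
Lemma count_rot_blocks ps qs : blocks ps -> blocks qs ->
  count (fun i => rot i (flatten ps) == flatten qs)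
    (iota 0 (size (flatten ps))) =
  count (fun k => rot k ps == qs) (iota 0 (size ps)).
Proof.
move=> hp hq; rewrite size_flatten count_block_marks ?blocks_shape // ?size_map.
  apply: eq_in_count => k; rewrite mem_iota add0n => /andP[_ lk].
  rewrite -flatten_rot; apply/eqP/eqP => [e|-> //].
  rewrite -[rot k ps]flattenK -[qs]flattenK e; congr reshape.
  have hr : blocks (rot k ps) by move=> w; rewrite mem_rot; apply: hp.
  apply: block_marks_inj; rewrite ?blocks_shape //.
  by rewrite -!blocks_cyclic_marks // e.
move=> i /eqP e lt; case: (flatten_blocks_rot hp hq _ e) => [|k [lk -> _]].
  by rewrite size_flatten.
by rewrite nth_block_marks_off ?blocks_shape ?size_map.
Qed.

End BlockSeq.

(** * Counting the rotations of a word *)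

Section CountFibers.
Variables (T T' : eqType).

Lemma sum_count_mem (s r : seq T) : uniq r -> {subset s <= r} ->
  sumn [seq count_mem y s | y <- r] = size s.
Proof.
move=> ur sr; rewrite sumnE big_map -sum1_size.
under eq_bigr do rewrite -sum1_count big_mkcond.
rewrite exchange_big; apply: eq_big_seq => x /sr xr /=.
rewrite -big_mkcond sum1_count (eq_count (a2 := pred1 x)) => [|y].
  by rewrite count_uniq_mem // xr.
by rewrite /= eq_sym.
Qed.

End CountFibers.

Section CountRot.
Variable T : eqType.
Implicit Types (l : seq T) (Q : pred (seq T)).

Lemma count_rot Q k l :
  count (fun i => Q (rot i (rot k l))) (iota 0 (size l)) =
  count (fun i => Q (rot i l)) (iota 0 (size l)).
Proof.
elim: k => [|k IH]; first by rewrite rot0.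
case: (ltnP k (size l)) => [lt|le]; last by rewrite rot_oversize // ltnW.
rewrite -{}IH rotS // -(size_rot k); move: (rot k l) => {lt}l.
case en : (size l) => [|n] //.
(* A shift by one letter raises indices by one; the last index completes a full turn and takes the
   place of index 0. *)
rewrite -{1}[n.+1]addn1 iotaD count_cat /= add0n addn0.
have e : iota 1 n = map succn (iota 0 n) by rewrite -[1]/(1 + 0) iotaDl.
rewrite e count_map addnC rot0; congr (_ + _).
  by rewrite rot_rot -rotS ?en // rot_oversize ?en.
apply: eq_in_count => i; rewrite mem_iota add0n => /andP[_ lt] /=.
by rewrite rot_rot -rotS // en ltnW.
Qed.

Lemma count_rot_eq j k l :
  count (fun i => rot i (rot j l) == rot k l) (iota 0 (size l)) =
  count (fun i => rot i l == l) (iota 0 (size l)).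
Proof.
rewrite (count_rot (fun m => m == rot k l)) -(count_rot (fun m =>
  m == rot k l) k).
by apply: eq_count => i /=; rewrite rot_rot (inj_eq (@rot_inj _ _)).
Qed.

(** Orbit-stabiliser for the cyclic group acting on [l]; the second factor is the multiplicity
    [J]. *)
Lemma size_undup_rots l :
  size (undup [seq rot i l | i <- iota 0 (size l)]) *
  count (fun i => rot i l == l) (iota 0 (size l)) = size l.
Proof.
set s := map _ _; rewrite -[RHS](size_iota 0) -(size_map (fun i =>
  rot i l)) -/s.
rewrite -(@sum_count_mem _ s (undup s)) ?undup_uniq // => [|x];
  last by rewrite mem_undup.
set m := count _ _; rewrite (_ : map _ _ = [seq m | _ <- undup s]).
  by elim: (undup s) => //= _ r <-; rewrite mulSn.
apply/eq_in_map => x; rewrite mem_undup => /mapP[k _ ->].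
by rewrite count_map /m -(count_rot_eq 0 k) rot0.
Qed.

End CountRot.

(** * Isomorphisms of labelled permutations *)

Section Orbits.
Variables (T : finType) (p : {perm T}).

Lemma iter_order_mod i x : iter i p x = iter (i %% fingraph.order p x) p x.
Proof.
rewrite {1}(divn_eq i (fingraph.order p x)) addnC iterD mulnC;
  congr (iter _ p _).
elim: (i %/ _) => [|m IH]; first by rewrite muln0.
by rewrite mulnS iterD IH iter_order //; exact: perm_inj.
Qed.

Lemma findex_iter_mod i x : findex p x (iter i p x) = i %% fingraph.order p x.
Proof. by rewrite iter_order_mod findex_iter // ltn_mod fingraph.order_gt0. Qed.

Lemma orbit_iter_rot i x : i < fingraph.order p x ->
  fingraph.orbit p (iter i p x) = rot i (fingraph.orbit p x).
Proof.
move=> lt; rewrite (fingraph.orbitE (p := rot i (fingraph.orbit p x))).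
- suff -> : index (iter i p x) (rot i (fingraph.orbit p x)) = 0 by rewrite rot0.
  have e : iter i p x = nth x (fingraph.orbit p x) i by rewrite nth_traject.
  by rewrite e /rot (@drop_nth _ x i) ?size_orbit //= eqxx.
- by rewrite rot_cycle; exact/cycle_orbit/perm_inj.
- by rewrite rot_uniq orbit_uniq.
- by rewrite mem_rot -fconnect_orbit fconnect_iter.
Qed.

Lemma card_orbits (A : pred T) (Q : pred T) : (forall x, A (p x) = A x) ->
  #|[pred y | A y && Q y]| =
  \sum_(r | froots p r && A r) count Q (fingraph.orbit p r).
Proof.
move=> cA; have Ac x y : fconnect p x y -> A x = A y.
  by move=> /iter_findex <-; elim: (findex _ _ _) => //= i ->; rewrite cA.
have symp := fconnect_sym (@perm_inj _ p).
rewrite -sum1_card (partition_big (froot p) [pred r | froots p r && A r]) /=.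
  apply: eq_bigr => r /andP[/eqP rr Ar].
  rewrite sum1dep_card -size_filter -(card_uniqP _) ?filter_uniq ?orbit_uniq //.
  apply: eq_card => y; rewrite !inE mem_filter -fconnect_orbit andbC.
  have -> : (froot p y == r) = fconnect p r y.
    by rewrite -{1}rr eq_sym (root_connect symp).
  case: (boolP (fconnect p r y)) => /= [/Ac <-|_]; rewrite ?andbF ?andbT ?Ar //.
move=> y /andP[Ay _]; rewrite roots_root //=.
by rewrite -(Ac y) // connect_root.
Qed.

End Orbits.

Definition orbit_labels (T : finType) X (q : {perm T}) (m : T -> X) x :=
  map m (fingraph.orbit q x).

Section Isomorphisms.
Variables (T : finType) (X K : eqType) (p0 p : {perm T}) (l0 l : T -> X).
Variables (key0 key : T -> K) (J : K -> nat).

Hypothesis key_step : forall y, key (p y) = key y.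

Let key_connect y z : fconnect p y z -> key z = key y.
Proof. by move=> /iter_findex <-; elim: (findex _ _ _) => //= m <-;
  rewrite key_step. Qed.


(** Keys classify the label words of cycles up to rotation, and [J] is the number of rotations
    fixing such a word. *)
Hypothesis key_count : forall x y0,
  count (fun y => orbit_labels p l y == orbit_labels p0 l0 x)
    (fingraph.orbit p y0) =
  if key y0 == key0 x then J (key0 x) else 0.

(* A cycle can be sent onto any remaining cycle with the same key, and onto each
   of them in [J] ways; hence [J k ^ m * m`!] for a key [k] of multiplicity
   [m]. *)
Fixpoint iso_weight (ks : seq K) : nat :=
  if ks is k :: ks' then J k * (count_mem k ks').+1 * iso_weight ks' else 1.

Definition labelled_iso : {set {perm T}} :=
  [set f : {perm T} | [forall x, (f (p0 x) == p (f x)) && (l (f x) == l0 x)]].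

(** An isomorphism is determined by the images of one point per cycle. These are chosen one after
    the other, each choice using up a whole cycle of [p]. *)
Fixpoint iso_images (xs : seq T) (A : pred T) : seq (seq T) :=
  if xs is x :: xs' then
    [seq y :: ys | y <- [seq y <- enum T | A y && (orbit_labels p l y ==
      orbit_labels p0 l0 x)],
                   ys <- iso_images xs' [pred z | A z && ~~ fconnect p y z]]
  else [:: [::]].

Let key_labels x y : orbit_labels p l y = orbit_labels p0 l0 x ->
  key y = key0 x.
Proof.
move=> e; have := key_count x y; case: eqP => // _ /eqP;
  rewrite eqn0Ngt -has_count.
by move=> /hasPn /(_ y (in_orbit _ _)); rewrite e eqxx.
Qed.

Let nkeys (A : pred T) k := #|[pred r | (froots p r && A r) && (key r == k)]|.

Let card_orbit_labels (A : pred T) x : (forall y, A (p y) = A y) ->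
  #|[pred y | A y && (orbit_labels p l y == orbit_labels p0 l0 x)]| =
  J (key0 x) * nkeys A (key0 x).
Proof.
move=> cA; rewrite (card_orbits _ cA).
under eq_bigr do rewrite key_count.
rewrite -big_mkcondr sum_nat_const mulnC; congr (_ * _).
Qed.

Let fconnect_perm y z : fconnect p y (p z) = fconnect p y z.
Proof. by rewrite -same_fconnect1_r //; exact: perm_inj. Qed.

Let nkeys_rem (A : pred T) y k : (forall z, A (p z) = A z) -> A y ->
  nkeys A k = (key y == k) + nkeys [pred z | A z && ~~ fconnect p y z] k.
Proof.
move=> cA Ay; have symp := fconnect_sym (@perm_inj _ p).
have yr : fconnect p y (froot p y) by exact: connect_root.
have Ar : A (froot p y).
  have [m _ <-] : exists2 m, true & iter m p y = froot p y.
    by exists (findex p y (froot p y)); rewrite ?iter_findex.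
  by elim: m => //= m; rewrite cA.
rewrite /nkeys (cardD1 (froot p y)) !inE roots_root //= Ar /= (key_connect yr).
congr (_ + _); apply: eq_card => r; rewrite !inE.
case rr : (froots p r); rewrite ?andbF //= !(andbA, andbC (A r));
  congr (_ && _).
congr (_ && _); congr (~~ _); rewrite -(root_connect symp) (eqP rr) eq_sym //.
Qed.

(** The hypothesis on [nkeys] is the invariant of the induction: for each key, as many cycles of [p]
    are still available as representatives remain to be placed. *)
Lemma size_iso_images xs (A : pred T) : (forall y, A (p y) = A y) ->
  (forall k, nkeys A k = count_mem k (map key0 xs)) ->
  size (iso_images xs A) = iso_weight (map key0 xs).
Proof.
elim: xs A => //= x xs IH A cA nA; rewrite size_allpairs_dep.
set s := seq.filter _ _; have ss y : y \in s -> A y /\ key y = key0 x.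
  by rewrite mem_filter => /andP[/andP[Ay /eqP /key_labels e] _].
have -> : [seq size (iso_images xs [pred z | A z
  & ~~ fconnect p y z]) | y <- s] =
          [seq iso_weight (map key0 xs) | _ <- s].
  apply/eq_in_map => y /ss[Ay ky]; apply: IH => [z|k] /=.
    by rewrite cA fconnect_perm.
  have := nA k; rewrite (nkeys_rem k cA Ay) /= ky.
  by move/addnI.
rewrite (_ : sumn _ = iso_weight (map key0 xs) * size s); last first.
  by elim: (s) => [|y t /= ->]; rewrite ?muln0 // mulnS.
rewrite mulnC; congr (_ * _).
have -> : size s = #|[pred y | A y && (orbit_labels p l y == orbit_labels p0 l0
  x)]|.
  by rewrite cardE /s; congr size; rewrite enumT.
by rewrite card_orbit_labels // nA /= eqxx.
Qed.

Lemma labelled_iso_iter (f : {perm T}) x i : f \in labelled_iso ->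
  f (iter i p0 x) = iter i p (f x).
Proof.
rewrite inE => /forallP fI.
by elim: i => //= i <-; have /andP[/eqP-> _] := fI (iter i p0 x).
Qed.

Lemma labelled_iso_fconnect (f : {perm T}) x y : f \in labelled_iso ->
  fconnect p (f x) (f y) = fconnect p0 x y.
Proof.
move=> fI; apply/idP/idP => /iter_findex.
  by rewrite -labelled_iso_iter // => /perm_inj <-; exact: fconnect_iter.
by move=> <-; rewrite labelled_iso_iter // fconnect_iter.
Qed.

Lemma labelled_iso_labels (f : {perm T}) x : f \in labelled_iso ->
  orbit_labels p l (f x) = orbit_labels p0 l0 x.
Proof.
move=> fI; have fo : fingraph.order p (f x) = fingraph.order p0 x.
  rewrite /fingraph.order -(fintype.card_image (@perm_inj _ f) (fconnect p0 x));
    apply: eq_card => y.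
  rewrite -[y](permKV f) (fintype.mem_image (@perm_inj _ f)).
  exact: labelled_iso_fconnect.
apply: (@eq_from_nth _ (l0 x)); rewrite !size_map !size_orbit // fo => i lt.
rewrite (nth_map (f x)) ?(nth_map x) ?size_orbit ?fo // /fingraph.orbit.
rewrite !nth_traject ?fo // -labelled_iso_iter //.
by move: fI; rewrite inE => /forallP /(_ (iter i p0 x)) /andP[_ /eqP->].
Qed.

Lemma mem_iso_images xs (A : pred T) (f : {perm T}) : f \in labelled_iso ->
  (forall x, x \in xs -> A (f x)) ->
  pairwise (fun x y => ~~ fconnect p0 x y) xs -> map f xs \in iso_images xs A.
Proof.
move=> fI; elim: xs A => //= x xs IH A hA /andP[/allP hx hxs].
apply/allpairsPdep; exists (f x), (map f xs); split => //.
  by rewrite mem_filter mem_enum hA ?inE ?eqxx // labelled_iso_labels // eqxx.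
apply: IH => // y ys; rewrite /= hA ?inE ?ys ?orbT // labelled_iso_fconnect //;
  exact: hx.
Qed.

Lemma iso_imagesP xs (A : pred T) ys : ys \in iso_images xs A ->
  [/\ map (orbit_labels p l) ys = map (orbit_labels p0 l0) xs,
      all A ys & pairwise (fun x y => ~~ fconnect p x y) ys].
Proof.
elim: xs A ys => [|x xs IH] A ys /=; first by rewrite inE => /eqP ->.
case/allpairsPdep => y [zs [+ /IH[e1 e2 e3] ->]] /=.
rewrite mem_filter => /andP[/andP[Ay /eqP ->] _]; rewrite e1 Ay e3 andbT;
  split => //.
  by apply/allP => z /(allP e2) /andP[].
by apply/allP => z /(allP e2) /andP[].
Qed.

(** Images of the representatives extend along the cycles by equivariance; equal label words force
    equal cycle lengths, so the extension closes up. *)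
Lemma iso_of_images xs ys : (forall y, exists2 x, x \in xs & fconnect p0 x y) ->
  pairwise (fun x y => ~~ fconnect p0 x y) xs ->
  ys \in iso_images xs predT -> exists2 f, f \in labelled_iso & map f xs = ys.
Proof.
move=> xsT px /iso_imagesP[el _ py].
have inj0 := @perm_inj _ p0; have inj := @perm_inj _ p.
have sz : size ys = size xs by have := congr1 size el; rewrite !size_map.
pose c z := find (fun x => fconnect p0 x z) xs.
have cP z : c z < size xs /\ fconnect p0 (nth z xs (c z)) z.
  have h : has (fun x => fconnect p0 x z) xs by apply/hasP;
    have [x ? ?] := xsT z; exists x.
  by split; [rewrite -has_find | apply: (nth_find z h)].
(* From the image of the representative of the cycle of [z], make as many steps as lead from that
   representative to [z]. *)
pose F z := iter (findex p0 (nth z xs (c z)) z) p (nth z ys (c z)).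
have labE z k : k < size xs ->
  orbit_labels p l (nth z ys k) = orbit_labels p0 l0 (nth z xs k).
  by move=> lt; rewrite -!(nth_map z [::] _) ?sz // el.
have ordE z k : k < size xs ->
  fingraph.order p (nth z ys k) = fingraph.order p0 (nth z xs k).
  by move=> /labE e; have := congr1 size (e z); rewrite !size_map !size_orbit.
have cstep z : c (p0 z) = c z.
  by apply: eq_find => x; rewrite -same_fconnect1_r.
have Fit z i k : c (iter i p0 (nth z xs k)) = k -> k < size xs ->
    F (iter i p0 (nth z xs k)) = iter i p (nth z ys k).
  move=> ck lt; rewrite /F ck (set_nth_default z) // findex_iter_mod.
  rewrite (set_nth_default z (iter i p0 _)) ?sz //.
  by rewrite -(ordE z) // -iter_order_mod.
have Fp z : F (p0 z) = p (F z).
  have [lt /iter_findex ez] := cP z; rewrite {2}/F -[in LHS]ez -!iterS Fit //.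
  by rewrite iterS ez cstep.
have Fl z : l (F z) = l0 z.
  have [lt /[dup] fz /iter_findex ez] := cP z; rewrite /F.
  set i := findex _ _ _ in ez *; set x := nth z xs _ in fz ez *;
    set y := nth z ys _.
  have li : i < fingraph.order p0 x by exact: findex_max.
  have := congr1 (nth (l0 z) ^~ i) (labE z _ lt); rewrite -/x -/y.
  rewrite (nth_map y) ?(nth_map x) ?size_orbit ?ordE // /fingraph.orbit.
  by rewrite !nth_traject ?ordE // ez.
have symp := fconnect_sym inj; have symp0 := fconnect_sym inj0.
have Fz z : fconnect p (nth z ys (c z)) (F z) by exact: fconnect_iter.
have neq z (r : {perm T}) (zs : seq T) i j : pairwise (fun x y =>
  ~~ fconnect r x y) zs ->
    i < size zs -> j < size zs -> fconnect r (nth z zs i) (nth z zs j) -> i = j.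
  move=> /(pairwiseP z) zP li lj ij; case: (ltngtP i j) => // lt.
    by have := zP _ _ li lj lt; rewrite ij.
  by have := zP _ _ lj li lt; rewrite (fconnect_sym (@perm_inj _ r)) ij.
have Finj : injective F.
  move=> z z' e; have [lt fz] := cP z; have [lt' fz'] := cP z'.
  have cc : c z = c z'.
    apply: (neq z p ys) => //; rewrite ?sz //.
    apply: (connect_trans (Fz z)); rewrite e symp (set_nth_default z') ?sz //.
  rewrite -cc in fz'; rewrite (set_nth_default z') // in fz.
  move: e; rewrite /F -cc (set_nth_default z' z lt).
  have lty : c z < size ys by rewrite sz.
  rewrite (set_nth_default z' z lty) => e.
  have := congr1 (findex p (nth z' ys (c z))) e.
  rewrite !findex_iter ?ordE ?findex_max // => ei.
  by rewrite -(iter_findex fz) ei iter_findex.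
exists (perm Finj).
  by rewrite inE; apply/forallP => x; rewrite !permE Fp Fl !eqxx.
case: (posnP (size xs)) => [/size0nil xs0|]; first by move: sz; rewrite xs0;
  case: (ys).
case exs : xs => [|x0 xs'] // _; rewrite -exs.
apply: (@eq_from_nth _ x0); rewrite size_map ?sz // => k lt.
rewrite (nth_map x0) // permE -[nth x0 xs k]/(iter 0 p0 _).
have ck : c (nth x0 xs k) = k.
  have [lt' fz] := cP (nth x0 xs k); apply: (neq x0 p0 xs) => //.
  by rewrite (set_nth_default (nth x0 xs k) x0 lt').
have := @Fit x0 0 k ck lt; rewrite /= => ->.
by [].
Qed.

Theorem card_labelled_iso xs :
  (forall y, exists2 x, x \in xs & fconnect p0 x y) ->
  pairwise (fun x y => ~~ fconnect p0 x y) xs ->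
  (forall k, #|[pred r | froots p r && (key r == k)]| =
    count_mem k (map key0 xs)) ->
  #|labelled_iso| = iso_weight (map key0 xs).
Proof.
move=> xsT px nk; rewrite -(@size_iso_images xs predT) => [|//|k]; last first.
  by rewrite -nk; apply: eq_card => r; rewrite !inE andbT.
rewrite cardE -(size_map (fun f : {perm T} => map f xs)).
apply: perm_size; apply: uniq_perm.
- rewrite map_inj_in_uniq ?enum_uniq // => f g.
  rewrite !mem_enum !inE => /forallP fI /forallP gI /eq_in_map fg.
  apply/permP => y; have [x xs_x /iter_findex <-] := xsT y.
  elim: (findex _ _ _) => [|i IH] /=; first exact: fg.
  have /andP[/eqP-> _] := fI (iter i p0 x);
    have /andP[/eqP-> _] := gI (iter i p0 x).
  by rewrite IH.
- elim: (xs) (predT : pred T) => //= x zs IH A.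
  apply: allpairs_uniq_dep => //; first by rewrite filter_uniq ?enum_uniq.
  by move=> [y us] [z vs] _ _ /= [-> ->].
- move=> ys; apply/mapP/idP => [[f]|].
    by rewrite mem_enum => fI ->; apply: mem_iso_images.
  by move=> /(iso_of_images xsT px)[f fI <-]; exists f; rewrite ?mem_enum.
Qed.

End Isomorphisms.

(** * Permutations with prescribed cycles *)

Section PermOfCycles.
Variables (T : finType) (cs : seq (seq T)).
Hypotheses (cs_uniq : uniq (flatten cs)) (cs_cov : forall x, x \in flatten cs).

Let cyc x := nth [::] cs (find (fun c => x \in c) cs).

Let mem_cyc x : x \in cyc x.
Proof.
have h : has (fun c => x \in c) cs by have /flattenP[c ? ?] := cs_cov x;
  apply/hasP; exists c.
exact: (nth_find [::] h).
Qed.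

Let cyc_in x : cyc x \in cs.
Proof.
apply: mem_nth; rewrite -has_find.
by have /flattenP[c ? ?] := cs_cov x; apply/hasP; exists c.
Qed.

Let cycE c x : c \in cs -> x \in c -> cyc x = c.
Proof.
rewrite /cyc; elim: (cs) cs_uniq => //= d s IH;
  rewrite cat_uniq => /and3P[_ /hasPn h us].
rewrite inE => /orP[/eqP -> -> //|cs_c xc].
rewrite ifN; first exact: IH.
by apply: h; apply/flattenP; exists c.
Qed.

Let cyc_uniq c : c \in cs -> uniq c.
Proof.
elim: (cs) cs_uniq => //= d s IH;
  rewrite cat_uniq inE => /and3P[ud _ us] /orP[/eqP ->|] //.
exact: IH.
Qed.

Let step x := next (cyc x) x.

Let step_inj : injective step.
Proof.
move=> x y e; have hx : step x \in cyc x by rewrite mem_next.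
have hy : step x \in cyc y by rewrite e mem_next.
have exy : cyc x = cyc y by rewrite -(cycE (cyc_in x) hx) (cycE (cyc_in y) hy).
have := congr1 (prev (cyc x)) e; rewrite /step -exy !prev_next //;
  exact/cyc_uniq/cyc_in.
Qed.

Lemma perm_of_cycles : exists p : {perm T}, forall x c, x :: c \in cs ->
  fingraph.orbit p x = x :: c.
Proof.
exists (perm step_inj) => x c hc; have uc := cyc_uniq hc.
rewrite (fingraph.orbitE (p := x :: c)) ?mem_head //=;
  first by rewrite eqxx rot0.
rewrite -[path _ _ _]/(path.cycle _ (x :: c)).
have := cycle_next uc;
  apply: (@sub_in_cycle _ (mem (x :: c))) => [y z yc _ /= /eqP <-|].
  by rewrite permE /step (cycE hc yc).
exact/allP.
Qed.

End PermOfCycles.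

(** The letters of [flatten ss] are numbered in order of appearance; each word becomes a cycle,
    represented by its first position. *)
Lemma labelled_perm_of_cycles (X : Type) (n : nat) (ss : seq (seq X)) :
  size (flatten ss) = n -> all (fun s => 0 < size s) ss ->
  exists (p : 'S_n) (l : 'I_n -> X) (xs : seq 'I_n),
    [/\ forall y, exists2 x, x \in xs & fconnect p x y,
        pairwise (fun x y => ~~ fconnect p x y) xs,
        map (orbit_labels p l) xs = ss &
        map l (enum 'I_n) = flatten ss].
Proof.
move=> <-; set m := size _ => ss0.
pose cs := reshape (shape ss) (enum 'I_m).
have sm : size (enum 'I_m) =
  sumn (shape ss) by rewrite size_enum_ord /m size_flatten.
have fcs : flatten cs = enum 'I_m by rewrite reshapeKr // sm.
have shcs : shape cs = shape ss by rewrite reshapeKl // sm.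
have ucs : uniq (flatten cs) by rewrite fcs enum_uniq.
have ccs x : x \in flatten cs by rewrite fcs mem_enum.
have [p hp] := perm_of_cycles ucs ccs.
have cs0 c : c \in cs -> c != [::].
  have : all (leq 1) (shape cs) by rewrite shcs all_map.
  by move=> /allP h cc; have := h _ (map_f size cc); case: (c).
pose xs := pmap ohead cs.
have oxs : map (fingraph.orbit p) xs = cs.
  rewrite /xs; elim: (cs) cs0 hp => // c ds IH h0 h1 /=.
  case: c h0 h1 => [|x c] h0 h1; first by have := h0 _ (mem_head _ _).
  rewrite /= (h1 x c) ?mem_head // IH // => [d hd|y d hd].
    by apply: h0; rewrite inE hd orbT.
  by apply: h1; rewrite inE hd orbT.
exists p, (tnth (in_tuple (flatten ss))), xs; split.
- move=> y; have /flattenP[c hc yc] := ccs y.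
  by move: hc; rewrite -oxs => /mapP[x hx ec]; exists x;
    rewrite // fconnect_orbit -ec.
- move: ucs; rewrite -oxs; elim: (xs) => //= x s IH;
    rewrite cat_uniq => /and3P[_ /hasPn h us].
  rewrite IH // andbT; apply/allP => y ys; rewrite fconnect_orbit; apply: h.
  by apply/flattenP; exists (fingraph.orbit p y); rewrite ?map_f ?in_orbit.
- rewrite /orbit_labels (map_comp (map (tnth (in_tuple (flatten ss))))
    (fingraph.orbit p)) oxs.
  rewrite /cs map_reshape map_tnth_enum; exact: flattenK.
- exact: map_tnth_enum.
Qed.

(** * Decomposition of a loop along its crossings *)

Local Open Scope quotient_scope.
Local Open Scope classical_set_scope.

Section Walks.
Variable G : ograph.
Implicit Types (x y z : vertex G) (b l : seq (edge G)) (D : subgraph G).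

Lemma walk_cat x b1 b2 z :
  walk x (b1 ++ b2) z <-> exists2 y, walk x b1 y & walk y b2 z.
Proof.
elim: b1 x => [|e b1 IH] x /=.
  by split=> [h|[y /eqP->]//]; exists x.
split=> [/andP[-> /IH[y h1 h2]]|[y /andP[-> h1] h2]]; first by exists y.
by apply/IH; exists y.
Qed.

Lemma walk_cat1 x b1 b2 y z : walk x b1 y -> walk y b2 z -> walk x (b1 ++ b2) z.
Proof. by move=> h1 h2; apply/walk_cat; exists y. Qed.

Lemma walk_end x b y : walk x b y -> y = last x [seq tgt e | e <- b].
Proof. by elim: b x => [|e b IH] x /= => [/eqP|/andP[_ /IH]]. Qed.

Lemma walk_fun x b y z : walk x b y -> walk x b z -> y = z.
Proof. by move=> /walk_end -> /walk_end ->. Qed.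

Lemma walk_start x e b y : walk x (e :: b) y -> src e = x.
Proof. by case/andP => /eqP. Qed.

Lemma closed_walkP l : closed_walk l <-> l != [::] /\ exists x, walk x l x.
Proof.
case: l => [|e l]; first by split => // -[].
split=> [h|[_ [x h]]]; first by split => //; exists (src e).
by rewrite /closed_walk (walk_start h).
Qed.

Lemma closed_walk_rot i l : closed_walk (rot i l) = closed_walk l.
Proof.
have imp j (m : seq (edge G)) : closed_walk m -> closed_walk (rot j m).
  move=> /closed_walkP[m0 [x]]; rewrite -[in walk _ _ _](cat_take_drop j m).
  move=> /walk_cat[y h1 h2]; apply/closed_walkP; split.
    by rewrite -size_eq0 size_rot size_eq0.
  by exists y; apply: walk_cat1 h2 h1.
apply/idP/idP; last exact: imp.
by move=> /(imp (size (rot i l) - i)); rewrite -/(rotr _ _) rotK.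
Qed.

Lemma bridges_cat D x y z b1 b2 :
  bridges D x y b1 -> bridges D y z b2 -> bridges D x z (b1 ++ b2).
Proof.
move=> [Dx Dy w1 h1] [_ Dz w2 h2]; split => //; first exact: walk_cat1 w1 w2.
by move=> e; rewrite mem_cat => /orP[/h1|/h2].
Qed.

(* [None] when [l] is not a closed walk. *)
Definition cls l : option (uloop G) :=
  omap (@uclass G) (insub l : option (rloop G)).

Lemma uclass_eq (l l' : rloop G) : uclass l = uclass l' <->
  exists i, val l' = rot i (val l).
Proof.
by split=> [/eqquotP/rerootP|h]; last apply/eqquotP/rerootP.
Qed.

Lemma uclass_uedges (l : rloop G) : exists i, val l = rot i (uedges (uclass l)).
Proof. by apply/uclass_eq; rewrite /uclass reprK. Qed.

Lemma uedges_closed (L : uloop G) : closed_walk (uedges L).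
Proof. exact: valP. Qed.

Lemma clsP l L : cls l = Some L <-> exists i, l = rot i (uedges L).
Proof.
rewrite /cls; case: insubP => [u ul <-|ncl] /=; split => //.
- by case=> <-; exact: uclass_uedges.
- move=> [i e]; congr Some; rewrite -[RHS]reprK; apply/esym/uclass_eq.
  by exists i.
- by move=> [i e]; rewrite e closed_walk_rot uedges_closed in ncl.
Qed.

Lemma cls_uedges (L : uloop G) : cls (uedges L) = Some L.
Proof. by apply/clsP; exists 0%N; rewrite rot0. Qed.

Lemma cls_rot i l : cls (rot i l) = cls l.
Proof.
case e : (cls l) => [L|].
  move/clsP: e => [j ->]; apply/clsP; exists (rot_add (uedges L) j i).
  by rewrite rot_rot_add.
case e' : (cls (rot i l)) => [L|] //; move/clsP: e' => [j e'].
suff : cls l = Some L by rewrite e.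
apply/clsP; rewrite -[l](rotK i) e' /rotr.
by eexists; rewrite rot_rot_add.
Qed.

(** The multiplicity [J(L)]; 0 is a default value for words that are not loops. *)
Definition loop_period (k : option (uloop G)) : nat :=
  if k is Some L then count (fun i =>
    rot i (uedges L) == uedges L) (iota 0 (size (uedges L)))
  else 0.

(** Both words are rotations of one representative, or no rotation takes one to the other. *)
Lemma count_rot_cls l l' : closed_walk l -> closed_walk l' ->
  count (fun i => rot i l == l') (iota 0 (size l)) =
  if cls l == cls l' then loop_period (cls l') else 0.
Proof.
move=> cl cl'; case: eqP => [e|ne].
  have [L eL] : exists L, cls l' = Some L.
    by rewrite /cls insubT /=; eexists.
  rewrite eL /=; rewrite eL in e; move/clsP: e => [k ->];
    move/clsP: eL => [k' ->].
  by rewrite size_rot count_rot_eq.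
apply/eqP; rewrite -leqn0 leqNgt -has_count; apply/hasPn => i _.
by apply/eqP => e; apply: ne; rewrite -e cls_rot.
Qed.

End Walks.

(* A loop meeting both sets is a cyclic sequence of pieces, each consisting of a
   crossing from [F1] to [F2], a bridge in [D] minus [F1], a crossing from [F2]
   to [F1] and a bridge in [D] minus [F2]. *)
Definition piece (G : ograph) : Type :=
  ((portion G * seq (edge G)) * (portion G * seq (edge G)))%type.

Definition word (G : ograph) (p : piece G) : seq (edge G) :=
  p.1.1.2 ++ p.1.2 ++ p.2.1.2 ++ p.2.2.

Section Pieces.
Variables (G : ograph) (D : subgraph G) (F1 F2 : set (vertex G)).

(** [crossing] does not mention [D], hence the condition on the edges of [a]. In use, [y] is the
    start of the next crossing. *)
Definition half_piece (F F' : set (vertex G)) (a : portion G) (b : seq (edge G))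
    (y : vertex G) : Prop :=
  [/\ crossing F F' a, forall e, e \in a.2 -> eset D e
    & bridges (remove D F) (pend a) y b].

Definition linked (p q : piece G) : Prop :=
  half_piece F1 F2 p.1.1 p.1.2 (pstart p.2.1) /\
  half_piece F2 F1 p.2.1 p.2.2 (pstart q.1.1).

End Pieces.

Section Blocks.
Variables (G : ograph) (D : subgraph G).
Implicit Types (F : set (vertex G)).

Definition inF F : pred (edge G) := fun e => src e \in F.

Lemma inF_disj F1 F2 : F1 `&` F2 = set0 -> forall e, inF F1 e -> ~~ inF F2 e.
Proof.
move=> F12 e; rewrite /inF !inE => h1; apply/negP; rewrite inE => h2.
by have : (F1 `&` F2) (src e) by []; rewrite F12.
Qed.

Lemma half_piece_block F1 F2 a b a' b' y y' :
  half_piece D F1 F2 a b y -> half_piece D F2 F1 a' b' y' ->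
  block (inF F1) (inF F2) a.2 b a'.2 b'.
Proof.
have aux F F' c d z : half_piece D F F' c d z ->
    [/\ head false (map (inF F) c.2), ~~ has (predU (inF F) (inF F'))
      (behead c.2),
        ~~ has (inF F) d & nilp d || head false (map (inF F') d)].
  case=> [[c0 wc Fc Fc' ci] _ [_ _ wd hd]]; split.
  - case: (c.2) c0 wc => //= e s _ /andP[/eqP es _].
    by rewrite /inF es; apply/mem_set.
  - apply/hasPn => e /ci[h1 h2] /=; rewrite negb_or /inF.
    by apply/andP; split; apply/negP; rewrite inE.
  - by apply/hasPn => e /hd[_ [h _]]; apply/negP; rewrite /inF inE.
  - by case: d wd {hd} => //= e s /andP[/eqP es _]; rewrite /inF es;
      apply/mem_set.
move=> /aux[h1 h2 h3 h4] /aux[h1' h2' h3' h4']; split => //.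
by move: h2'; rewrite !has_predU orbC.
Qed.

Lemma linked_block F1 F2 p q : linked D F1 F2 p q ->
  block (inF F1) (inF F2) p.1.1.2 p.1.2 p.2.1.2 p.2.2.
Proof. by case=> h1 h2; exact: half_piece_block h1 h2. Qed.

Lemma linked_is_block F1 F2 p q : linked D F1 F2 p q ->
  is_block (inF F1) (inF F2) (word p).
Proof. by move=> /linked_block h; do 4!eexists; split; [|exact: h]. Qed.

Lemma crossing_start F F' (a : portion G) : crossing F F' a ->
  Some a.1 = ohead (map (@src G) a.2).
Proof. by case=> + + _ _ _; case: (a.2) => //= e s _ /andP[/eqP -> _]. Qed.

Lemma crossing_inj F F' E E' (a c : portion G) : crossing F F' a ->
  crossing E E' c ->
  a.2 = c.2 -> a = c.
Proof.
move=> /crossing_start h /crossing_start h' e.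
by case: a c e h h' => [a1 a2] [c1 c2] /= -> <- [->].
Qed.

Lemma word_inj F1 F2 p q p' q' : F1 `&` F2 = set0 ->
  linked D F1 F2 p q -> linked D F1 F2 p' q' ->
  word p = word p' -> p = p'.
Proof.
move=> F12 h h' /(block_inj (inF_disj F12) (linked_block h) (linked_block h')).
case: h h' => [[h1 _ _] [h2 _ _]] [[h1' _ _] [h2' _ _]] [e1 e2 e3 e4].
rewrite [p]surjective_pairing [p.1]surjective_pairing [p.2]surjective_pairing.
rewrite [p']surjective_pairing [p'.1]surjective_pairing
  [p'.2]surjective_pairing.
by rewrite (crossing_inj h1 h1' e1) (crossing_inj h2 h2' e3) e2 e4.
Qed.

Lemma linked_walk F1 F2 p q : linked D F1 F2 p q ->
  walk (pstart p.1.1) (word p) (pstart q.1.1).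
Proof.
case=> [[[_ w1 _ _ _] _ [_ _ w2 _]] [[_ w3 _ _ _] _ [_ _ w4 _]]].
apply: walk_cat1 w1 _; apply: walk_cat1 w2 _; exact: walk_cat1 w3 w4.
Qed.

Lemma linked_edges F1 F2 p q : linked D F1 F2 p q ->
  forall e, e \in word p -> eset D e.
Proof.
case=> [[_ h1 [_ _ _ h2]] [_ h3 [_ _ _ h4]]] e.
by rewrite !mem_cat => /or4P[/h1|/h2[]|/h3|/h4[]].
Qed.

End Blocks.

Section SplitLast.
Variables (T : Type) (p : pred T).

Lemma split_last s : has p s ->
  exists s1 x s2, [/\ s = s1 ++ x :: s2, p x & ~~ has p s2].
Proof.
elim: s => //= x s IH;
  case: (boolP (has p s)) => [/IH[s1 [y [s2 [-> py h]]]] _|h].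
  by exists (x :: s1), y, s2.
by rewrite orbF => px; exists [::], x, s.
Qed.

Lemma split_first s : has p s ->
  exists s1 x s2, [/\ s = s1 ++ x :: s2, p x & ~~ has p s1].
Proof.
elim: s => //= x s IH;
  case: (boolP (p x)) => [px _|px /IH[s1 [y [s2 [-> py h]]]]].
  by exists [::], x, s.
by exists (x :: s1), y, s2; rewrite /= negb_or px.
Qed.

End SplitLast.

Definition piece_link (G : ograph) (D : subgraph G)
  (F1 F2 : set (vertex G)) : rel (piece G) :=
  fun p q => `[< linked D F1 F2 p q >].

Section Decomposition.
Variables (G : ograph) (D : subgraph G) (F1 F2 : set (vertex G)).
Hypotheses (F12 : F1 `&` F2 = set0) (F1D : F1 `<=` vset D)
  (F2D : F2 `<=` vset D).

Let F1N2 x : F1 x -> ~ F2 x.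
Proof. by move=> h1 h2; have : (F1 `&` F2) x by []; rewrite F12. Qed.

(** The condition on [b] concerns sources only; the target of an edge is the source of the next one,
    or [y] for the last. *)
Lemma bridges_remove F x y b : walk x b y -> vset D x -> vset D y ->
  (forall e, e \in b -> eset D e) -> ~ F x -> ~ F y -> ~~ has (inF F) b ->
  bridges (remove D F) x y b.
Proof.
move=> w Dx Dy hD Fx Fy hF; split => // e eb; split; first exact: hD.
elim: b x w eb hF {Dx Fx hD} => //= e' b IH x /andP[/eqP es w].
rewrite inE negb_or => /orP[/eqP->|eb] /andP[he hb]; last exact: IH w eb hb.
split; first by move=> h; move/negP: he; apply; exact: mem_set.
case: b w hb {IH} => [/eqP -> //|e2 b /walk_start <-] /= /norP[h _] h'.
by move/negP: h; apply; exact: mem_set.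
Qed.

(* [b] followed by the pieces [ps] leads from [x] to [z]; the last component of
   a piece is the bridge that precedes the next one. *)
Fixpoint chained x b (ps : seq (piece G)) z : Prop :=
  if ps is p :: ps' then
    [/\ bridges (remove D F2) x (pstart p.1.1) b,
        half_piece D F1 F2 p.1.1 p.1.2 (pstart p.2.1),
        crossing F2 F1 p.2.1, (forall e, e \in p.2.1.2 -> eset D e)
      & chained (pend p.2.1) p.2.2 ps' z]
  else bridges (remove D F2) x z b.

Lemma crossingI F F' x e b y : walk x (e :: b) y -> F x -> F' y ->
  ~~ has (inF F) b -> ~~ has (inF F') b ->
  let a : portion G := (x, e :: b) in crossing F F' a /\ pend a = y.
Proof.
move=> w Fx Fy h h' a; have ey : pend a = y by rewrite (walk_end w).
split => //; split; rewrite ?ey // => e' /= be'.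
by split=> hF; [move/hasPn: h | move/hasPn: h'] => /(_ _ be') /negP; apply;
  exact: mem_set.
Qed.

(** Induction on length. The first visit to [F2] ends a crossing begun at the last earlier visit to
    [F1]; the next return to [F1] ends a crossing begun at the last visit to [F2] before it. The
    rest of the walk starts in [F1] again. *)
Lemma walk_chained x w z : F1 x -> F1 z -> walk x w z ->
  (forall e, e \in w -> eset D e) ->
  exists b ps, w = b ++ flatten (map (@word G) ps) /\ chained x b ps z.
Proof.
have [n] := ubnP (size w); elim: n w x => // n IH w x lt Fx Fz wk hD.
case: (boolP (has (inF F2) w)) => [|h2]; last first.
  exists w, [::]; rewrite cats0; split => //=.
  by apply: bridges_remove => //;
    [exact: F1D|exact: F1D|exact: F1N2|exact: F1N2].
case/split_first => u [e2 [v [ew f2 hu]]].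
move: (wk); rewrite {1}ew => /walk_cat[y wu wv].
have ey := walk_start wv; have Fy : F2 y by rewrite -ey; exact: set_mem.
have : has (inF F1) u.
  case: u wu {ew hu} => [/eqP xy|e u /walk_start ex].
    by case: (F1N2 Fx); rewrite xy.
  by rewrite /= /inF ex mem_set.
case/split_last => b0 [e1 [a0 [eu f1 ha0]]].
move: (wu); rewrite {1}eu => /walk_cat[x' wb0 wa].
have ex' := walk_start wa; have Fx' : F1 x' by rewrite -ex'; exact: set_mem.
(* The return to [F1] is the source of a later edge or, failing that, the endpoint [z], with [v2]
   empty. *)
have [v1 [v2 [y2 [ev wv1 wv2 Fy2 hv1]]]] : exists v1 v2 y2,
    [/\ e2 :: v = v1 ++ v2, walk y v1 y2, walk y2 v2 z, F1 y2
      & ~~ has (inF F1) v1].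
  case: (boolP (has (inF F1) (e2 :: v))) =>
    [/split_first[v1 [e3 [v2 [ev f3 h]]]]|h].
    move: (wv); rewrite {1}ev => /walk_cat[y2 w1 w2]; exists v1, (e3 :: v2), y2.
    by split => //; rewrite -(walk_start w2); exact: set_mem.
  by exists (e2 :: v), [::], z; rewrite cats0 /=; split => //=.
have : has (inF F2) v1.
  case: v1 wv1 ev {hv1} => [/eqP yy _|e v1 _ [<- _]]; last by rewrite /= f2.
  by case: (F1N2 Fy2); rewrite -yy.
case/split_last => b [e3 [a1 [ev1 f3 ha1]]].
move: (wv1); rewrite {1}ev1 => /walk_cat[y3 wb wa'].
have ey3 := walk_start wa'; have Fy3 : F2 y3 by rewrite -ey3; exact: set_mem.
have eW : w = b0 ++ (e1 :: a0) ++ b ++ (e3 :: a1) ++ v2.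
  by rewrite ew eu ev ev1 -!catA.
have [b' [ps [ev2 ch]]] : exists b' ps, v2 = b' ++ flatten (map (@word G) ps) /\
  chained y2 b' ps z.
  apply: IH => //; last by move=> e he; apply: hD; rewrite eW !mem_cat he !orbT.
  move: lt; rewrite eW ltnS; apply: leq_trans.
  by rewrite !size_cat /= addSn addnS ltnS !addnA leq_addl.
move: hu hv1; rewrite eu ev1 !has_cat /= !negb_or =>
  /and3P[hb0 _ ha02] /and3P[hb _ ha11].
have [cr e1y] := crossingI wa Fx' Fy ha0 ha02.
have [cr' e3y] := crossingI wa' Fy3 Fy2 ha1 ha11.
pose p : piece G := (((x', e1 :: a0), b), ((y3, e3 :: a1), b')).
exists b0, (p :: ps); split.
  have -> : flatten (map (@word G) (p :: ps)) =
      ((e1 :: a0) ++ b ++ (e3 :: a1) ++ b') ++ flatten (map (@word G) ps) by [].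
  by rewrite eW ev2 -!catA.
have sub s : {subset s <= w} -> forall e, e \in s ->
  eset D e by move=> h e /h /hD.
have F2N1 t : F2 t -> ~ F1 t by move=> h2 h1; exact: (F1N2 h1 h2).
split => //=.
- apply: bridges_remove => //; rewrite /pstart /=; auto.
  by apply: sub => e; rewrite eW mem_cat => ->.
- split => //; first by apply: sub => e he; rewrite eW !mem_cat he !orbT.
  rewrite e1y /pstart /=; apply: bridges_remove => //; auto.
  by apply: sub => e he; rewrite eW !mem_cat he !orbT.
- by apply: sub => e he; rewrite eW !mem_cat he !orbT.
- by rewrite e3y.
Qed.

(** Closes the chain: a root in [F1] may sit in the middle of a bridge, whose second half has to be
    joined to the end of the last piece. *)
Lemma chained_cat x b ps z b' z' : chained x b ps z ->
  bridges (remove D F2) z z' b' ->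
  ps != [::] -> exists ps',
    [/\ flatten (map (@word G) ps') = flatten (map (@word G) ps) ++ b',
    chained x b ps' z' & map (fun p => p.1) ps' = map (fun p => p.1) ps].
Proof.
elim: ps x b => // p [|q ps] IH x b.
  move=> [h1 h2 h3 h4 h5] hb _; exists [:: (p.1, (p.2.1, p.2.2 ++ b'))].
  rewrite /= !cats0 /word /= -!catA; split => //.
  by split => //=; exact: bridges_cat h5 hb.
move=> [h1 h2 h3 h4 h5] hb _; case: (IH _ _ h5 hb isT) => ps' [e1 e2 e3].
by exists (p :: ps'); rewrite [flatten _]/= e1 /= -!catA e3; split.
Qed.

Lemma chained_path p ps q : crossing F2 F1 p.2.1 -> (forall e, e \in p.2.1.2 ->
  eset D e) ->
  half_piece D F1 F2 p.1.1 p.1.2 (pstart p.2.1) ->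
  chained (pend p.2.1) p.2.2 ps (pstart q.1.1) ->
  path (piece_link D F1 F2) p (rcons ps q).
Proof.
elim: ps p => [|r ps IH] p c1 c2 c3 /=.
  by move=> h; rewrite andbT; apply/asboolP; split.
move=> [h1 h2 h3 h4 h5]; apply/andP; split; last exact: IH.
by apply/asboolP; split.
Qed.

Lemma closed_walk_pieces l : closed_walk l -> (forall e, e \in l -> eset D e) ->
  has (inF F1) l -> has (inF F2) l ->
  exists ps i, [/\ ps != [::], path.cycle (piece_link D F1 F2) ps
                 & flatten (map (@word G) ps) = rot i l].
Proof.
move=> cl hD h1 h2; have [u [e [v [el f1 _]]]] := split_first h1.
have er : rot (size u) l = e :: (v ++ u) by rewrite el rot_size_cat.
have : closed_walk (rot (size u) l) by rewrite closed_walk_rot.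
rewrite er /closed_walk => wk; have Fe : F1 (src e) by exact: set_mem.
have hD' e' : e' \in e :: v ++ u -> eset D e' by rewrite -er mem_rot; exact: hD.
have [b [ps [eW ch]]] := walk_chained Fe Fe wk hD'.
have ps0 : ps != [::].
  (* Without any piece the loop would be a single bridge in [D] minus [F2], yet it visits [F2]. *)
  apply/eqP => ps0; move: ch eW; rewrite ps0 /= cats0 => -[_ _ _ hb] eb.
  have : has (inF F2) b by rewrite -eb -er has_rot.
  by case/hasP => e' /hb[_ [h _]] /set_mem.
case eps : ps ps0 => [|p qs] // _.
have hb : bridges (remove D F2) (src e) (pstart p.1.1) b by move: ch;
  rewrite eps => -[].
have [|ps' [e1 e2 e3]] := chained_cat ch hb; first by rewrite eps.
have wE : flatten (map (@word G) ps) = drop (size b)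
  (e :: v ++ u) by rewrite eW drop_size_cat.
have bE : b = take (size b) (e :: v ++ u) by rewrite eW take_size_cat.
(* The first rotation puts the root in [F1]; the second moves it past the initial bridge [b] to the
   start of a crossing. *)
exists ps', (rot_add l (size u) (size b)).
rewrite -rot_rot_add er /rot -wE -bE e1.
case: ps' {e1} e2 e3 => [|p' qs'] e2 e3; first by rewrite eps in e3.
have ep : p'.1 = p.1 by move: e3; rewrite eps => -[].
move: e2 => [k1 k2 k3 k4 k5]; split => //.
by apply: chained_path => //; rewrite /pstart ep.
Qed.

End Decomposition.

Lemma cycle_zip (T : eqType) (e : rel T) s x : path.cycle e s ->
  x \in zip s (rot 1 s) -> e x.1 x.2.
Proof.
have gen v w t : path e w (rcons t v) -> x \in zip (w :: t) (rcons t v) ->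
  e x.1 x.2.
  elim: t w => [|z t IH] w /=; first by rewrite andbT inE => h /eqP ->.
  by move=> /andP[wz zs]; rewrite inE => /orP[/eqP -> //|]; exact: IH zs.
by case: s => // y s; rewrite rot1_cons; exact: gen.
Qed.

(* Exchanges the roles of the two kinds of crossings, by cutting the loop at the
   crossings from [F2] to [F1] instead. *)
Lemma flatten_zip_rot (T U : Type) (f g : T -> seq U) (s : seq T) :
  exists j, flatten [seq g x.1 ++ f x.2 | x <- zip s (rot 1 s)] =
            rot j (flatten [seq f x ++ g x | x <- s]).
Proof.
case: s => [|y s]; first by exists 0.
exists (size (f y)); rewrite [flatten (map _ (y :: s))]/= -catA rot_size_cat
  rot1_cons.
suff gen v w : flatten [seq g x.1 ++ f x.2 | x <- zip (w :: s) (rcons s v)] =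
    (g w ++ flatten [seq f x ++ g x | x <- s]) ++ f v by exact: gen.
elim: s w => [|z s IH] w /=; first by rewrite !cats0.
by rewrite IH -!catA.
Qed.

Section PieceCycles.
Variables (G : ograph) (D : subgraph G) (F1 F2 : set (vertex G)).
Hypotheses (F12 : F1 `&` F2 = set0) (F1D : F1 `<=` vset D)
  (F2D : F2 `<=` vset D).
Implicit Types (ps qs : seq (piece G)).
Local Notation link := (piece_link D F1 F2).

Definition loop_of ps : seq (edge G) := flatten (map (@word G) ps).

Lemma cycle_linked ps p : path.cycle link ps -> p \in ps ->
  exists q, linked D F1 F2 p q.
Proof. by move=> c ps_p; exists (next ps p); apply/asboolP;
  exact: (next_cycle c). Qed.

Lemma cycle_blocks ps : path.cycle link ps ->
  forall w, w \in map (@word G) ps -> is_block (inF F1) (inF F2) w.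
Proof. by move=> c w /mapP[p /(cycle_linked c)[q /linked_is_block h] ->]. Qed.

Lemma loop_of_walk p s q : path link p (rcons s q) ->
  walk (pstart p.1.1) (loop_of (p :: s)) (pstart q.1.1).
Proof.
elim: s p => [|r s IH] p /=.
  by rewrite /loop_of /= cats0 andbT => /asboolP /linked_walk.
by move=> /andP[/asboolP /linked_walk w /IH]; exact: walk_cat1.
Qed.

Lemma loop_of_has ps : path.cycle link ps -> ps != [::] ->
  has (inF F1) (loop_of ps) /\ has (inF F2) (loop_of ps).
Proof.
case: ps => // p s c _; have [|q /linked_block b] := cycle_linked (p := p) c.
  by rewrite inE eqxx.
rewrite /loop_of /= !has_cat; case: b; case: (p.1.1.2) => //= e a -> _ _ _.
by case: (p.2.1.2) => //= e' a' -> _ _ _; rewrite !orbT.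
Qed.

Lemma loop_of_closed ps : path.cycle link ps -> ps != [::] ->
  closed_walk (loop_of ps).
Proof.
move=> c ps0; apply/closed_walkP; split.
  by have [h _] := loop_of_has c ps0; apply/eqP => e; rewrite e in h.
by case: ps c ps0 => // p s /loop_of_walk w _; exists (pstart p.1.1).
Qed.

Lemma loop_of_edges ps : path.cycle link ps -> forall e, e \in loop_of ps ->
  eset D e.
Proof.
move=> c e /flattenP[w /mapP[p /(cycle_linked c)[q h] ->]];
  exact: linked_edges h _.
Qed.

Lemma cls_meets_both l L : (forall e, e \in l -> eset D e) ->
  has (inF F1) l -> has (inF F2) l -> cls l = Some L -> meets_both D F1 F2 L.
Proof.
move=> hD h1 h2 /[dup] /clsP[i el]; rewrite /cls;
  case: insubP => // r _ er [eL].
have vis F : has (inF F) l -> visits F L.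
  by rewrite el has_rot => /hasP[e he fe]; exists e => //; exact: set_mem.
split; [exists r => // e | exact: vis | exact: vis].
by rewrite er; exact: hD.
Qed.

Lemma cls_closed l : closed_walk l -> exists L : uloop G, cls l = Some L.
Proof. by move=> h; rewrite /cls insubT /=; eexists. Qed.

Lemma cls_loop_of ps : path.cycle link ps -> ps != [::] ->
  exists2 L, cls (loop_of ps) = Some L & meets_both D F1 F2 L.
Proof.
move=> c ps0; have [L eL] := cls_closed (loop_of_closed c ps0).
have [h1 h2] := loop_of_has c ps0.
by exists L => //; exact: cls_meets_both (loop_of_edges c) h1 h2 eL.
Qed.

Lemma meets_both_pieces L : meets_both D F1 F2 L ->
  exists2 ps, path.cycle link ps & ps != [::] /\ cls (loop_of ps) = Some L.
Proof.
case=> -[r rD rL] [e1 h1 f1] [e2 h2 f2].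
have lD e : e \in uedges L -> eset D e.
  have [i er] := uclass_uedges r; rewrite rL in er.
  by move=> he; apply: rD; rewrite er mem_rot.
have [|| ps [i [ps0 c e]]] :=
  closed_walk_pieces F12 F1D F2D (uedges_closed L) lD.
- by apply/hasP; exists e1 => //; exact: mem_set.
- by apply/hasP; exists e2 => //; exact: mem_set.
by exists ps => //; split=> //; rewrite /loop_of e cls_rot cls_uedges.
Qed.

Lemma words_inj ps qs : path.cycle link ps -> path.cycle link qs ->
  map (@word G) ps = map (@word G) qs -> ps = qs.
Proof.
move=> c d; have hp := cycle_linked c; have hq := cycle_linked d.
elim: ps qs hp hq {c d} => [|p ps IH] [|q qs] // hp hq [e es].
have [p' lp] := hp _ (mem_head _ _); have [q' lq] := hq _ (mem_head _ _).
rewrite (word_inj F12 lp lq e); congr (_ :: _); apply: IH => // r hr.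
- by apply: hp; rewrite inE hr orbT.
- by apply: hq; rewrite inE hr orbT.
Qed.

(** Rotations of pieces and rotations of edges agree; this supplies [key_count] for the count of
    isomorphisms. *)
Lemma count_rot_pieces ps qs : path.cycle link ps -> path.cycle link qs ->
  ps != [::] -> qs != [::] ->
  count (fun k => rot k ps == qs) (iota 0 (size ps)) =
  if cls (loop_of ps) == cls (loop_of qs) then loop_period (cls (loop_of qs))
    else 0.
Proof.
move=> c d ps0 qs0; rewrite -count_rot_cls ?loop_of_closed //.
rewrite (count_rot_blocks (inF_disj F12) (cycle_blocks c)
  (cycle_blocks d)) size_map.
apply: eq_count => k; rewrite -map_rot; apply/eqP/eqP => [->//|].
by apply: words_inj; rewrite ?rot_cycle.
Qed.

End PieceCycles.

(** * Occurrences of a crossing in a loop *)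

Section Occurrences.
Variables (G : ograph) (F F' : set (vertex G)).
Hypothesis FF' : F `&` F' = set0.
Local Notation f := (inF F).
Local Notation f' := (inF F').
Implicit Types (a c : portion G) (m t : seq (edge G)).

Let crossing_has a : crossing F F' a ->
  ~~ has f (behead a.2) /\ ~~ has f' (behead a.2).
Proof.
case=> _ _ _ _ h; split; apply/hasPn => e /h[h1 h2]; apply/negP => /set_mem //.
Qed.

Let crossing_f a : crossing F F' a -> head false (map f a.2).
Proof.
case=> + + Fa _ _; case: (a.2) => //= e s _ /andP[/eqP es _].
by rewrite /inF es; exact: mem_set.
Qed.

Let find_crossing a t : crossing F F' a -> head false (map f' t) ->
  find f' (a.2 ++ t) = size a.2.
Proof.
move=> ca ht; apply: find_cat_head => //; have [_ h] := crossing_has ca.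
have := crossing_f ca; case: (a.2) h => //= e s h fe; rewrite negb_or h andbT.
exact: (inF_disj FF').
Qed.

(** A crossing cannot fill a closed walk, because its endpoints lie in disjoint sets; so an edge
    follows it, and that edge starts in [F']. *)
Lemma crossing_prefix a m : closed_walk m -> crossing F F' a -> prefix a.2 m ->
  exists2 t, m = a.2 ++ t & head false (map f' t).
Proof.
move=> /closed_walkP[_ [x +]] ca /prefixP[t em];
  rewrite em => /walk_cat[y w1 w2].
exists t => //; have [a0 wa Fa Fa' _] := ca.
have ex : x = pstart a by case: (a.2) a0 w1 wa =>
  //= e s _ /andP[/eqP <- _] /andP[/eqP <-].
have ey : y = pend a by rewrite ex in w1; exact: walk_fun w1 wa.
case: t w2 {em} => [/eqP yx|e t /walk_start es] /=.
  have : (F `&` F') x by split; [rewrite ex | rewrite -yx ey].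
  by rewrite FF'.
by rewrite /inF es ey; exact: mem_set.
Qed.

Lemma crossing_prefix_head a m : closed_walk m -> crossing F F' a ->
  prefix a.2 m ->
  crossing_head f f' m.
Proof.
move=> cm ca /(crossing_prefix cm ca)[t -> ht]; have [h h'] := crossing_has ca.
have := crossing_f ca; case: (a.2) h h' => //= e s h h' ->; rewrite /=.
rewrite find_cat_head // find_cat (negbTE h) -addn1 leq_add2l.
by case: t ht => //= e' t f'e; case: ifP => // /(inF_disj FF'); rewrite f'e.
Qed.

(** The length of an initial crossing is the position of the first visit to [F'], so at most one
    crossing starts at a given place. *)
Lemma prefix_crossing a c m t : closed_walk m -> crossing F F' a ->
  crossing F F' c ->
  m = c.2 ++ t -> head false (map f' t) -> prefix a.2 m = (c == a).
Proof.
move=> cm ca cc em ht; apply/idP/eqP => [|<-]; last by rewrite em prefix_prefix.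
case/(crossing_prefix cm ca) => u em' hu; apply: (crossing_inj cc ca).
have sz : size c.2 = size a.2 by rewrite -(find_crossing cc ht) -(find_crossing
  ca hu) -em -em'.
by rewrite -(take_size_cat t sz) -em em' take_size_cat.
Qed.

(** An occurrence of [a] starts at a crossing head, hence at a block boundary, where [A] tells which
    crossing starts. *)
Lemma occurrencesE (W : seq (seq (edge G))) (A : seq (portion G)) a j L :
  (forall w, w \in W -> is_block f f' w) -> flatten W = rot j (uedges L) ->
  size A = size W ->
  (forall k d, k < size W -> crossing F F' (nth d A k) /\
     exists2 t, nth [::] W k = (nth d A k).2 ++ t & head false (map f' t)) ->
  crossing F F' a -> occurrences a L = count_mem a A.
Proof.
move=> hW eW sA hA ca;
  rewrite /occurrences -(count_rot (fun m => prefix a.2 m) j).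
rewrite -(size_rot j) -eW (count_crossing_head (inF_disj FF') hW); last first.
  by move=> i; apply: crossing_prefix_head => //;
    rewrite closed_walk_rot eW closed_walk_rot uedges_closed.
rewrite -sA -[in RHS](mkseq_nth a A) count_map.
apply: eq_in_count => k; rewrite mem_iota add0n => /andP[_ lt] /=.
rewrite sA in lt; have [cc [t eWk ht]] := hA k a lt.
apply: (prefix_crossing (t := t ++ flatten (behead (rot k W)))) => //.
- by rewrite closed_walk_rot eW closed_walk_rot uedges_closed.
- rewrite -flatten_rot catA -eWk /rot (drop_nth [::]) //.
- by case: (t) ht.
Qed.

End Occurrences.

Section PieceOccurrences.
Variables (G : ograph) (D : subgraph G) (F1 F2 : set (vertex G)).
Hypothesis F12 : F1 `&` F2 = set0.
Local Notation link := (piece_link D F1 F2).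

Let F21 : F2 `&` F1 = set0. Proof. by rewrite setIC. Qed.

Lemma occurrences12 ps L a : path.cycle link ps -> cls (loop_of ps) = Some L ->
  crossing F1 F2 a -> occurrences a L = count (fun p => p.1.1 == a) ps.
Proof.
move=> c /clsP[j e] ca;
  rewrite -(count_map (fun p : piece G => p.1.1) (pred1 a)).
apply: (occurrencesE F12 (W := map (@word G) ps) (j := j)) => //.
- exact: cycle_blocks c.
- by rewrite !size_map.
move=> k d; rewrite size_map => lt;
  have d0 : piece G := nth ((d, [::]), (d, [::])) ps k.
rewrite !(nth_map d0) //; have [q lk] := cycle_linked c (mem_nth d0 lt).
split; first by case: lk => -[].
eexists; first by [].
case: (linked_block lk) => _ _ _; case: (_.1.2) => [|x s] //= _.
by case: (_.2.1.2).
Qed.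

Lemma occurrences21 ps L a : path.cycle link ps -> cls (loop_of ps) = Some L ->
  crossing F2 F1 a -> occurrences a L = count (fun p => p.2.1 == a) ps.
Proof.
move=> c /clsP[j e] ca;
  rewrite -(count_map (fun p : piece G => p.2.1) (pred1 a)).
pose f (p : piece G) := p.1.1.2 ++ p.1.2.
pose g (p : piece G) := p.2.1.2 ++ p.2.2.
have [i ei] := flatten_zip_rot f g ps.
have eW : flatten [seq f x ++ g x | x <- ps] = loop_of ps.
  by congr flatten; apply: eq_map => p; rewrite /f /g /word -!catA.
(* The second half of a piece and the first half of the next one form a block for the exchanged
   sets. *)
have zl x : x \in zip ps (rot 1 ps) ->
    block (inF F2) (inF F1) x.1.2.1.2 x.1.2.2 x.2.1.1.2 x.2.1.2.
  move=> hx; have /asboolP[_ h1] := cycle_zip c hx.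
  have [|q [h2 _]] := cycle_linked (p := x.2) c.
    have : x.2 \in unzip2 (zip ps (rot 1 ps)) by exact: map_f.
    by rewrite unzip2_zip ?size_rot // mem_rot.
  exact: half_piece_block h1 h2.
have szz : size (zip ps (rot 1 ps)) =
  size ps by rewrite size_zip size_rot minnn.
apply: (occurrencesE F21 (W :=
  [seq g x.1 ++ f x.2 | x <- zip ps (rot 1 ps)]) (j :=
    rot_add (uedges L) j i)) => //.
- move=> w /mapP[x /zl h ->]; do 4!eexists; split; last exact: h.
  by rewrite /g /f -!catA.
- by rewrite ei eW e rot_rot_add.
- by rewrite !size_map szz.
move=> k d; rewrite size_map => lt; have lt' : k < size ps by rewrite -szz.
have d0 : piece G := nth ((d, [::]), (d, [::])) ps k.
rewrite (nth_map d0) // (nth_map (d0, d0)) //.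
have := zl _ (mem_nth (d0, d0) lt); rewrite nth_zip ?size_rot //= => b.
split; first by have [q [_ []]] := cycle_linked c (mem_nth d0 lt').
rewrite /g -catA; eexists; first by [].
case: b => _ _ _; case: (_.2.2) => [|x s] //= _.
by rewrite /f; case: (_.1.1.2).
Qed.

End PieceOccurrences.

(** * Pairs of unordered bridges producing a given configuration *)

Section Representatives.
Variables (T : finType) (K : eqType).

Definition orbit_reps (p : {perm T}) (xs : seq T) : Prop :=
  (forall y, exists2 x, x \in xs & fconnect p x y) /\
  pairwise (fun x y => ~~ fconnect p x y) xs.

(** Sending each representative to the root of its cycle compares [xs] with the system of
    representatives [froots p]. *)
Lemma card_roots_reps (p : {perm T}) (key : T -> K) xs k :
  (forall y, key (p y) = key y) -> orbit_reps p xs ->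
  #|[pred r | froots p r && (key r == k)]| = count_mem k (map key xs).
Proof.
move=> kp [cov pw]; have symp := fconnect_sym (@perm_inj _ p).
have kc x y : fconnect p x y -> key y = key x.
  by move=> /iter_findex <-; elim: (findex _ _ _) => //= i <-; rewrite kp.
have kr x : key (froot p x) = key x by apply: kc; exact: connect_root.
rewrite count_map -size_filter -(size_map (froot p)) cardE; apply: perm_size.
have pr (a : pred T) : uniq [seq froot p x | x <- xs & a x].
  have : pairwise (fun x y => ~~ fconnect p x y) (seq.filter a xs).
    by apply: subseq_pairwise pw; exact: filter_subseq.
  rewrite uniq_pairwise pairwise_map; apply: sub_pairwise => x y /=.
  by rewrite (root_connect symp).
apply: uniq_perm; rewrite ?enum_uniq //= => r.
rewrite mem_enum inE; apply/andP/mapP => [[rr /eqP <-]|[x + ->]].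
  have [x xs_x xr] := cov r; exists x;
    first by rewrite mem_filter xs_x /= (kc _ _ xr) eqxx.
  by rewrite -{1}(eqP rr); apply/eqP; rewrite eq_sym (root_connect symp).
by rewrite mem_filter => /andP[/eqP <- _]; rewrite roots_root // kr.
Qed.

Lemma enum_froots_reps (p : {perm T}) : orbit_reps p (enum (froots p)).
Proof.
have symp := fconnect_sym (@perm_inj _ p).
split=> [y|].
  exists (froot p y); first by rewrite mem_enum; exact: roots_root.
  by rewrite symp connect_root.
have : all (froots p) (enum (froots p)) by apply/allP => x; rewrite mem_enum.
elim: (enum _) (enum_uniq (froots p)) => //= x s IH /andP[xs us] /andP[rx rs].
rewrite IH // andbT; apply/allP => y ys; apply: contra xs.
rewrite -(root_connect symp) (eqP rx) => /eqP ->.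
by rewrite (eqP (allP rs _ ys)).
Qed.

End Representatives.

Section Stabilizers.
Variables (n : nat) (X : eqType).
Implicit Types (c : n.-tuple X) (u : 'I_n -> X).

Definition tuple_stabilizer c : nat :=
  #|[pred f : 'S_n | [forall j, tnth c (f j) == tnth c j]]|.

Lemma tuple_stabilizer_gt0 c : 0 < tuple_stabilizer c.
Proof. by apply/card_gt0P; exists 1%g; rewrite inE; apply/forallP => j;
  rewrite perm1. Qed.

(** The matchings form a coset of the stabiliser of [c]. *)
Lemma card_matching c u (f0 : 'S_n) : (forall j, tnth c (f0 j) = u j) ->
  #|[pred f : 'S_n | [forall j, tnth c (f j) == u j]]| = tuple_stabilizer c.
Proof.
move=> h0; rewrite /tuple_stabilizer -(fintype.card_image (@mulgI _ f0) [pred f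
  : 'S_n | [forall j, tnth c (f j) == tnth c j]]).
apply: eq_card => f; rewrite !inE; apply/forallP/fintype.imageP => [h|[s]].
  exists (f0^-1 * f)%g; last by rewrite mulKVg.
  by rewrite inE; apply/forallP => j; rewrite permM (eqP (h _)) -h0 permKV.
by rewrite inE => /forallP h -> j; rewrite permM (eqP (h _)) h0.
Qed.

End Stabilizers.

Section LinkedStructures.
Variables (G : ograph) (D : subgraph G) (F1 F2 : set (vertex G)).
Hypotheses (F12 : F1 `&` F2 = set0).
Variable T : finType.
Implicit Types (p : {perm T}) (l : T -> piece G).
Local Notation link := (piece_link D F1 F2).

Definition linked_structure p l : Prop :=
  forall j, linked D F1 F2 (l j) (l (p j)).

Definition structure_key p l j : option (uloop G) :=
  cls (loop_of (orbit_labels p l j)).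

Lemma orbit_labels_iter p l j i : i < fingraph.order p j ->
  orbit_labels p l (iter i p j) = rot i (orbit_labels p l j).
Proof. by move=> lt; rewrite /orbit_labels orbit_iter_rot // map_rot. Qed.

Lemma loop_of_rot i (ps : seq (piece G)) : exists k,
  loop_of (rot i ps) = rot k (loop_of ps).
Proof. by rewrite /loop_of map_rot flatten_rot; eexists. Qed.

Lemma structure_key_step p l j : structure_key p l (p j) = structure_key p l j.
Proof.
rewrite /structure_key -[p j]/(iter 1 p j) iter_order_mod.
rewrite orbit_labels_iter ?ltn_mod ?fingraph.order_gt0 //.
by have [k ->] := loop_of_rot (1 %% fingraph.order p j) (orbit_labels p l j);
  rewrite cls_rot.
Qed.

Lemma orbit_labels_neq0 p l j : orbit_labels p l j != [::].
Proof. by rewrite -size_eq0 size_map size_orbit -lt0n fingraph.order_gt0. Qed.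

Lemma orbit_labels_cycle p l j : linked_structure p l ->
  path.cycle link (orbit_labels p l j).
Proof.
move=> h; rewrite /orbit_labels cycle_map.
apply: sub_cycle (cycle_orbit (@perm_inj _ p) j) => x y /= /eqP <-.
exact/asboolP.
Qed.

Lemma structure_key_count p0 p l0 l x y :
  linked_structure p0 l0 -> linked_structure p l ->
  count (fun z => orbit_labels p l z == orbit_labels p0 l0 x)
    (fingraph.orbit p y) =
  if structure_key p l y == structure_key p0 l0 x then loop_period
    (structure_key p0 l0 x) else 0.
Proof.
move=> h0 h.
have c0 := orbit_labels_cycle x h0; have c := orbit_labels_cycle y h.
rewrite -(count_rot_pieces F12 c c0) ?orbit_labels_neq0 // size_map size_orbit.
rewrite /fingraph.orbit -(mkseq_nth y (traject _ _ _)) size_traject count_map.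
apply: eq_in_count => i; rewrite mem_iota add0n => /andP[_ lt] /=.
by rewrite nth_traject // orbit_labels_iter.
Qed.

Lemma structure_key_meets p l j : linked_structure p l ->
  exists2 L, structure_key p l j = Some L & meets_both D F1 F2 L.
Proof.
by move=> h; exact: cls_loop_of (orbit_labels_cycle j h)
  (orbit_labels_neq0 p l j).
Qed.

Lemma card_structure_iso p0 p l0 l xs : linked_structure p0 l0 ->
  linked_structure p l ->
  orbit_reps p0 xs ->
  (forall L, meets_both D F1 F2 L ->
     #|[pred r | froots p r && (structure_key p l r == Some L)]| =
     count_mem (Some L) (map (structure_key p0 l0) xs)) ->
  #|labelled_iso p0 p l0 l| = iso_weight (@loop_period G)
    (map (structure_key p0 l0) xs).
Proof.
move=> h0 h [cov pw] hk.
apply: (@card_labelled_iso _ _ _ p0 p l0 l (structure_key p0 l0)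
  (structure_key p l)) => //.
- by move=> y; exact: structure_key_step.
- by move=> x y; exact: structure_key_count.
(* Only loops meeting both sets occur as keys; for any other key both counts are 0. *)
move=> k; case: (pselect (exists2 L, k = Some L & meets_both D F1 F2 L)) =>
  [[L -> mL]|nk].
  exact: hk.
have kn q m j : linked_structure q m -> structure_key q m j == k = false.
  move=> /(structure_key_meets j)[L eL mL]; apply/eqP => ek; apply: nk.
  by exists L => //; rewrite -ek.
rewrite eq_card0 => [|r]; last by rewrite !inE kn // andbF.
by apply/esym/eqP; rewrite -leqn0 leqNgt -has_count has_map;
  apply/hasPn => j _ /=; rewrite kn.
Qed.

End LinkedStructures.

Section Gluing.
Variables (G : ograph) (D : subgraph G) (F1 F2 : set (vertex G)).
Variables (n : nat) (c12 c21 : n.-tuple (portion G)).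
Implicit Types xi : (ubridge G n * ubridge G n)%type.

Definition glued_piece xi j : piece G :=
  ((tnth c12 j, tnth xi.1.2 j), (tnth c21 (xi.1.1 j), tnth xi.2.2 (xi.1.1 j))).

Definition crossings_in (F F' : set (vertex G))
  (c : n.-tuple (portion G)) : Prop :=
  forall j, crossing F F' (tnth c j) /\ forall e, e \in (tnth c j).2 ->
    eset D e.

Definition bridge_pairs : set (ubridge G n * ubridge G n) :=
  [set xi | ubridges (remove D F1) (ends c12) (starts c21) xi.1 /\
            ubridges (remove D F2) (ends c21) (starts c12) xi.2].

(** Moves all conditions on [xi] to consecutive pieces of a labelled permutation, where isomorphisms
    can be counted. *)
Lemma bridge_pairsP xi : crossings_in F1 F2 c12 -> crossings_in F2 F1 c21 ->
  bridge_pairs xi <-> linked_structure D F1 F2 (glue_next xi) (glued_piece xi).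
Proof.
move=> h12 h21; split=> [[b1 b2] j|h]; last split=> j.
- have [x1 x2] := h12 j; have [y1 y2] := h21 (xi.1.1 j).
  split; split => //=.
    by have := b1 j; rewrite !tnth_map.
  by have := b2 (xi.1.1 j); rewrite !tnth_map /glue_next permM.
- by have [[_ _ +] _] := h j; rewrite !tnth_map.
(* The bridges of [xi.2] are indexed by [c21] but the pieces by [c12]; [xi.1.1] translates between
   the two. *)
- by have [_ [_ _ +]] := h (xi.1.1^-1 j)%g;
    rewrite /= !tnth_map /glue_next permM permKV.
Qed.

Lemma glued_loopE xi j :
  glued_loop c12 c21 xi j = loop_of (orbit_labels (glue_next xi)
    (glued_piece xi) j).
Proof. by rewrite /glued_loop /loop_of /orbit_labels -map_comp. Qed.

(** Replaces cycles as sets by one root per cycle. *)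
Lemma glued_multE xi L : glued_mult c12 c21 xi L =
  #|[pred r | froots (glue_next xi) r &&
              (structure_key (glue_next xi) (glued_piece xi) r == Some L)]|.
Proof.
set p := glue_next xi; set key := structure_key _ _.
have symp := fconnect_sym (@perm_inj _ p).
have kc x y : fconnect p x y -> key y = key x.
  move=> /iter_findex <-; elim: (findex _ _ _) => //= i <-.
  exact: structure_key_step.
have mp x y : (y \in porbit p x) = fconnect p x y.
  apply/porbitP/idP => [[i ->]|xy]; first by rewrite permX;
    exact: fconnect_iter.
  by exists (findex p x y); rewrite permX iter_findex.
have keyP j : reflect (key j = Some L)
    [exists i : 'I_(size (uedges L)),
      glued_loop c12 c21 xi j == rot i (uedges L)].
  apply: (iffP existsP) => [[i /eqP e]|/clsP[i e]].
    by apply/clsP; exists i; rewrite -e glued_loopE.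
  case: (ltnP i (size (uedges L))) => [lt|le].
    by exists (Ordinal lt); rewrite glued_loopE e.
  have L0 : 0 < size (uedges L) by case: (uedges L) (uedges_closed L).
  by exists (Ordinal L0); rewrite glued_loopE e rot_oversize ?rot0.
have inj : {in [pred r | froots p r && (key r == Some L)] &,
  injective (porbit p)}.
  move=> x y /andP[rx _] /andP[ry _] e;
    have : y \in porbit p x by rewrite e porbit_id.
  by rewrite mp -(root_connect symp) (eqP rx) (eqP ry) => /eqP.
rewrite /glued_mult -(card_in_image inj); apply: eq_card => C; rewrite !inE.
apply/andP/fintype.imageP =>
  [[/imsetP[x _ ->] /existsP[j /andP[jx /keyP kj]]]|[r /andP[rr kr] ->]].
  exists (froot p x); last first.
    by apply/setP => y; rewrite !mp; apply: (same_connect symp);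
      exact: connect_root.
  rewrite inE roots_root //= (kc x) ?connect_root //.
  by rewrite -(kc x j) ?kj // -mp.
split; first exact: imset_f.
by apply/existsP; exists r; rewrite porbit_id; apply/keyP/eqP.
Qed.

End Gluing.

Section DoubleCounting.
Variables (G : ograph) (D : subgraph G) (F1 F2 : set (vertex G)).
Hypotheses (F12 : F1 `&` F2 = set0).
Variables (n : nat) (c12 c21 : n.-tuple (portion G)).
Hypotheses (h12 : crossings_in D F1 F2 c12) (h21 : crossings_in D F2 F1 c21).
Variables (p0 : 'S_n) (l0 : 'I_n -> piece G).
Hypothesis linked0 : linked_structure D F1 F2 p0 l0.
Implicit Types (xi : (ubridge G n * ubridge G n)%type)
  (ff : ('S_n * 'S_n)%type).
Local Notation gnext := (@glue_next G n).
Local Notation gpiece := (glued_piece c12 c21).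

Definition matchings : pred ('S_n * 'S_n) :=
  [pred ff : 'S_n * 'S_n | [forall j, tnth c12 (ff.1 j) == (l0 j).1.1] &&
             [forall j, tnth c21 (ff.2 j) == (l0 j).2.1]].

(* [ff] numbers the crossings of both kinds in the structure [(p0, l0)]; the
   numberings that yield the same pair [xi] correspond to the isomorphisms from
   [(p0, l0)] onto the structure of [xi]. *)
Definition reassemble ff : (ubridge G n * ubridge G n)%type :=
  (((ff.1^-1 * ff.2)%g, [tuple (l0 ((ff.1^-1)%g j)).1.2 | j < n]),
   ((ff.2^-1 * p0 * ff.1)%g, [tuple (l0 ((ff.2^-1)%g j)).2.2 | j < n])).

Lemma reassemble_next ff : gnext (reassemble ff) = (ff.1^-1 * p0 * ff.1)%g.
Proof. by rewrite /glue_next /= !mulgA mulgK. Qed.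

Lemma reassemble_piece ff j : ff \in matchings ->
  gpiece (reassemble ff) (ff.1 j) = l0 j.
Proof.
move=> /andP[/forallP m1 /forallP m2].
rewrite /glued_piece /= !tnth_mktuple permM !permK (eqP (m1 j)) (eqP (m2 j)).
by case: (l0 j) => -[a b] [c d].
Qed.

Lemma reassemble_iso ff : ff \in matchings ->
  ff.1 \in labelled_iso p0 (gnext (reassemble ff)) l0 (gpiece (reassemble ff)).
Proof.
move=> m; rewrite inE; apply/forallP => j.
by rewrite reassemble_piece // reassemble_next !permM permK !eqxx.
Qed.

(** [f] numbers the crossings of the first kind; following it with [xi.1.1] is then the only
    numbering of the second kind that gives back [xi]. *)
Lemma labelled_iso_reassemble xi f :
  f \in labelled_iso p0 (gnext xi) l0 (gpiece xi) ->
  (f, (f * xi.1.1)%g) \in matchings /\ reassemble (f, (f * xi.1.1)%g) = xi.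
Proof.
rewrite inE => /forallP h;
  have fl j : gpiece xi (f j) = l0 j by have /andP[_ /eqP] := h j.
have fp : (p0 * f = f * gnext xi)%g.
  by apply/permP => j; have /andP[/eqP + _] := h j; rewrite !permM.
split.
  by rewrite inE; apply/andP; split; apply/forallP => j; rewrite -fl /= ?permM.
case: xi h fl fp => [[s b] [s' b']] h fl fp; rewrite /reassemble /= mulKg.
congr ((_, _), (_, _)).
- by apply: eq_from_tnth => j; rewrite tnth_mktuple -fl /= permKV.
- by rewrite invMg -!mulgA fp /glue_next /= !mulgA mulgKV mulVg mul1g.
- apply: eq_from_tnth => j; rewrite tnth_mktuple -fl /=.
  by rewrite -[s (f _)]permM permKV.
Qed.

Lemma card_reassemble_fiber xi :
  #|[pred ff | (ff \in matchings) && (reassemble ff == xi)]| =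
  #|labelled_iso p0 (gnext xi) l0 (gpiece xi)|.
Proof.
have inj : injective (fun f : 'S_n => (f, (f * xi.1.1)%g)) by move=> f f' [].
rewrite -(fintype.card_image inj); apply: eq_card => -[f f']; rewrite inE.
apply/andP/fintype.imageP => [[m /eqP e]|[h hI ->]]; last first.
  by have [m e] := labelled_iso_reassemble hI; rewrite m e.
have := reassemble_iso m; rewrite /= e => fI; exists f => //; congr (_, _).
by rewrite -e /= mulKVg.
Qed.

Lemma reassemble_bridge_pairs ff : ff \in matchings ->
  bridge_pairs D F1 F2 c12 c21 (reassemble ff).
Proof.
move=> m; apply/bridge_pairsP => // j.
have -> : j = ff.1 ((ff.1^-1)%g j) by rewrite permKV.
by rewrite reassemble_piece // reassemble_next !permM permK reassemble_piece.
Qed.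

Variables (xs : seq 'I_n) (kappa : uloop G -> nat).
Hypothesis reps : orbit_reps p0 xs.
Hypothesis kappaE : forall L, meets_both D F1 F2 L ->
  kappa L = count_mem (Some L) (map (structure_key p0 l0) xs).

Lemma reassemble_missing ff : ff \in matchings ->
  missing_parts D F1 F2 c12 c21 kappa (reassemble ff).
Proof.
move=> m; have [b1 b2] := reassemble_bridge_pairs m; split => // L mL.
rewrite glued_multE kappaE //; have fI := reassemble_iso m.
rewrite (@card_roots_reps _ _ _ _ (map ff.1 xs)).
- congr (count_mem _ _); rewrite -map_comp; apply: eq_map => j /=.
  by rewrite /structure_key (labelled_iso_labels _ fI).
- exact: structure_key_step.
case: reps => [cov pw]; split=> [y|].
  have [x xs_x xy] := cov ((ff.1^-1)%g y); exists (ff.1 x); first exact: map_f.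
  by rewrite -[y](permKV ff.1) (labelled_iso_fconnect _ _ fI).
by rewrite pairwise_map; apply: sub_pairwise pw => x y /=;
  rewrite (labelled_iso_fconnect _ _ fI).
Qed.

Let weight := iso_weight (@loop_period G) (map (structure_key p0 l0) xs).

Lemma loop_period_gt0 (L : uloop G) : 0 < loop_period (Some L).
Proof.
rewrite /= -has_count; apply/hasP; exists 0; last by rewrite rot0.
by rewrite mem_iota /=; case: (uedges L) (uedges_closed L).
Qed.

Lemma structure_weight_gt0 : 0 < weight.
Proof.
rewrite /weight; elim: (xs) => //= x s IH; rewrite !muln_gt0 IH andbT.
by have [L -> _] := structure_key_meets x linked0; rewrite loop_period_gt0.
Qed.

(** Pairs producing [kappa] have equally many cycles of each loop class, so the fibres of
    [reassemble] over them have the same size. *)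
Lemma card_missing_iso xi : missing_parts D F1 F2 c12 c21 kappa xi ->
  #|labelled_iso p0 (gnext xi) l0 (gpiece xi)| = weight.
Proof.
move=> [b1 b2 hk]; apply: (card_structure_iso F12 linked0 _ reps).
  by apply/bridge_pairsP.
by move=> L mL; rewrite -glued_multE -hk // kappaE.
Qed.

(** The image of [matchings] under [reassemble] is the set of missing parts, and each fibre has size
    [weight]. *)
Lemma missing_partsE : exists s, [/\ uniq s,
  missing_parts D F1 F2 c12 c21 kappa = [set xi | xi \in s] &
  size s * weight = #|matchings|].
Proof.
exists (undup (map reassemble (enum matchings))).
have mE xi : xi \in map reassemble (enum matchings) <->
  missing_parts D F1 F2 c12 c21 kappa xi.
  split=> [/mapP[ff + ->]|hxi]; first by rewrite mem_enum;
    exact: reassemble_missing.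
  have : 0 < #|labelled_iso p0 (gnext xi) l0 (gpiece xi)|.
    by rewrite card_missing_iso // structure_weight_gt0.
  case/card_gt0P => f /labelled_iso_reassemble[m e].
  by apply/mapP; eexists; [rewrite mem_enum; exact: m | rewrite e].
split; first exact: undup_uniq.
  by apply/seteqP; split => xi /=; rewrite mem_undup => /mE.
rewrite cardE -(size_map reassemble) -[RHS](@sum_count_mem _ _ (undup (map
  reassemble (enum matchings)))) ?undup_uniq //; last first.
  by move=> xi; rewrite mem_undup.
rewrite (_ : map (fun y =>
  _) _ = [seq weight | _ <- undup (map reassemble (enum matchings))]).
  by elim: (undup _) => //= _ r <-; rewrite mulSn.
apply/eq_in_map => xi; rewrite mem_undup => /mE h.
rewrite -(card_missing_iso h) -card_reassemble_fiber count_map -size_filter.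
rewrite -(card_uniqP _) ?filter_uniq -?enumT ?enum_uniq //.
by apply: eq_card => ff; rewrite mem_filter mem_enum andbC.
Qed.

End DoubleCounting.

Import Order.TTheory GRing.Theory Num.Theory.
Local Open Scope ring_scope.

(** * Sums of natural numbers over a set *)

Section EsumNat.
Variables (R : realType) (T : choiceType).

Lemma sum_count_mul (s r : seq T) (f : T -> nat) : uniq r -> {subset s <= r} ->
  (\sum_(y <- r) count_mem y s * f y = \sum_(y <- s) f y)%N.
Proof.
move=> ur sr.
under eq_bigr do rewrite -sum1_count big_mkcond big_distrl /=.
rewrite exchange_big; apply: eq_big_seq => x /sr xr /=.
rewrite (bigD1_seq x) //= eqxx mul1n big1 ?addn0 // => y /negbTE yx.
by rewrite eq_sym yx.
Qed.

Lemma esum_support (A B : set T) (f : T -> \bar R) : B `<=` A ->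
  (forall x, A x -> ~ B x -> f x = 0%E) ->
  \esum_(x in A) f x = \esum_(x in B) f x.
Proof.
move=> BA f0; rewrite esum_mkcond [RHS]esum_mkcond; apply: eq_esum => x _.
case: (pselect (B x)) => [Bx|nBx]; first by rewrite !mem_set //; exact: BA.
rewrite (memNset nBx); case: ifP => // /set_mem Ax; exact: f0.
Qed.

Lemma esum_count (s : seq T) (A : set T) (k f : T -> nat) :
  (forall x, x \in s -> A x) ->
  (forall x, A x -> f x != 0%N -> k x = count_mem x s) ->
  \esum_(x in A) (k x * f x)%:R%:E = (\sum_(x <- s) f x)%N%:R%:E :> \bar R.
Proof.
move=> sA ks; rewrite (@esum_support _ [set` undup s]); first last.
- move=> x Ax /= xs; have [->|fx] := eqVneq (f x) 0%N; first by rewrite muln0.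
  by rewrite ks // (count_memPn _) //; apply/negP; rewrite -mem_undup => /xs.
- by move=> x /=; rewrite mem_undup => /sA.
rewrite esum_fset ?finite_seq //.
rewrite -fsbig_seq ?undup_uniq // sumEFin -natr_sum; congr (_%:R%:E).
rewrite -(@sum_count_mul s (undup s)) ?undup_uniq // => [|x];
  last by rewrite mem_undup.
apply: eq_big_seq => x; rewrite mem_undup => /sA Ax.
by have [->|fx] := eqVneq (f x) 0%N; rewrite ?muln0 // ks.
Qed.

(** If the support were infinite, [m.+1] of its points would already contribute more than [m]. *)
Lemma esum_nat_finite (A : set T) (f : T -> nat) (m : nat) :
  \esum_(x in A) (f x)%:R%:E = m%:R%:E :> \bar R ->
  finite_set [set x | A x /\ f x != 0%N].
Proof.
move=> e; apply: contrapT => /(infinite_set_fset m.+1)[B BA mB].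
suff : (m.+1%:R%:E <= m%:R%:E :> \bar R)%E by rewrite lee_fin ler_nat ltnn.
rewrite -e; apply: esum_ge; exists [set` B]; first by split => // x /BA[].
rewrite -(fsbig_seq _ _ (fset_uniq B)) sumEFin -natr_sum lee_fin ler_nat.
apply: (leq_trans mB); rewrite -sum1_size !big_seq; apply: leq_sum => x xB.
by have [_] := BA x xB; rewrite lt0n.
Qed.

End EsumNat.

(** * Configurations of loops as lists of cycles of pieces *)

Section Decompositions.
Variables (R : realType) (G : ograph) (D : subgraph G) (F1 F2 : set (vertex G)).
Hypotheses (F12 : F1 `&` F2 = set0) (F1D : F1 `<=` vset D)
  (F2D : F2 `<=` vset D).
Implicit Types (kappa : uloop G -> nat) (ss : seq (seq (piece G))).
Local Notation link := (piece_link D F1 F2).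

Definition piece_cycles ss : Prop :=
  forall ps, ps \in ss -> path.cycle link ps /\ ps != [::].

(** Values of [kappa] at loops that do not meet both sets are left free. *)
Definition decomposes kappa ss : Prop :=
  piece_cycles ss /\
  forall L, meets_both D F1 F2 L ->
    kappa L = count_mem (Some L) (map (@cls G \o @loop_of G) ss).

Lemma piece_cycles_loops ss : piece_cycles ss ->
  exists2 ls, map (@cls G \o @loop_of G) ss = map Some ls &
              forall L, L \in ls -> meets_both D F1 F2 L.
Proof.
elim: ss => [|ps ss IH] h; first by exists [::].
have [c ps0] := h _ (mem_head _ _); have [L eL mL] := cls_loop_of c ps0.
have [ls els hls] : exists2 ls, map (@cls G \o @loop_of G) ss = map Some ls &
    forall L, L \in ls -> meets_both D F1 F2 L.
  by apply: IH => qs hqs; apply: h; rewrite inE hqs orbT.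
exists (L :: ls); first by rewrite /= eL els.
by move=> L'; rewrite inE => /orP[/eqP -> //|]; exact: hls.
Qed.

Lemma loops_piece_cycles (ls : seq (uloop G)) : (forall L, L \in ls ->
  meets_both D F1 F2 L) ->
  exists2 ss, piece_cycles ss & map (@cls G \o @loop_of G) ss = map Some ls.
Proof.
elim: ls => [|L ls IH] h; first by exists [::].
have [ps c [ps0 eL]] := meets_both_pieces F12 F1D F2D (h _ (mem_head _ _)).
have [ss hss es] : exists2 ss, piece_cycles ss
  & map (@cls G \o @loop_of G) ss = map Some ls.
  by apply: IH => L' hL; apply: h; rewrite inE hL orbT.
exists (ps :: ss); last by rewrite /= eL es.
by move=> qs; rewrite inE => /orP[/eqP -> //|]; exact: hss.
Qed.

Lemma finite_decomposes kappa :
  finite_set [set L | meets_both D F1 F2 L /\ kappa L != 0%N] ->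
    exists ss, decomposes kappa ss.
Proof.
set A := [set L | _] => fA; pose S : seq (uloop G) := fset_set A.
pose ls := flatten [seq nseq (kappa L) L | L <- S].
have SA L : L \in S -> A L by move=> LS; move: (fset_setK fA);
  rewrite /mkset => <-.
have [ss hss es] : exists2 ss, piece_cycles ss
  & map (@cls G \o @loop_of G) ss = map Some ls.
  apply: loops_piece_cycles => L /flattenP[t /mapP[L' /SA[mL _] ->]].
  by rewrite mem_nseq => /andP[_ /eqP ->].
exists ss; split => // L mL; rewrite es count_map (eq_count (a2 := pred1 L)) //.
rewrite /ls count_flatten -map_comp.
transitivity (\sum_(L' <- S) (if L' == L then kappa L' else 0%N))%N; last first.
  rewrite sumnE big_map; apply: eq_bigr => L' _;
    rewrite /= count_nseq /= eq_sym.
  by case: eqP; rewrite ?mul1n ?mul0n.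
rewrite -big_mkcond /=; have [k0|kn0] := eqVneq (kappa L) 0%N.
  by rewrite k0 big1 // => L' /eqP ->.
have LS : L \in S by rewrite /S in_fset_set // mem_set.
by rewrite (big_rem L) //= eqxx big1_seq ?addn0 // => L' /andP[/eqP -> +];
  rewrite mem_rem_uniqF ?fset_uniq.
Qed.

Lemma occurrences_visits F F' (a : portion G) L : F `&` F' = set0 ->
  crossing F F' a ->
  occurrences a L != 0%N -> visits F L /\ visits F' L.
Proof.
move=> FF' ca; rewrite -lt0n -has_count => /hasP[i _ pa].
have cl : closed_walk (rot i (uedges L)) by rewrite closed_walk_rot
  uedges_closed.
have [t et ht] := crossing_prefix FF' cl ca pa.
split; last first.
  case: t et ht => // e t et /= fe; exists e; last exact: set_mem.
  by rewrite -(mem_rot i) et mem_cat inE eqxx orbT.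
have [a0 wa Fa _ _] := ca; case: (a.2) a0 wa et => // e s _ /andP[/eqP es _] et.
by exists e; rewrite ?es // -(mem_rot i) et inE eqxx.
Qed.

Lemma occurrences_meets12 (a : portion G) L : crossing F1 F2 a ->
  uloop_in D L ->
  occurrences a L != 0%N -> meets_both D F1 F2 L.
Proof. by move=> ca LD /(occurrences_visits F12 ca)[v1 v2]; split. Qed.

Lemma occurrences_meets21 (a : portion G) L : crossing F2 F1 a ->
  uloop_in D L ->
  occurrences a L != 0%N -> meets_both D F1 F2 L.
Proof.
have F21 : F2 `&` F1 = set0 by rewrite setIC.
by move=> ca LD /(occurrences_visits F21 ca)[v1 v2]; split.
Qed.

Let decomposes_mult kappa ss a (h : pred (piece G)) : decomposes kappa ss ->
  (forall L, uloop_in D L -> occurrences a L != 0%N -> meets_both D F1 F2 L) ->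
  (forall ps L, path.cycle link ps -> cls (loop_of ps) = Some L ->
    occurrences a L = count h ps) ->
  crossing_mult R D kappa a = (count h (flatten ss))%:R%:E.
Proof.
move=> [hss hk] hm ho; have [ls els hls] := piece_cycles_loops hss.
rewrite /crossing_mult (@esum_count _ _ ls).
- congr (_%:R%:E); rewrite count_flatten sumnE big_map.
  elim: (ss) (ls) els hss {hk hls} => [|ps ss' IH] [|L ls'] //;
    first by rewrite !big_nil.
  move=> [eL els] hss; rewrite !big_cons (IH ls') // => [|qs hqs];
    last by apply: hss; rewrite inE hqs orbT.
  by have [c _] := hss _ (mem_head _ _); rewrite (ho _ _ c eL).
- by move=> L /hls[].
move=> L LD /(hm _ LD) mL; rewrite hk // els count_map; exact: eq_count.
Qed.

Lemma decomposes_mult12 kappa ss a : decomposes kappa ss -> crossing F1 F2 a ->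
  crossing_mult R D kappa a = (count_mem a (map (fun p =>
    p.1.1) (flatten ss)))%:R%:E.
Proof.
move=> hd ca; rewrite count_map; apply: decomposes_mult => // [L|ps L].
  exact: occurrences_meets12.
by move=> c eL; exact: occurrences12 c eL ca.
Qed.

Lemma decomposes_mult21 kappa ss a : decomposes kappa ss -> crossing F2 F1 a ->
  crossing_mult R D kappa a = (count_mem a (map (fun p =>
    p.2.1) (flatten ss)))%:R%:E.
Proof.
move=> hd ca; rewrite count_map; apply: decomposes_mult => // [L|ps L].
  exact: occurrences_meets21.
by move=> c eL; exact: occurrences21 c eL ca.
Qed.

Lemma piece_cycles_flatten ss p : piece_cycles ss -> p \in flatten ss ->
  exists q, linked D F1 F2 p q.
Proof. by move=> h /flattenP[ps /h[c _] pps]; exact: cycle_linked c pps. Qed.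

Let lists_perm F F' kappa ord c (u : seq (portion G)) :
  (forall a, a \in u -> crossing F F' a) ->
  (forall a, crossing F F' a ->
    crossing_mult R D kappa a = (count_mem a u)%:R%:E) ->
  lists_crossings R D ord F F' kappa c <-> ord c = c /\ perm_eq c u.
Proof.
move=> hu hm; split=> [[oc hc hcm]|[oc pcu]].
  split => //; apply/allP => a _ /=;
    case: (pselect (crossing F F' a)) => [ca|nca].
    by have := hcm a ca; rewrite hm // => -[] /eqP; rewrite eqr_nat.
  have nu : a \notin u by apply/negP => /hu.
  have nc : a \notin c by apply/negP => /hc.
  by rewrite (count_memPn nu) (count_memPn nc).
split => // [a|a ca]; first by rewrite (perm_mem pcu); exact: hu.
by rewrite hm // (seq.permP pcu).
Qed.

Lemma decomposes_lists12 kappa ss ord c : decomposes kappa ss ->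
  lists_crossings R D ord F1 F2 kappa c <->
  ord c = c /\ perm_eq c (map (fun p => p.1.1) (flatten ss)).
Proof.
move=> hd; apply: lists_perm => [a /mapP[p + ->]|a];
  last exact: decomposes_mult12.
by case: hd => hss _ /(piece_cycles_flatten hss)[q [[]]].
Qed.

Lemma decomposes_lists21 kappa ss ord c : decomposes kappa ss ->
  lists_crossings R D ord F2 F1 kappa c <->
  ord c = c /\ perm_eq c (map (fun p => p.2.1) (flatten ss)).
Proof.
move=> hd; apply: lists_perm => [a /mapP[p + ->]|a];
  last exact: decomposes_mult21.
by case: hd => hss _ /(piece_cycles_flatten hss)[q [_ []]].
Qed.

(** Each loop counted contains a crossing, which must appear in [c]; each crossing of [c] has a
    finite total multiplicity, so it lies on finitely many loops of [kappa]. *)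
Lemma lists_crossings_finite kappa ord c : lists_crossings R D ord F1 F2 kappa c
  ->
  finite_set [set L | meets_both D F1 F2 L /\ kappa L != 0%N].
Proof.
move=> [_ hc hcm].
pose B a := [set L | uloop_in D L /\ (kappa L * occurrences a L)%N != 0%N].
apply: (@sub_finite_set _ _ (\bigcup_(a in [set` c]) B a)); last first.
  apply: bigcup_finite; first exact: finite_seq.
  by move=> a /= /hc ca; apply: esum_nat_finite (esym (hcm a ca)).
move=> L [mL kL]; have [ps c' [ps0 eL]] := meets_both_pieces F12 F1D F2D mL.
case: ps c' ps0 eL => // p ps c' _ eL;
  have [q [[ca _ _] _]] := cycle_linked c' (mem_head _ _).
have oL : occurrences p.1.1 L != 0%N by rewrite (occurrences12 F12 c' eL ca) /=
  eqxx.
have LD : uloop_in D L by case: mL.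
exists p.1.1; last by split => //; rewrite muln_eq0 negb_or kL.
have := hcm _ ca; case: (boolP (p.1.1 \in c)) => // nc;
  rewrite (count_memPn nc) => /esym.
move=> e0; have : ((kappa L *
  occurrences p.1.1 L)%N%:R%:E <= 0%N%:R%:E :> \bar R)%E.
  rewrite -e0; apply: esum_ge; exists [set L]; last by rewrite fsbig_set1.
  by split => // L' /= ->.
by rewrite lee_fin ler_nat leqn0 muln_eq0 (negbTE kL) (negbTE oL).
Qed.

End Decompositions.

Lemma flatten_orbit_labels (T : finType) (X : eqType) (p : {perm T}) (l : T ->
  X) xs :
  orbit_reps p xs -> perm_eq (flatten (map (orbit_labels p l) xs))
    (map l (enum T)).
Proof.
move=> [cov pw].
have -> : flatten (map (orbit_labels p l) xs) =
  map l (flatten (map (fingraph.orbit p) xs)).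
  by rewrite map_flatten -map_comp.
apply: perm_map; apply: uniq_perm => [||y]; [|exact: enum_uniq|]; last first.
  rewrite mem_enum; apply/flattenP; have [x xs_x xy] := cov y.
  by exists (fingraph.orbit p x); rewrite ?map_f // -fconnect_orbit.
elim: (xs) pw => //= x s IH /andP[/allP hx ps];
  rewrite cat_uniq orbit_uniq IH // andbT.
apply/hasPn => z /flattenP[_ /mapP[y ys ->]]; rewrite -!fconnect_orbit => yz.
apply/negP => xz; move/negP: (hx _ ys); apply.
by apply: connect_trans xz _; rewrite (fconnect_sym (@perm_inj _ p)).
Qed.

Section Existence.
Variables (R : realType) (G : ograph) (D : subgraph G) (F1 F2 : set (vertex G)).
Hypotheses (F12 : F1 `&` F2 = set0) (F1D : F1 `<=` vset D)
  (F2D : F2 `<=` vset D).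
Implicit Types (kappa : uloop G -> nat) (ss : seq (seq (piece G))).

Lemma perm_matching (X : eqType) n (c : n.-tuple X) (u : 'I_n -> X) :
  perm_eq c (map u (enum 'I_n)) ->
    exists f : 'S_n, forall j, tnth c (f j) = u j.
Proof.
rewrite perm_sym => /tuple_permP[f e]; exists f => j.
have := congr1 (fun s => nth (u j) s j) e.
rewrite (nth_map j) ?size_enum_ord // nth_ord_enum => ->.
by rewrite (nth_map j) ?size_enum_ord // nth_ord_enum.
Qed.

Lemma piece_cycles_structure n ss : piece_cycles D F1 F2 ss ->
  size (flatten ss) = n ->
  exists (p : 'S_n) (l : 'I_n -> piece G) (xs : seq 'I_n),
    [/\ orbit_reps p xs, map (orbit_labels p l) xs = ss,
      map l (enum 'I_n) = flatten ss
      & linked_structure D F1 F2 p l].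
Proof.
move=> hss sz; have [|p [l [xs [cov pw e1 e2]]]] := labelled_perm_of_cycles sz.
  by apply/allP => ps /hss[_]; case: ps.
exists p, l, xs; split => // j; have [x xs_x] := cov j;
  rewrite fconnect_orbit => jx.
have [|+ _] := hss (orbit_labels p l x); first by rewrite -e1 map_f.
rewrite /orbit_labels cycle_map => c; have := next_cycle c jx.
have /eqP <- := next_cycle (cycle_orbit (@perm_inj _ p) x) jx.
by move=> /asboolP.
Qed.

(** Up to order, the lists are the crossings of the pieces of [kappa]; numbering the pieces
    accordingly and reassembling gives a pair. *)
Lemma missing_parts_exist kappa n (c12 c21 : n.-tuple (portion G)) ord :
  lists_crossings R D ord F1 F2 kappa c12 ->
    lists_crossings R D ord F2 F1 kappa c21 ->
  [/\ crossings_in D F1 F2 c12, crossings_in D F2 F1 c21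
    & exists xi, missing_parts D F1 F2 c12 c21 kappa xi].
Proof.
move=> h12 h21; have [ss hd] :=
  finite_decomposes F12 F1D F2D (lists_crossings_finite F12 F1D F2D h12).
have [_ p12] := (decomposes_lists12 R F12 ord c12 hd).1 h12.
have [_ p21] := (decomposes_lists21 R F12 ord c21 hd).1 h21.
have [hss hk] := hd; have sz : size (flatten ss) = n.
  by have := perm_size p12; rewrite size_map size_tuple.
have i12 : crossings_in D F1 F2 c12.
  move=> j; have := mem_tnth j c12; rewrite (perm_mem p12) => /mapP[p + ->].
  by move=> /(piece_cycles_flatten hss)[q [[]]].
have i21 : crossings_in D F2 F1 c21.
  move=> j; have := mem_tnth j c21; rewrite (perm_mem p21) => /mapP[p + ->].
  by move=> /(piece_cycles_flatten hss)[q [_ []]].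
split => //; have [p [l [xs [reps e1 e2 lk]]]] := piece_cycles_structure hss sz.
have [f1 hf1] : exists f : 'S_n, forall j, tnth c12 (f j) = (l j).1.1.
  by apply: perm_matching; rewrite (map_comp (fun p : piece G => p.1.1) l) e2.
have [f2 hf2] : exists f : 'S_n, forall j, tnth c21 (f j) = (l j).2.1.
  by apply: perm_matching; rewrite (map_comp (fun p : piece G => p.2.1) l) e2.
exists (reassemble p l (f1, f2)); apply: (reassemble_missing i12 i21 lk reps).
  by move=> L mL; rewrite hk // -e1 -map_comp.
by apply/andP; split; apply/forallP => j; rewrite ?hf1 ?hf2.
Qed.

Lemma lists_crossings_exist kappa ord : ordering_rule ord ->
  finite_set [set L | meets_both D F1 F2 L /\ kappa L != 0%N] ->
  exists (n : nat) (c12 c21 : n.-tuple (portion G)),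
    lists_crossings R D ord F1 F2 kappa c12 /\
      lists_crossings R D ord F2 F1 kappa c21.
Proof.
move=> [ord1 ord2] /(finite_decomposes F12 F1D F2D)[ss hd].
have s12 : size (ord (map (fun p : piece G =>
  p.1.1) (flatten ss))) == size (flatten ss).
  by rewrite (perm_size (ord1 _)) size_map.
have s21 : size (ord (map (fun p : piece G =>
  p.2.1) (flatten ss))) == size (flatten ss).
  by rewrite (perm_size (ord1 _)) size_map.
exists (size (flatten ss)), (Tuple s12), (Tuple s21); split.
- by apply/(decomposes_lists12 R F12 ord _ hd); split => //=; exact: ord2.
- by apply/(decomposes_lists21 R F12 ord _ hd); split => //=; exact: ord2.
Qed.

Section BridgePair.
Variables (n : nat) (c12 c21 : n.-tuple (portion G)).
Hypotheses (h12 : crossings_in D F1 F2 c12) (h21 : crossings_in D F2 F1 c21).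
Variable xi : (ubridge G n * ubridge G n)%type.
Hypothesis hxi : bridge_pairs D F1 F2 c12 c21 xi.

Let p := glue_next xi.
Let l := glued_piece c12 c21 xi.
Let xs := enum (froots p).
Let lk : linked_structure D F1 F2 p l. Proof. exact/bridge_pairsP. Qed.
Let reps : orbit_reps p xs. Proof. exact: enum_froots_reps. Qed.
Let ss := map (orbit_labels p l) xs.

Lemma glued_decomposes : decomposes D F1 F2 (glued_mult c12 c21 xi) ss.
Proof.
split=> [ps /mapP[x _ ->]|L mL].
  by split; [exact: orbit_labels_cycle | exact: orbit_labels_neq0].
rewrite glued_multE -map_comp; apply: card_roots_reps => //.
exact: structure_key_step.
Qed.

Let perm_ss : perm_eq (flatten ss) (map l (enum 'I_n)).
Proof. exact: flatten_orbit_labels. Qed.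

Lemma glued_lists (ord : seq (portion G) -> seq (portion G)) : ord c12 = c12 ->
  ord c21 = c21 ->
  lists_crossings R D ord F1 F2 (glued_mult c12 c21 xi) c12 /\
  lists_crossings R D ord F2 F1 (glued_mult c12 c21 xi) c21.
Proof.
move=> o12 o21; split.
- apply/(decomposes_lists12 R F12 ord _ glued_decomposes); split => //.
  rewrite perm_sym; apply: perm_trans (perm_map _ perm_ss) _.
  by rewrite -map_comp (eq_map (g := tnth c12)) // map_tnth_enum.
- apply/(decomposes_lists21 R F12 ord _ glued_decomposes); split => //.
  rewrite perm_sym; apply: perm_trans (perm_map _ perm_ss) _.
  rewrite -map_comp; apply/tuple_permP; exists xi.1.1.
  by rewrite /=; apply: eq_map => j.
Qed.

(** The structure of [xi] itself serves as reference structure for the double count; [ls] lists its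
    glued loops. *)
Lemma bridge_pair_count : exists (ls : seq (uloop G))
  (s : seq (ubridge G n * ubridge G n)%type),
  [/\ (forall L, L \in ls -> meets_both D F1 F2 L) /\
      (forall L, meets_both D F1 F2 L ->
        glued_mult c12 c21 xi L = count_mem L ls),
      uniq s,
      missing_parts D F1 F2 c12 c21 (glued_mult c12 c21 xi) =
        [set xi | xi \in s],
      (size s * iso_weight (@loop_period G) (map Some ls) =
       tuple_stabilizer c12 * tuple_stabilizer c21)%N &
      (\sum_(L <- ls) size (uedges L) = \sum_(j < n) size (word (l j)))%N].
Proof.
have [hss hk] := glued_decomposes; have [ls els hls] := piece_cycles_loops hss.
have kE L : meets_both D F1 F2 L -> glued_mult c12 c21 xi L =
    count_mem (Some L) (map (structure_key p l) xs).
  by move=> mL; rewrite hk // -map_comp.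
have [s [us sE sz]] := missing_partsE F12 h12 h21 lk reps kE.
exists ls, s; split => //.
- split=> // L mL; rewrite hk // els count_map; exact: eq_count.
- rewrite -els -map_comp sz.
  rewrite (_ : #|_| = #|[predX [pred f : 'S_n | [forall j,
    tnth c12 (f j) == (l j).1.1]] &
      [pred f : 'S_n | [forall j, tnth c21 (f j) == (l j).2.1]]]|);
        last by apply: eq_card.
  (* Each coset needs one element: the pieces of [xi] are indexed by [c12] through the identity and
     by [c21] through [xi.1.1]. *)
  rewrite cardX (@card_matching _ _ c12 (fun j => (l j).1.1) 1%g) => [|j];
    last by rewrite perm1.
  by rewrite (@card_matching _ _ c21 (fun j => (l j).2.1) xi.1.1).
have -> : (\sum_(j < n) size (word (l j)) =
  \sum_(q <- flatten ss) size (word q))%N.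
  by rewrite (perm_big _ perm_ss) big_map big_enum.
have : map (@cls G \o @loop_of G) ss = map Some ls by [].
elim: (ss) (ls) => [|ps t IH] [|L r] //=; first by rewrite !big_nil.
move=> [eL et]; rewrite big_cons big_cat (IH _ et) /=; congr addn.
by move/clsP: eL => [i e];
  rewrite -(size_rot i) -e /loop_of size_flatten sumnE !big_map.
Qed.

End BridgePair.

End Existence.

(** * The loop measure and the loop soup *)

Section LoopMeasure.
Variables (R : realType) (G : ograph) (g : nat) (D : subgraph G).
Implicit Types (A B : set (uloop G)) (L : uloop G).
Local Notation mu := (@loop_measure R G g D).

Lemma rho_ge0 (l : rloop G) : 0 <= rho R g l.
Proof. by rewrite mulr_ge0 // invr_ge0 ?exprn_ge0. Qed.

Lemma loop_measure_ge0 A : (0 <= mu A)%E.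
Proof. by apply: esum_ge0 => l _; rewrite lee_fin rho_ge0. Qed.

Lemma le_loop_measure A B : A `<=` B -> (mu A <= mu B)%E.
Proof.
move=> AB; rewrite /loop_measure esum_mkcond [leRHS]esum_mkcond;
  apply: le_esum => l _.
case: ifPn => [|_].
  by rewrite inE => -[lD lA]; rewrite mem_set //; split=> //; exact: AB.
by case: ifPn => // _; rewrite lee_fin rho_ge0.
Qed.

Lemma loop_measureD1 A L : A L -> (mu A = mu [set L] + mu (A `\ L))%E.
Proof.
move=> AL; rewrite /loop_measure (esumID [set l | uclass l = L]); last first.
  by move=> l _; rewrite lee_fin rho_ge0.
congr (_ + _)%E; congr (esum _ _); apply/seteqP; split => l /=.
- by move=> [[lD _] e].
- by move=> [lD e]; rewrite e.
- by move=> [[lD lA] ne].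
- by move=> [lD [lA ne]].
Qed.

Lemma rho_uclass (l : rloop G) L : uclass l = L ->
  rho R g l = g%:R ^- size (uedges L) / (size (uedges L))%:R.
Proof. by move=> <-; have [i e] := uclass_uedges l;
  rewrite /rho e size_rot. Qed.

Lemma uloop_in_edges L : uloop_in D L -> forall e, e \in uedges L -> eset D e.
Proof.
move=> [l lD <-] e; have [i el] := uclass_uedges l.
by move=> he; apply: lD; rewrite el mem_rot.
Qed.

(** A loop of length [n] and multiplicity [J] has [n / J] rootings, each of mass [g^-n / n]. *)
Lemma loop_measure1 L : uloop_in D L ->
  mu [set L] = (g%:R ^- size (uedges L) / (loop_period (Some L))%:R)%:E.
Proof.
move=> LD; set l := uedges L; set n := size l.
pose s := undup [seq rot i l | i <- iota 0 n].
pose rs : seq (rloop G) := pmap insub s.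
have scl m : m \in s -> closed_walk m.
  by rewrite mem_undup => /mapP[i _ ->]; rewrite closed_walk_rot uedges_closed.
have rsE : [set r : rloop G | rloop_in D r /\ uclass r = L] = [set` rs].
  apply/seteqP; split => r /=; rewrite mem_pmap_sub.
    move=> [_ rL]; rewrite mem_undup; have [i e] := uclass_uedges r.
    rewrite rL in e; apply/mapP; case: (ltnP i n) => [lt|le].
      by exists i; rewrite ?mem_iota.
    exists 0%N; rewrite ?mem_iota ?add0n /=;
      last by rewrite e rot_oversize ?rot0.
    by rewrite /n /l; case: (uedges L) (uedges_closed L).
  rewrite mem_undup => /mapP[i _ e]; split.
    by move=> e'; rewrite e mem_rot; exact: uloop_in_edges.
  have : cls (val r) = Some L by apply/clsP; exists i.
  by rewrite /cls valK => -[].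
have szrs : size rs = size s.
  by rewrite size_pmap_sub; apply/eqP; rewrite -all_count; apply/allP => m /scl.
have urs : uniq rs by rewrite pmap_sub_uniq ?undup_uniq.
rewrite /loop_measure /= rsE esum_fset; last first.
- by move=> r _; rewrite lee_fin rho_ge0.
- exact: finite_seq.
rewrite -(fsbig_seq _ _ urs).
rewrite (eq_big_seq (fun=> (g%:R ^- n / n%:R)%:E)) => [|r rr]; last first.
  have : [set` rs] r by [].
  by rewrite -rsE => -[_ rL]; rewrite (rho_uclass rL).
rewrite sumEFin big_const_seq count_predT iter_addr_0 szrs; congr (_%:E).
have := size_undup_rots l;
  rewrite -/n -/s -[count _ _]/(loop_period (Some L)) => /(congr1 (fun k =>
    k%:R : R)).
have n0 : n%:R != 0 :> R.
  by rewrite pnatr_eq0 -lt0n /n /l; case: (uedges L) (uedges_closed L).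
have J0 : (loop_period (Some L))%:R != 0 :> R by rewrite pnatr_eq0 -lt0n
  loop_period_gt0.
rewrite natrM => e; rewrite -[LHS]mulr_natl mulrCA; congr (_ * _).
by apply: (mulIf n0); rewrite mulfVK // -[in RHS]e mulrC mulfK.
Qed.

End LoopMeasure.

Lemma esum_subset (R : realType) (T : choiceType) (A B : set T) (f : T ->
  \bar R) :
  A `<=` B -> (forall x, B x -> (0 <= f x)%E) ->
  (\esum_(x in A) f x <= \esum_(x in B) f x)%E.
Proof.
move=> AB f0; rewrite esum_mkcond [leRHS]esum_mkcond; apply: le_esum => x _.
case: ifPn => [/set_mem Ax|_]; first by rewrite mem_set //; exact: AB.
by case: ifPn => // /set_mem; exact: f0.
Qed.

(** At rate 0 the law is the Dirac mass at 0, and the formula persists since [0 ^+ 0 = 1]. *)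
Lemma poisson_prob1 (R : realType) (r : R) (k : nat) : 0 <= r ->
  poisson_prob r 0%N [set k] = (r ^+ k / k`!%:R * expR (- r))%:E.
Proof.
rewrite le_eqVlt /poisson_prob => /orP[/eqP <-|r0].
  rewrite ltxx diracE oppr0 expR0 mulr1; case: k => [|k].
    by rewrite mem_set // expr0 fact0 divr1.
  by rewrite memNset // expr0n mul0r.
rewrite r0 esum_set1 ?lee_fin ?poisson_pmf_ge0 //.
by rewrite /poisson_pmf r0.
Qed.

Section FiniteMass.
Variables (R : realType) (G : ograph) (g : nat) (D : subgraph G).
Implicit Types (A B : set (uloop G)) (L : uloop G).
Local Notation mu := (@loop_measure R G g D).

Lemma loop_measure_esum A : mu A = \esum_(L in A) mu [set L].
Proof.
rewrite /loop_measure esum_esum; last by move=> L l _ _;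
  rewrite lee_fin rho_ge0.
apply/esym; apply: (@reindex_esum _ _ _ _ _ (fun l : rloop G => (uclass l, l)));
  split.
- by move=> l /= [lD Al]; split.
- by move=> l l' _ _ [].
- by move=> [L l] /= [AL [lD el]]; exists l; rewrite /= ?el.
Qed.

(** Rooting each loop at a visit to [F] embeds the loops into the bridges from a point of [F] to
    itself. As [J >= 1], the mass is at most the sum over [x] in [F] of the Green's function at
    [(x, x)]. *)
Lemma loop_measure_visits_lt_pinfty (F : set (vertex G)) :
  finite_set F -> F `<=` vset D ->
  (forall x y, vset D x -> vset D y -> (green R g D x y < +oo)%E) ->
  (mu [set L | uloop_in D L /\ visits F L] < +oo)%E.
Proof.
move=> finF FD hG; set A := [set L | _].
pose b L := rot (find (inF F) (uedges L)) (uedges L).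
have bP L : A L -> exists x, [/\ F x, ohead (map (@src G) (b L)) = Some x
  & bridges D x x (b L)].
  move=> [LD [e he Fe]].
  have hF : has (inF F) (uedges L) by apply/hasP; exists e => //;
    exact: mem_set.
  have [u [e' [v [eL f' hu]]]] := split_first hF.
  have bE : b L = e' :: (v ++ u).
    by rewrite /b eL find_cat (negbTE hu) /= f' addn0 rot_size_cat.
  exists (src e'); have Fx : F (src e') by exact: set_mem.
  rewrite bE /=; split => //.
  have : closed_walk (b L) by rewrite closed_walk_rot uedges_closed.
  rewrite bE /closed_walk => wb; split => //; try exact: FD.
  by move=> e2; rewrite -bE mem_rot; exact: uloop_in_edges.
have clsb L : cls (b L) = Some L by rewrite cls_rot cls_uedges.
have /choice[xb xbP] : forall L, exists x, A L ->
    [/\ F x, ohead (map (@src G) (b L)) = Some x & bridges D x x (b L)].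
  move=> L; case: (pselect (A L)) => [AL|nAL].
    by have [x hx] := bP L AL; exists x.
  by case: (uedges L) (uedges_closed L) => // e _ _; exists (src e).
rewrite loop_measure_esum.
apply: (@le_lt_trans _ _ (\esum_(L in A) (g%:R ^- size (b L))%:E)%E).
  apply: le_esum => L [LD _]; rewrite loop_measure1 // lee_fin size_rot.
  rewrite ler_piMr ?invr_ge0 ?exprn_ge0 // invf_le1 ?ltr0n ?loop_period_gt0 //.
  by rewrite ler1n loop_period_gt0.
apply: (@le_lt_trans _ _ (\esum_(k in F `*`` (fun x =>
  bridges D x x)) (g%:R ^- size k.2)%:E)%E).
  rewrite -(@esum_image _ _ _ A (fun L => (xb L, b L)) (fun k =>
    (g%:R ^- size k.2)%:E)).
    apply: esum_subset => [_ [L AL <-]|k _].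
      by have [Fx _ hb] := xbP L AL; split.
    by rewrite lee_fin invr_ge0 exprn_ge0.
  by move=> L L' _ _ [_ e]; have := clsb L; rewrite e clsb => -[].
rewrite -(@esum_esum _ _ _ _ _ (fun _ b => (g%:R ^- size b)%:E)); last first.
  by move=> *; rewrite lee_fin invr_ge0 exprn_ge0.
rewrite esum_fset //; last first.
  by move=> x _; apply: esum_ge0 => b' _; rewrite lee_fin invr_ge0 exprn_ge0.
rewrite fsbig_finite //= big_seq; apply: lte_sum_pinfty => x.
by rewrite in_fset_set // => /set_mem Fx; apply: hG; exact: FD.
Qed.

End FiniteMass.

Section IsoWeight.
Variables (R : realType) (G : ograph).

Lemma iso_weight_prod (ls r : seq (uloop G)) : uniq r -> {subset ls <= r} ->
  iso_weight (@loop_period G) (map Some ls) =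
  (\prod_(L <- r) (loop_period (Some L) ^ count_mem L ls *
    (count_mem L ls)`!))%N.
Proof.
move=> ur; elim: ls => [|L ls IH] sub.
  by rewrite /= big1.
rewrite [LHS]/= IH => [|L' hL']; last by apply: sub; rewrite inE hL' orbT.
have Lr : L \in r by apply: sub; rewrite mem_head.
rewrite !(bigD1_seq L Lr ur) /= eqxx add1n expnS factS.
have -> : count (fun j => j == Some L) (map Some ls) = count_mem L ls.
  by rewrite count_map; apply: eq_count.
rewrite mulnA [in RHS]mulnACA; congr (_ * _)%N.
apply: eq_bigr => L' /negbTE nL; by rewrite eq_sym nL.
Qed.

(** The multiplicities [J] and the factorials of the Poisson weights combine into the number of
    automorphisms. *)
Lemma prod_loop_weights (q : R) (ls : seq (uloop G)) :
  \prod_(L <- undup ls)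
    ((q ^- size (uedges L) / (loop_period (Some L))%:R) ^+ count_mem L ls
                          / (count_mem L ls)`!%:R) =
  q ^- (\sum_(L <- ls) size (uedges L))%N / (iso_weight (@loop_period G)
    (map Some ls))%:R.
Proof.
have sub : {subset ls <= undup ls} by move=> L; rewrite mem_undup.
rewrite (iso_weight_prod (undup_uniq ls) sub) natr_prod -prodfV.
have -> : (\sum_(L <- ls) size (uedges L) =
  \sum_(L <- undup ls) count_mem L ls * size (uedges L))%N.
  by rewrite sum_count_mul ?undup_uniq.
rewrite -exprVn expr_sum -big_split; apply: eq_bigr => L _ /=.
by rewrite expr_div_n natrM natrX invfM mulrA -exprVn -exprM mulnC.
Qed.

End IsoWeight.

Section SoupProbability.
Variables (R : realType) (G : ograph) (g : nat) (D : subgraph G).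
Variables (d : measure_display) (Omega : measurableType d).
Variables (P : probability Omega R) (N : Omega -> uloop G -> nat).
Hypothesis soup : loop_soup g D 1 P N.
Implicit Types (A B : set (uloop G)) (L : uloop G).
Local Notation mu := (@loop_measure R G g D).

Lemma npoints1 (nu : uloop G -> nat) L : npoints R nu [set L] = (nu L)%:R%:E.
Proof. by rewrite /npoints esum_set1 // lee_fin. Qed.

Lemma npoints0 (nu : uloop G -> nat) A :
  npoints R nu A = 0%:R%:E <-> forall L, A L -> nu L = 0%N.
Proof.
split=> [e L AL|h]; last by rewrite /npoints esum1 // => L /h ->.
have : (npoints R nu [set L] <= npoints R nu A)%E.
  by apply: esum_subset => [_ /= ->//|L' _]; rewrite lee_fin.
by rewrite npoints1 e lee_fin ler_nat leqn0 => /eqP.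
Qed.

Lemma soup_count A k : (mu A < +oo)%E ->
  P [set w | npoints R (N w) A = k%:R%:E] =
  (fine (mu A) ^+ k / k`!%:R * expR (- fine (mu A)))%:E.
Proof.
move=> fA; case: soup => _ h _; rewrite h mul1e // poisson_prob1 //.
by rewrite fine_ge0 // loop_measure_ge0.
Qed.

Lemma loop_measure_split A (s : seq (uloop G)) : uniq s -> (forall L, L \in s ->
  A L) ->
  (mu A = mu (A `\` [set` s]) + \sum_(L <- s) mu [set L])%E.
Proof.
elim: s A => [|L s IH] A /=.
  by move=> _ _; rewrite big_nil adde0; congr mu; apply/seteqP;
    split => [L AL|L [AL _]] //; split.
move=> /andP[nL us] sA;
  rewrite big_cons (loop_measureD1 R g D (sA _ (mem_head _ _))).
rewrite (IH (A `\ L)) //; last first.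
  move=> L' hL'; split; first by apply: sA; rewrite inE hL' orbT.
  by move=> /= e; rewrite -e hL' in nL.
rewrite addeCA; congr (mu _ + _)%E; apply/seteqP; split => L' /=.
- by move=> [[AL nLL] ns]; split=> //; rewrite inE; apply/negP; rewrite negb_or;
    apply/andP; split; [apply/eqP|apply/negP].
- by move=> [AL /negP]; rewrite inE negb_or => /andP[/eqP h1 /negP h2].
Qed.

(** The conditions on [A] amount to one count for each distinct loop of [ls] and a zero count for
    all the others together. The exponential factors recombine by additivity of [mu]. *)
Lemma soup_prob A (ls : seq (uloop G)) : (mu A < +oo)%E ->
  (forall L, L \in ls -> A L) ->
  P [set w | forall L, A L -> N w L = count_mem L ls] =
  (expR (- fine (mu A)) * \prod_(L <- undup ls)
     (fine (mu [set L]) ^+ count_mem L ls / (count_mem L ls)`!%:R))%:E.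
Proof.
move=> fA lsA; set S := undup ls.
have fsub B : B `<=` A -> (mu B < +oo)%E by move=> BA; apply: le_lt_trans fA;
  exact: le_loop_measure.
have SA L : L \in S -> A L by rewrite mem_undup; exact: lsA.
have f1 L : L \in S -> (mu [set L] < +oo)%E by move=> /SA AL;
  apply: fsub => _ ->.
(* Index 0 stands for the remainder, the other indices for the distinct loops of [ls]. *)
pose B (i : 'I_(size S).+1) : set (uloop G) :=
  if unlift ord0 i is Some j then [set tnth (in_tuple S) j] else A `\` [set` S].
pose k (i : 'I_(size S).+1) : nat :=
  if unlift ord0 i is Some j then count_mem (tnth (in_tuple S) j) ls else 0%N.
have BA i : B i `<=` A.
  rewrite /B; case: unliftP => [j _ L /= ->|_ L []//].
  by apply: SA; exact: mem_tnth.
have tinj : injective (tnth (in_tuple S)) by apply/tuple_uniqP;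
  exact: undup_uniq.
have tB : trivIset setT B.
  move=> i j _ _; rewrite /B; case: unliftP => [a ->|->];
    case: unliftP => [b ->|->] //.
  - by move=> [L /= [-> /tinj ->]].
  - by move=> [L /= [-> [_ []]]]; exact: mem_tnth.
  - by move=> [L /= [[_ h] e]]; case: h; rewrite e; exact: mem_tnth.
have -> : [set w | forall L, A L -> N w L = count_mem L ls] =
    [set w | forall i, npoints R (N w) (B i) = (k i)%:R%:E].
  apply/seteqP; split => w /= h.
    move=> i; rewrite /B /k; case: unliftP => [j _|_].
      by rewrite npoints1 h //; apply: SA; exact: mem_tnth.
    apply/npoints0 => L [AL nS]; rewrite h //; apply/count_memPn/negP.
    by rewrite -mem_undup.
  move=> L AL; case: (boolP (L \in S)) => [LS|nLS].
    have /tnthP[j ej] : L \in in_tuple S by [].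
    have := h (lift ord0 j); rewrite /B /k liftK npoints1 -ej => -[] /eqP.
    by rewrite eqr_nat => /eqP.
  have := h ord0; rewrite /B /k unlift_none => /npoints0 ->.
    by apply/esym/count_memPn; rewrite -mem_undup.
  by split => //=; exact/negP.
have [_ _ indep] := soup; rewrite indep //; last first.
  by move=> i; rewrite mul1e; apply: fsub.
rewrite big_ord_recl /= soup_count; last by apply: fsub.
under eq_bigr => j _.
  rewrite soup_count; last by apply: fsub.
  rewrite /B /k liftK.
  over.
rewrite prodEFin -EFinM; congr (_%:E).
rewrite /B /k unlift_none expr0 fact0 divr1 mul1r.
rewrite -(big_tnth _ _ _ predT (fun L =>
  fine (mu [set L]) ^+ count_mem L ls / (count_mem L ls)`!%:R *
    expR (- fine (mu [set L])))).
rewrite big_split /= mulrCA mulrC; congr (_ * _).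
have fE B' : (mu B' < +oo)%E -> mu B' = (fine (mu B'))%:E.
  by move=> fB; rewrite fineK // ge0_fin_numE ?loop_measure_ge0.
have : fine (mu A) = fine (mu (A `\` [set` S])) + \sum_(L <- S) fine (mu [set
  L]).
  apply: EFin_inj; rewrite EFinD -sumEFin -!fE //; last by apply: fsub => L [].
  rewrite (loop_measure_split (undup_uniq ls) SA); congr (_ + _)%E.
  by apply: eq_big_seq => L LS; rewrite -fE //; exact: f1.
by move=> ->; rewrite opprD expRD -sumrN expR_sum.
Qed.

End SoupProbability.

(** * Sums and unions over countable families *)

Section EsumProducts.
Variable R : realType.

Lemma esumZl (T : choiceType) (A : set T) (c : R) (f : T -> \bar R) :
  0 <= c -> (forall x, (0 <= f x)%E) ->
  (\esum_(x in A) (c%:E * f x) = c%:E * \esum_(x in A) f x)%E.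
Proof.
move=> c0 f0.
have le (k : R) h : 0 <= k -> (forall x, (0 <= h x)%E) ->
    (\esum_(x in A) (k%:E * h x) <= k%:E * \esum_(x in A) h x)%E.
  move=> k0 h0; apply: ge_ereal_sup => _ [X [fX XA] <-].
  rewrite -ge0_mule_fsumr //; apply: lee_wpmul2l; rewrite ?lee_fin //;
    apply: esum_ge; exists X => //.
have [->|cn0] := eqVneq c 0.
  by rewrite mul0e; apply: esum1 => x _; rewrite mul0e.
apply/eqP; rewrite eq_le le //=.
(* The converse inequality is the first one for [c^-1]. *)
rewrite -[leRHS]mul1e -(mulfV cn0) EFinM -muleA.
apply: lee_wpmul2l; rewrite ?lee_fin //.
apply: le_trans (le c^-1 (fun x => c%:E * f x)%E _ _); rewrite ?invr_ge0 //.
  by apply: le_esum => x Ax; rewrite muleA -EFinM mulVf ?mul1e.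
by move=> x; rewrite mule_ge0 // lee_fin.
Qed.

Lemma esum_prod (T1 T2 : choiceType) (A : set T1) (B : set T2) (f : T1 ->
  R) (h : T2 -> R) :
  (forall x, 0 <= f x) -> (forall y, 0 <= h y) ->
  (\esum_(y in B) (h y)%:E < +oo)%E ->
  (\esum_(k in A `*` B) (f k.1 * h k.2)%:E =
   (\esum_(x in A) (f x)%:E) * (\esum_(y in B) (h y)%:E))%E.
Proof.
move=> f0 h0 hfin.
have H0 : (0 <= \esum_(y in B) (h y)%:E)%E by apply: esum_ge0 => y _;
  rewrite lee_fin.
have HE : (\esum_(y in B) (h y)%:E)%E = (fine (\esum_(y in B) (h y)%:E))%:E.
  by rewrite fineK // ge0_fin_numE.
rewrite muleC HE -esumZl ?fine_ge0 //.
rewrite -(@esum_esum _ _ _ A (fun=> B) (fun x y => (f x * h y)%:E)); last first.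
  by move=> x y _ _; rewrite lee_fin mulr_ge0.
apply: eq_esum => x _; under eq_esum do rewrite EFinM.
by rewrite esumZl // HE muleC.
Qed.

(** Distributivity for infinite sums; it turns the total weight of independent bridges into a
    product of Green's functions. *)
Lemma esum_tuple (T : choiceType) n (A : 'I_n -> set T) (f : 'I_n -> T -> R) :
  (forall j x, 0 <= f j x) -> (forall j, \esum_(x in A j) (f j x)%:E < +oo)%E ->
  \esum_(t in [set t : n.-tuple T | forall j, A j (tnth t j)])
    (\prod_(j < n) f j (tnth t j))%:E =
  (\prod_(j < n) fine (\esum_(x in A j) (f j x)%:E))%:E.
Proof.
elim: n A f => [|n IH] A f f0 ffin.
  rewrite (_ : [set t | _] = [set [tuple]]); last first.
    by apply/seteqP; split => t /=; [rewrite [t]tuple0 | move=> _ []].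
  by rewrite esum_set1 !big_ord0 ?lee_fin.
pose B : set (n.-tuple T) := [set t | forall j, A (lift ord0 j) (tnth t j)].
pose c (k : T * n.-tuple T) : n.+1.-tuple T := [tuple of k.1 :: k.2].
rewrite (@reindex_esum _ _ _ (A ord0 `*` B) _ c); last first.
  split.
  - move=> [x t] /= [Ax Bt] j; case: (unliftP ord0 j) => [i ->|->].
      by rewrite tnthS; exact: Bt.
    by rewrite tnth0.
  - by move=> [x t] [y u] _ _ /(congr1 val) [-> /val_inj ->].
  - move=> t At; exists (thead t, [tuple of behead t]);
      last by rewrite /c /= -tuple_eta.
    split; first exact: At.
    move=> j; rewrite tnth_behead; have := At (lift ord0 j).
    by rewrite (_ : inord j.+1 = lift ord0 j) //; apply: val_inj;
      rewrite /= inordK // ltnS.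
under eq_esum => k _.
  rewrite big_ord_recl tnth0; under eq_bigr do rewrite tnthS.
  over.
have IH' := IH _ _ (fun j => f0 (lift ord0 j)) (fun j => ffin (lift ord0 j)).
rewrite (@esum_prod _ _ (A ord0) B (f ord0) (fun t =>
  \prod_(j < n) f (lift ord0 j) (tnth t j))) //.
- rewrite IH' big_ord_recl EFinM fineK // ge0_fin_numE //.
  by apply: esum_ge0 => x _; rewrite lee_fin.
- by move=> t; exact: prodr_ge0.
- by rewrite IH' ltry.
Qed.

End EsumProducts.

Section CountableUnions.
Variables (R : realType) (d : measure_display) (Omega : measurableType d).
Variables (P : {measure set Omega ->
  \bar R}) (T : choiceType) (A : set T) (F : T -> set Omega).
Hypotheses (cA : countable A) (mF : forall x, A x -> measurable (F x)).

(** Reindexing by [nat] gives access to countable additivity, which concerns sequences of events. *)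
Let nat_family : exists f : T -> nat, exists F' : nat -> set Omega,
  [/\ {in A &, injective f}, forall x, A x -> F' (f x) = F x,
      forall k, (f @` A) k ->
        measurable (F' k) & \bigcup_(x in A) F x = \bigcup_(k in f @` A) F' k].
Proof.
have /countable_injP[f injf] := cA.
exists f, (fun k => \bigcup_(x in [set x | A x /\ f x = k]) F x).
have FE x : A x -> \bigcup_(y in [set y | A y /\ f y = f x]) F y = F x.
  move=> Ax; apply/seteqP; split => w; last by exists x.
  by move=> [y [Ay /injf e] Fy]; rewrite -e // ?inE.
split=> // [k [x Ax <-]|]; first by rewrite FE //; exact: mF.
apply/seteqP; split => w.
  by move=> [x Ax Fx]; exists (f x); [exists x | rewrite /= FE].
by move=> [k [x Ax <-]]; rewrite FE // => Fx; exists x.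
Qed.

Lemma countable_bigcup_measurable : measurable (\bigcup_(x in A) F x).
Proof. by have [f [F' [_ _ mF' ->]]] := nat_family;
  exact: bigcup_measurable. Qed.

Lemma measure_countable_bigcup : trivIset A F ->
  P (\bigcup_(x in A) F x) = \esum_(x in A) P (F x).
Proof.
move=> tF; have [f [F' [injf FE mF' ->]]] := nat_family.
rewrite measure_bigcup //; last first.
  move=> _ _ [x Ax <-] [y Ay <-]; rewrite !FE // => h; congr f; exact: tF.
rewrite nneseries_esum // set_mem_set esum_image; last by move=> x y;
  apply: injf.
by apply: eq_esum => x Ax; rewrite FE.
Qed.

Lemma measure_countable_bigcup0 : (forall x, A x -> P (F x) = 0%E) ->
  P (\bigcup_(x in A) F x) = 0%E.
Proof.
move=> F0; have [f [F' [injf FE mF' ->]]] := nat_family.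
apply/negligibleP; first exact: bigcup_measurable.
rewrite bigcup_mkcond; apply: negligible_bigcup => k.
case: ifPn => [/set_mem [x Ax <-]|_]; last exact: negligible_set0.
by rewrite FE //; apply/negligibleP; [exact: mF | exact: F0].
Qed.

End CountableUnions.

(** * Countability of loops and of pairs of bridges *)

Section Countability.

Lemma countable_seqs (T : eqType) (A : set T) : countable A ->
  countable [set s : seq T | forall x, x \in s -> A x].
Proof.
move=> /countable_injP[f injf]; apply/countable_injP.
exists (fun s => choice.pickle (map f s)) => s t /set_mem sA /set_mem tA.
move=> /(pcan_inj choice.pickleK) e;
  elim: s t sA tA e => [|x s IH] [|y t] //= sA tA [exy est].
congr (_ :: _); last first.
  by apply: IH => // z hz; [apply: sA|apply: tA]; rewrite inE hz orbT.
by apply: injf => //; apply: mem_set; [apply: sA|apply: tA]; rewrite mem_head.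
Qed.

Variables (G : ograph) (g : nat).
Hypothesis regular : out_regular G g.

(** Finite out-degrees: for each [k], countably many edges are reached from [F] in [k] steps. *)
Lemma countable_walk_edges (F : set (vertex G)) : finite_set F ->
  exists2 E : set (edge G), countable E &
    forall x b y, F x -> walk x b y -> forall e, e \in b -> E e.
Proof.
move=> finF; pose Ek := fix Ek k : set (edge G) :=
  if k is k'.+1 then \bigcup_(e in Ek k') [set e' | src e' = tgt e]
  else \bigcup_(x in F) [set e | src e = x].
have c1 (x : vertex G) : countable [set e | src e = x].
  by rewrite (eq_countable (regular x)); exact: countableP.
have ck k : countable (Ek k).
  elim: k => [|k IH] /=; apply: bigcup_countable => //.
  exact: finite_set_countable.
exists (\bigcup_k Ek k); first exact: bigcup_countable.
move=> x b y Fx w e eb.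
have gen b' k x' : (forall e', src e' = x' -> Ek k e') -> walk x' b' y ->
    e \in b' -> exists k', Ek k' e.
  elim: b' k x' => // e' b' IH k x' hk /andP[/eqP es w'].
  rewrite inE => /orP[/eqP ->|eb']; first by exists k; exact: hk.
  by apply: (IH k.+1 _ _ w' eb') => e'' he''; exists e' => //; exact: hk.
have [|k hk] := gen b 0%N x _ w eb; first by move=> e' es; exists x.
by exists k.
Qed.

Variables (D : subgraph G) (F1 F2 : set (vertex G)).
Hypotheses (fin1 : finite_set F1) (fin2 : finite_set F2).

Lemma countable_meets_both : countable (meets_both D F1 F2).
Proof.
have [E cE hE] := countable_walk_edges fin1.
have /countable_injP[f injf] := countable_seqs cE.
apply/countable_injP;
  exists (f \o @uedges G) => L L' /set_mem mL /set_mem mL' /= e.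
have sub L0 : meets_both D F1 F2 L0 -> forall e, e \in uedges L0 -> E e.
  move=> [_ [e0 he0 Fe0] _] e1 he1.
  (* Rooting at a visit to [F1] makes the loop a walk started in [F1]. *)
  have : closed_walk (rot (index e0 (uedges L0)) (uedges L0)).
    by rewrite closed_walk_rot uedges_closed.
  have := rot_index he0; rewrite /closed_walk => er; rewrite er => w.
  by apply: (hE _ _ _ Fe0 w); rewrite -er mem_rot.
have /(congr1 (@cls G)) : uedges L = uedges L' by apply: injf; rewrite ?inE //;
  apply: sub.
by rewrite !cls_uedges => -[].
Qed.

Lemma countable_bridge_pairs n (c12 c21 : n.-tuple (portion G)) :
  crossings_in D F1 F2 c12 -> crossings_in D F2 F1 c21 ->
  countable (bridge_pairs D F1 F2 c12 c21).
Proof.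
move=> h12 h21.
have [|E cE hE] := @countable_walk_edges (F1 `|` F2);
  first by rewrite finite_setU.
have /countable_injP[f injf] := countable_seqs cE.
pose code (b : ubridge G n) := (b.1, map f b.2).
apply/countable_injP; exists (fun xi => choice.pickle (code xi.1, code xi.2)).
move=> xi xi' /set_mem [b1 b2] /set_mem [b1' b2'] /(pcan_inj choice.pickleK) [s1
  t1 s2 t2].
have tuple_inj (u v : n.-tuple (seq (edge G))) :
    (forall j e, e \in tnth u j -> E e) -> (forall j e, e \in tnth v j ->
      E e) ->
    map f u = map f v -> u = v.
  move=> hu hv e; apply: eq_from_tnth => j; apply: injf; rewrite ?inE //=.
  - exact: hu.
  - exact: hv.
  have := congr1 (fun s => nth (f (tnth u j)) s j) e.
  by rewrite !(nth_map [::]) ?size_tuple // -!tnth_nth.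
have hb D' (x : vertex G) y b : bridges D' x y b -> (F1 `|` F2) x ->
  forall e, e \in b -> E e.
  by move=> [_ _ w _] Fx; exact: hE w.
have in1 j : (F1 `|` F2) (tnth (ends c12) j).
  by rewrite tnth_map; right; have [[]] := h12 j.
have in2 j : (F1 `|` F2) (tnth (ends c21) j).
  by rewrite tnth_map; left; have [[]] := h21 j.
case: xi xi' b1 b2 b1' b2' s1 t1 s2 t2 => [[s t] [s' t']] [[u v] [u' v']] /=.
move=> b1 b2 b1' b2' -> t1 -> t2; congr ((_, _), (_, _)).
- by apply: tuple_inj t1 => j;
    [exact: hb (b1 j) (in1 j) | exact: hb (b1' j) (in1 j)].
- by apply: tuple_inj t2 => j;
    [exact: hb (b2 j) (in2 j) | exact: hb (b2' j) (in2 j)].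
Qed.

End Countability.

(** * Conditional law of the missing parts *)

Section UnorderedBridges.
Variables (R : realType) (G : ograph) (g : nat) (D : subgraph G).
Hypothesis regular : out_regular G g.
Hypothesis green_fin :
  forall x y, vset D x -> vset D y -> (green R g D x y < +oo)%E.

Lemma green_ge0 (x y : vertex G) : (0 <= green R g D x y)%E.
Proof. by apply: esum_ge0 => b _; rewrite lee_fin invr_ge0 exprn_ge0. Qed.

Lemma green_lt_pinfty (x y : vertex G) : (green R g D x y < +oo)%E.
Proof.
case: (pselect (vset D x /\ vset D y)) => [[Dx Dy]|nD]; first exact: green_fin.
rewrite /green (_ : bridges D x y = set0) ?esum_set0 ?ltry //.
by apply/seteqP; split => // b [Dx Dy _ _]; case: nD.
Qed.

Lemma green_fineK (x y : vertex G) : (fine (green R g D x y))%:E =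
  green R g D x y.
Proof. by rewrite fineK // ge0_fin_numE ?green_ge0 // green_lt_pinfty. Qed.

(** If [g = 0] there is no edge, and the only bridges are empty, with weight 1. *)
Lemma pathweight_gt0 x b y : bridges D x y b -> 0 < g%:R ^- size b :> R.
Proof.
case: b => [|e b] _; first by rewrite expr0 invr1.
rewrite invr_gt0 exprn_gt0 // ltr0n lt0n; apply/eqP => g0.
have := regular (src e); rewrite g0 II0 card_eq0 => /eqP h.
by have : [set e' | src e' = src e] e by []; rewrite h.
Qed.

Lemma green_gt0 x b y : bridges D x y b -> 0 < fine (green R g D x y).
Proof.
move=> hb; apply: lt_le_trans (pathweight_gt0 hb) _.
rewrite -lee_fin green_fineK; apply: esum_ge; exists [set b];
  last by rewrite fsbig_set1.
by split => // _ ->.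
Qed.

Variables (n : nat) (X Y : n.-tuple (vertex G)).
Implicit Types (b : ubridge G n).

Definition ubridge_weight b : R := \prod_(j < n) g%:R ^- size (tnth b.2 j).

Lemma ubridge_weight_ge0 b : 0 <= ubridge_weight b.
Proof. by apply: prodr_ge0 => j _; rewrite invr_ge0 exprn_ge0. Qed.

(** The permanent of the matrix of Green's functions from [X] to [Y]. *)
Definition ubridge_mass : R := \sum_(s : 'S_n) perm_weight R g D X Y s.

Lemma perm_weight_ge0 s : 0 <= perm_weight R g D X Y s.
Proof. by apply: prodr_ge0 => j _; rewrite fine_ge0 // green_ge0. Qed.

Lemma perm_weight_gt0 b : ubridges D X Y b -> 0 < perm_weight R g D X Y b.1.
Proof. by move=> hb; apply: prodr_gt0 => j _; exact: green_gt0 (hb j). Qed.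

Lemma ubridge_mass_gt0 b : ubridges D X Y b -> 0 < ubridge_mass.
Proof.
move=> hb; rewrite /ubridge_mass (bigD1 b.1) //=.
by rewrite ltr_pwDl ?perm_weight_gt0 // sumr_ge0 // => s _;
  exact: perm_weight_ge0.
Qed.

Lemma ubridges_definedP b : ubridges D X Y b -> ubridge_defined R g D X Y.
Proof. by move=> hb; exists b.1; exact: perm_weight_gt0. Qed.

(** The Green's functions weighting the permutation cancel the normalisations of its bridges. *)
Lemma ubridge_probE b : ubridges D X Y b ->
  ubridge_prob R g D X Y b = ubridge_weight b / ubridge_mass.
Proof.
move=> hb; have w0 := perm_weight_gt0 hb; rewrite /ubridge_prob -/ubridge_mass.
rewrite mulrAC; congr (_ / _).
rewrite /perm_weight -big_split; apply: eq_bigr => j _ /=.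
by rewrite /bridge_prob mem_set // mulrC divfK // gt_eqF // (green_gt0 (hb j)).
Qed.

Lemma ubridge_prob0 b : ~ ubridges D X Y b -> ubridge_prob R g D X Y b = 0.
Proof.
move=> /existsNP[j nb]; rewrite /ubridge_prob (bigD1 j) //=.
by rewrite /bridge_prob memNset // mul0r mulr0.
Qed.

Lemma esum_ubridge_weight : \esum_(b in ubridges D X Y)
  (ubridge_weight b)%:E = ubridge_mass%:E.
Proof.
have -> : ubridges D X Y = [set: 'S_n] `*`` (fun s =>
    [set t : n.-tuple (seq (edge G)) | forall j, bridges D (tnth X j)
      (tnth Y (s j)) (tnth t j)]).
  by apply/seteqP; split => [[s t] h|[s t] [_ h]] //; split.
rewrite -(@esum_esum _ _ _ _ _ (fun s t =>
  (\prod_(j < n) g%:R ^- size (tnth t j))%:E)); last first.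
  by move=> s t _ _; rewrite lee_fin; apply: prodr_ge0 => j _;
    rewrite invr_ge0 exprn_ge0.
rewrite (eq_esum (b := fun s => (perm_weight R g D X Y s)%:E)) => [|s _];
  last first.
  apply: (@esum_tuple R _ n (fun j =>
    bridges D (tnth X j) (tnth Y (s j))) (fun _ w => g%:R ^- size w)).
    by move=> j w; rewrite invr_ge0 exprn_ge0.
  by move=> j; exact: green_lt_pinfty.
rewrite (_ : [set: 'S_n] = [set` enum 'S_n]); last first.
  by apply/seteqP; split => // s _; rewrite /= mem_enum.
rewrite esum_fset ?finite_seq //; last by move=> s _; rewrite lee_fin;
  exact: perm_weight_ge0.
by rewrite -(fsbig_seq _ _ (enum_uniq 'S_n)) sumEFin big_enum.
Qed.

End UnorderedBridges.

Lemma green_remove_lt_pinfty (R : realType) (G : ograph) (g : nat)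
  (D : subgraph G) (F : set (vertex G)) :
  (forall x y, vset D x -> vset D y -> (green R g D x y < +oo)%E) ->
  forall x y, vset (remove D F) x -> vset (remove D F) y ->
    (green R g (remove D F) x y < +oo)%E.
Proof.
move=> h x y [Dx _] [Dy _]; apply: le_lt_trans (h x y Dx Dy).
apply: esum_subset => [b [_ _ w hb]|b _];
  last by rewrite lee_fin invr_ge0 exprn_ge0.
by split => // e /hb[].
Qed.

Lemma uniform_mass_seq (R : realType) (T : choiceType) (s : seq T)
  (t : T) : uniq s -> t \in s ->
  uniform_mass R [set x | x \in s] t = (size s)%:R^-1.
Proof.
move=> us ts; rewrite /uniform_mass mem_set //; congr (_%:R^-1).
have -> : [set x | x \in s] = [set` [fset x in s]%fset].
  by apply/seteqP; split => x /=; rewrite !inE.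
by rewrite set_fsetK card_fseq undup_id.
Qed.

Section Soup.
Variables (R : realType) (G : ograph) (g : nat) (D : subgraph G).
Variables (F1 F2 : set (vertex G)) (d : measure_display)
  (Omega : measurableType d).
Variables (P : probability Omega R) (N : Omega -> uloop G -> nat).
Hypothesis regular : out_regular G g.
Hypothesis green_fin :
  forall x y, vset D x -> vset D y -> (green R g D x y < +oo)%E.
Hypotheses (fin1 : finite_set F1) (fin2 : finite_set F2).
Hypotheses (F1D : F1 `<=` vset D) (F2D : F2 `<=` vset D)
  (F12 : F1 `&` F2 = set0).
Hypothesis soup : loop_soup g D 1 P N.
Local Notation meets := (meets_both D F1 F2).
Local Notation mu := (@loop_measure R G g D).

Lemma loop_measure_meets_lt_pinfty : (mu meets < +oo)%E.
Proof.
apply: le_lt_trans (loop_measure_visits_lt_pinfty fin1 F1D green_fin).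
by apply: le_loop_measure => L [LD v1 _].
Qed.

Let sub_fin (A : set (uloop G)) : A `<=` meets -> (mu A < +oo)%E.
Proof. by move=> h; apply: le_lt_trans loop_measure_meets_lt_pinfty;
  exact: le_loop_measure. Qed.

Lemma measurable_npoints (A : set (uloop G)) x : A `<=` meets ->
  measurable [set w | npoints R (N w) A = x].
Proof.
move=> Am; have [mf _ _] := soup.
have fA : (1%:E * mu A < +oo)%E by rewrite mul1e; exact: sub_fin.
by have := mf A fA measurableT [set x] (emeasurable_set1 x); rewrite setTI.
Qed.

Definition same_loops (kappa : uloop G -> nat) : set Omega :=
  [set w | forall L, meets L -> N w L = kappa L].

(** Only countably many loops meet both sets. *)
Lemma measurable_same_loops kappa : measurable (same_loops kappa).
Proof.
rewrite -[same_loops kappa]setCK; apply: measurableC.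
have -> : ~` same_loops kappa =
  \bigcup_(L in meets) ~` [set w | npoints R (N w) [set L] = (kappa L)%:R%:E].
  apply/seteqP; split => w /=.
    move=> /existsNP[L /not_implyP[mL ne]]; exists L => //=.
    by rewrite npoints1 => -[] /eqP; rewrite eqr_nat => /eqP.
  by move=> [L mL /= ne] h; apply: ne; rewrite npoints1 h.
apply: countable_bigcup_measurable => [|L mL].
  by apply: (countable_meets_both regular).
by apply/measurableC/measurable_npoints => _ ->.
Qed.

(** A Poisson variable of finite rate is finite almost surely: its masses at the integers sum to
    1. *)
Lemma ae_finite_meets : \forall w \ae P,
  finite_set [set L | meets L /\ N w L != 0%N].
Proof.
pose U := \bigcup_(k in [set: nat]) [set w | npoints R (N w) meets = k%:R%:E].
have mU k : measurable [set w | npoints R (N w) meets =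
  k%:R%:E] by exact: measurable_npoints.
exists (~` U); split.
- by apply: measurableC; exact: bigcup_measurable.
- rewrite probability_setC; last exact: bigcup_measurable.
  suff -> : P U = 1%E by rewrite subee.
  have [_ hk _] := soup.
  rewrite /U measure_bigcup //; last first.
    by move=> i j _ _ [w [/= -> [] /eqP]]; rewrite eqr_nat => /eqP.
  rewrite (eq_eseriesr (g := fun k =>
    poisson_prob (fine (mu meets)) 0%N [set k])); last first.
    move=> k _; have fm : (1%:E * mu meets < +oo)%E.
      by rewrite mul1e loop_measure_meets_lt_pinfty.
    by have := hk meets fm k; rewrite mul1e.
  rewrite -(@measure_bigcup _ _ _ (poisson_prob (fine (mu meets)) 0%N) setT (fun
    k => [set k])) //.
    rewrite (_ : \bigcup_(n in _) _ = setT);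
      first exact: (probability_setT (poisson_prob _ 0%N)).
    by apply/seteqP; split => // k _; exists k.
  by move=> i j _ _ [k [/= <- <-]].
move=> w /=; apply: contra_not => -[k _ /= hk].
by apply: esum_nat_finite hk.
Qed.

Lemma lists_crossings_agree12 ord kappa kappa' c :
  (forall L, meets L -> kappa L = kappa' L) ->
  lists_crossings R D ord F1 F2 kappa c ->
    lists_crossings R D ord F1 F2 kappa' c.
Proof.
move=> hk [oc hc hm]; split => // a ca; rewrite hm //; apply: eq_esum => L LD.
have [->|oL] := eqVneq (occurrences a L) 0%N; first by rewrite !muln0.
by rewrite hk //; exact: occurrences_meets12 ca LD oL.
Qed.

Lemma lists_crossings_agree21 ord kappa kappa' c :
  (forall L, meets L -> kappa L = kappa' L) ->
  lists_crossings R D ord F2 F1 kappa c ->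
    lists_crossings R D ord F2 F1 kappa' c.
Proof.
move=> hk [oc hc hm]; split => // a ca; rewrite hm //; apply: eq_esum => L LD.
have [->|oL] := eqVneq (occurrences a L) 0%N; first by rewrite !muln0.
by rewrite hk //; exact: occurrences_meets21 ca LD oL.
Qed.

End Soup.

(** * Joint law of the crossings and of the pair of bridges *)

Section Conditional.
Variables (R : realType) (G : ograph) (g : nat) (D : subgraph G).
Variables (F1 F2 : set (vertex G)) (d : measure_display)
  (Omega : measurableType d).
Variables (P : probability Omega R) (N : Omega -> uloop G -> nat).
Variables (ord : seq (portion G) -> seq (portion G)) (Xi : Omega ->
  ubridge_pair G).
Hypothesis regular : out_regular G g.
Hypothesis green_fin :
  forall x y, vset D x -> vset D y -> (green R g D x y < +oo)%E.
Hypotheses (fin1 : finite_set F1) (fin2 : finite_set F2).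
Hypotheses (F1D : F1 `<=` vset D) (F2D : F2 `<=` vset D)
  (F12 : F1 `&` F2 = set0).
Hypothesis soup : loop_soup g D 1 P N.
Hypothesis unif : uniform_missing_parts D ord F1 F2 P N Xi.
Variables (n : nat) (c12 c21 : n.-tuple (portion G)).
Hypotheses (h12 : crossings_in D F1 F2 c12) (h21 : crossings_in D F2 F1 c21).
Hypotheses (ord12 : ord c12 = c12) (ord21 : ord c21 = c21).
Implicit Types (xi : (ubridge G n * ubridge G n)%type).
Local Notation meets := (meets_both D F1 F2).
Local Notation mu := (@loop_measure R G g D).
Local Notation pairs := (bridge_pairs D F1 F2 c12 c21).
Local Notation gm := (glued_mult c12 c21).
Local Notation same kappa := (same_loops D F1 F2 N kappa).
Local Notation uw := (@ubridge_weight R G g n).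
Local Notation eta := (eta_event R D ord F1 F2 N c12 c21).

Let Xi_is xi : set Omega := [set w | Xi w = existT _ n xi].

Let crossing_steps : nat :=
  (\sum_(j < n) (size (tnth c12 j).2 + size (tnth c21 j).2))%N.

(** The factors shared by all pairs compatible with [c12] and [c21]: the Poisson exponential, the
    weight of the edges of the crossings, and the relabellings of identical crossings. *)
Let const : R := expR (- fine (mu meets)) * g%:R ^- crossing_steps /
  (tuple_stabilizer c12 * tuple_stabilizer c21)%N%:R.

Lemma glued_weight xi :
  g%:R ^- (\sum_(j < n) size (word (glued_piece c12 c21 xi j)))%N =
  g%:R ^- crossing_steps * (uw xi.1 * uw xi.2).
Proof.
have -> : (\sum_(j < n) size (word (glued_piece c12 c21 xi j)) =
    crossing_steps + (\sum_(j < n) size (tnth xi.1.2 j) + \sum_(j < n) size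
      (tnth xi.2.2 j)))%N.
  rewrite /crossing_steps big_split /=.
  rewrite [(\sum_(j < n) size (tnth c21 j).2)%N](reindex_inj (@perm_inj _
    xi.1.1)).
  rewrite [(\sum_(j < n) size (tnth xi.2.2 j))%N](reindex_inj (@perm_inj _
    xi.1.1)) /=.
  rewrite -!big_split /=; apply: eq_bigr => j _.
  by rewrite /word /= !size_cat; lia.
rewrite -!exprVn !exprD !expr_sum /ubridge_weight.
by congr (_ * (_ * _)); apply: eq_bigr => j _; rewrite exprVn.
Qed.

(** The double count trades the automorphisms in the Poisson weight for the number [size s] of pairs
    giving the same loops. *)
Lemma prob_same_loops xi : pairs xi ->
  exists s : seq (ubridge G n * ubridge G n)%type,
  [/\ uniq s, xi \in s,
    missing_parts D F1 F2 c12 c21 (gm xi) = [set xi' | xi' \in s] &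
      P (same (gm xi)) = ((size s)%:R * (const * (uw xi.1 * uw xi.2)))%:E].
Proof.
move=> hxi; have [ls [s [[lsm kE] us sE sz tot]]] :=
  bridge_pair_count F12 h12 h21 hxi.
exists s; split => //.
  have : missing_parts D F1 F2 c12 c21 (gm xi) xi by case: hxi => b1 b2; split.
  by rewrite sE.
have -> : same (gm xi) = [set w | forall L, meets L -> N w L = count_mem L ls].
  by apply/seteqP; split => w h L mL; rewrite h // kE.
rewrite (soup_prob soup (loop_measure_meets_lt_pinfty F2 green_fin fin1 F1D)
  lsm).
rewrite (eq_big_seq (fun L =>
  (g%:R ^- size (uedges L) / (loop_period (Some L))%:R) ^+ count_mem L ls
    / (count_mem L ls)`!%:R)); last first.
  by move=> L; rewrite mem_undup => /lsm[LD _ _]; rewrite loop_measure1.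
rewrite prod_loop_weights tot glued_weight; congr (_%:E).
have A0 : (0 < tuple_stabilizer c12 *
  tuple_stabilizer c21)%N by rewrite muln_gt0 !tuple_stabilizer_gt0.
rewrite /const -sz; rewrite -sz muln_gt0 in A0; case/andP: A0 => s0 W0.
rewrite natrM invfM.
have s0' : (size s)%:R != 0 :> R by rewrite pnatr_eq0 -lt0n.
have alg (c c' x y z t : R) : c * (z * x * (c' * t) * y) = c * c' * (z * (x *
  y * t)) by ring.
by rewrite alg mulfV // mul1r.
Qed.

(** The uniform choice divides by exactly that number of pairs. *)
Lemma prob_same_loops_Xi xi : pairs xi ->
  P (same (gm xi) `&` Xi_is xi) = (const * (uw xi.1 * uw xi.2))%:E.
Proof.
move=> hxi; have [s [us xis sE PE]] := prob_same_loops hxi.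
have [l12 l21] := glued_lists R F12 h12 h21 hxi ord12 ord21.
have [_ /(_ _ _ _ _ l12 l21 xi)] := unif; rewrite /= => ->.
rewrite -/(same _) PE sE uniform_mass_seq // -EFinM mulrAC mulfV ?mul1r //.
by rewrite pnatr_eq0 -lt0n; case: (s) xis.
Qed.

Let measurable_same kappa : measurable (same kappa).
Proof. exact: measurable_same_loops regular green_fin fin1 F1D soup kappa. Qed.

Let measurable_Xi xi : measurable (Xi_is xi).
Proof. by have [h _] := unif; exact: h. Qed.

Let countable_pairs : countable pairs.
Proof. exact: (countable_bridge_pairs regular fin1 fin2 h12 h21). Qed.

(** Several pairs may give the same loops, so the events [same (gm xi)] overlap; adding the value of
    [Xi] makes the union disjoint. *)
Let described := \bigcup_(xi in pairs) (same (gm xi) `&` Xi_is xi).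

Let measurable_described : measurable described.
Proof.
apply: countable_bigcup_measurable => // xi _; exact: measurableI.
Qed.

Let Xi_inj xi xi' w : Xi_is xi w -> Xi_is xi' w -> xi = xi'.
Proof.
by rewrite /Xi_is /= => -> e;
  exact: (Eqdep_dec.inj_pair2_eq_dec _ PeanoNat.Nat.eq_dec _ _ _ _ e).
Qed.

(** The uniform masses of the finitely many missing parts sum to 1, so [Xi] almost surely takes one
    of these values, and each of them glues to the same loops. *)
Let undescribed0 xi : pairs xi -> P (same (gm xi) `\` described) = 0%E.
Proof.
move=> hxi; have [s [us xis sE PE]] := prob_same_loops hxi.
have [l12 l21] := glued_lists R F12 h12 h21 hxi ord12 ord21.
pose B := \bigcup_(xi' in [set` s]) (same (gm xi) `&` Xi_is xi').
have cs : countable [set` s] by apply: finite_set_countable; exact: finite_seq.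
have mB : measurable B.
  by apply: countable_bigcup_measurable => // xi' _; exact: measurableI.
have PB : P B = P (same (gm xi)).
  rewrite measure_countable_bigcup //; [|by move=> *; exact: measurableI|];
    last first.
    by move=> x y _ _ [w [[_ h] [_ h']]]; exact: Xi_inj h h'.
  have [_ /(_ _ _ _ _ l12 l21) h] := unif.
  rewrite (eq_esum (b := fun=> (const * (uw xi.1 * uw xi.2))%:E)) => [|xi' hs].
    have w0 : 0 <= const * (uw xi.1 *
      uw xi.2) by rewrite -lee_fin -prob_same_loops_Xi.
    rewrite esum_fset; [|exact: finite_seq|by move=> ? _; rewrite lee_fin].
    by rewrite -(fsbig_seq _ _ us) sumEFin big_const_seq count_predT iter_addr_0
      PE mulr_natl.
  apply: (etrans (h xi'));
    rewrite -/(same _) PE sE uniform_mass_seq // -EFinM mulrAC mulfV ?mul1r //.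
  by rewrite pnatr_eq0 -lt0n; case: (s) xis.
apply/eqP; rewrite eq_le measure_ge0 andbT.
apply: (@le_trans _ _ (P (same (gm xi) `\` B))).
  apply: le_measure; rewrite ?inE; [exact: measurableD|exact: measurableD|].
  move=> w [sw nw]; split => // -[xi' hs [_ hX]]; apply: nw.
  have : missing_parts D F1 F2 c12 c21 (gm xi) xi' by rewrite sE.
  by move=> [b1 b2 hk]; exists xi'; split => // L mL; rewrite sw // hk.
rewrite measureD //; last by rewrite (le_lt_trans (probability_le1 _ _)) ?ltry.
have e0 : (P (same (gm xi)) - P B = 0)%E by rewrite PB subee ?fin_num_measure.
rewrite (_ : same (gm xi) `&` B = B); first by rewrite -[leRHS]e0.
by apply/seteqP; split => [w []//|w hw]; split => //; case: hw => xi' _ [].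
Qed.

(** Every configuration with these crossings is glued from some pair, and gluing a pair creates no
    other crossing. *)
Lemma eta_bridge_pairs : eta = \bigcup_(xi in pairs) same (gm xi).
Proof.
apply/seteqP; split => w.
  move=> [l12 l21]; have [_ _ [xi [b1 b2 hk]]] :=
    missing_parts_exist F12 F1D F2D l12 l21.
  by exists xi.
move=> [xi hxi sw]; have [l12 l21] := glued_lists R F12 h12 h21 hxi ord12 ord21.
split.
- by apply: lists_crossings_agree12 l12 => // L mL; rewrite sw.
- by apply: lists_crossings_agree21 l21 => // L mL; rewrite sw.
Qed.

Let measurable_eta : measurable eta.
Proof. by rewrite eta_bridge_pairs; exact: countable_bigcup_measurable. Qed.

Let eta_undescribed0 : P (eta `\` described) = 0%E.
Proof.
rewrite eta_bridge_pairs setD_bigcupl.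
apply: measure_countable_bigcup0 => // xi hxi; exact: measurableD.
Qed.

Let prob_mod_described A : measurable A -> A `<=` eta ->
  P A = P (A `&` described).
Proof.
move=> mA Aeta; rewrite (measureDI P mA measurable_described) -[RHS]add0e;
  congr (_ + _)%E.
apply/eqP; rewrite eq_le measure_ge0 andbT -eta_undescribed0.
by apply: le_measure; rewrite ?inE;
  [exact: measurableD|exact: measurableD|exact: setSD].
Qed.

Let described_eta : described `<=` eta.
Proof. by rewrite eta_bridge_pairs => w [xi hxi [sw _]]; exists xi. Qed.

Lemma prob_eta_Xi xi : P (eta `&` Xi_is xi) =
  if xi \in pairs then (const * (uw xi.1 * uw xi.2))%:E else 0%E.
Proof.
rewrite prob_mod_described; [|exact: measurableI|by move=> w []].
case: ifPn => [/set_mem hxi|/negP nxi].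
  rewrite -prob_same_loops_Xi //; congr (P _); apply/seteqP; split => w.
    by move=> [[_ hw] [xi' _ [sw hw']]]; rewrite (Xi_inj hw hw').
  by move=> [sw hw]; split; [split => //; rewrite eta_bridge_pairs;
    exists xi | exists xi].
(* On [described] the value of [Xi] is a compatible pair. *)
rewrite (_ : _ `&` _ = set0) ?measure0 //; apply/seteqP; split => // w.
by move=> [[_ hw] [xi' hxi' [_ hw']]]; apply: nxi; rewrite (Xi_inj hw hw');
  exact: mem_set.
Qed.

Local Notation X := (ends c12).
Local Notation Y := (starts c21).
Local Notation X' := (ends c21).
Local Notation Y' := (starts c12).

(** The compatible pairs form a product set and their weight is a product; this is the source of the
    independence. *)
Lemma prob_eta : P eta = (const * (ubridge_mass R g (remove D F1) X Y *
                                   ubridge_mass R g (remove D F2) X' Y'))%:E.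
Proof.
rewrite prob_mod_described // (_ : eta `&` described = described); last first.
  by apply/seteqP; split => [w []//|w hw]; split => //; exact: described_eta.
rewrite measure_countable_bigcup //; [|by move=> *; exact: measurableI|];
  last first.
  by move=> x y _ _ [w [[_ h] [_ h']]]; exact: Xi_inj h h'.
rewrite (eq_esum (b := fun xi => const%:E * (uw xi.1 * uw xi.2)%:E)%E) =>
  [|xi hxi]; last first.
  by rewrite -EFinM; exact: prob_same_loops_Xi.
have const_ge0 : 0 <= const.
  by rewrite divr_ge0 // mulr_ge0 ?expR_ge0 // invr_ge0 exprn_ge0.
have gf F := green_remove_lt_pinfty (F := F) green_fin.
rewrite esumZl // => [|xi];
  last by rewrite lee_fin mulr_ge0 // ubridge_weight_ge0.
rewrite (_ : pairs = ubridges (remove D F1) X Y `*` ubridges (remove D F2) X'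
  Y') //.
rewrite esum_prod; [|exact: ubridge_weight_ge0|exact: ubridge_weight_ge0|].
  by rewrite (esum_ubridge_weight (gf F1)) (esum_ubridge_weight (gf F2)).
by rewrite (esum_ubridge_weight (gf F2)) ltry.
Qed.

End Conditional.

Theorem proposition2 (R : realType) (G : ograph) (g : nat) (D : subgraph G)
    (F1 F2 : set (vertex G)) (d : measure_display) (Omega : measurableType d)
    (P : probability Omega R) (N : Omega -> uloop G -> nat)
    (ord : seq (portion G) -> seq (portion G))
    (Xi : Omega -> ubridge_pair G) :
  out_regular G g ->
  (forall x y, vset D x -> vset D y -> (green R g D x y < +oo)%E) ->
  finite_set F1 -> finite_set F2 ->
  F1 `<=` vset D -> F2 `<=` vset D -> F1 `&` F2 = set0 ->
  loop_soup g D 1 P N ->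
  ordering_rule ord ->
  uniform_missing_parts D ord F1 F2 P N Xi ->
  (\forall w \ae P, exists (n : nat) (c12 c21 : n.-tuple (portion G)),
     eta_event R D ord F1 F2 N c12 c21 w) /\
  forall (n : nat) (c12 c21 : n.-tuple (portion G)),
    let eta := eta_event R D ord F1 F2 N c12 c21 in
    let X := ends c12 in let Y := starts c21 in
    let X' := ends c21 in let Y' := starts c12 in
    (0 < P eta)%E ->
    [/\ ubridge_defined R g (remove D F1) X Y,
        ubridge_defined R g (remove D F2) X' Y'
      & forall (b b' : ubridge G n),
        P (eta `&` [set w | Xi w = existT _ n (b, b')])
        = (P eta * (ubridge_prob R g (remove D F1) X Y b *
                    ubridge_prob R g (remove D F2) X' Y' b')%:E)%E].
Proof.
move=> regular green_fin fin1 fin2 F1D F2D F12 soup ordr unif; split.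
  have fin := ae_finite_meets F2 green_fin fin1 F1D soup.
  apply: filterS fin => w hw.
  have [n [c12 [c21 [l12 l21]]]] := lists_crossings_exist R F12 F1D F2D ordr hw.
  by exists n, c12, c21; split.
move=> n c12 c21 eta X Y X' Y' eta0.
(* A point of [eta] provides a compatible pair, which makes both normalisations positive. *)
have [w [l12 l21]] : exists w, eta w.
  apply: contrapT => /forallNP h; move: eta0; rewrite (_ : eta = set0) ?measure0 ?ltxx //.
  by apply/seteqP; split => // w /h.
have [h12 h21 [xi [b1 b2 _]]] := missing_parts_exist F12 F1D F2D l12 l21.
have ord12 : ord c12 = c12 by case: l12.
have ord21 : ord c21 = c21 by case: l21.
have gf F := green_remove_lt_pinfty (F := F) green_fin.
split.
- exact: (ubridges_definedP regular (gf F1) b1).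
- exact: (ubridges_definedP regular (gf F2) b2).
move=> b b'; rewrite (prob_eta regular green_fin fin1 fin2 F1D F2D F12 soup unif
  h12 h21 ord12 ord21).
rewrite (prob_eta_Xi regular green_fin fin1 fin2 F1D F2D F12 soup unif h12 h21
  ord12 ord21).
have m1 := ubridge_mass_gt0 regular (gf F1) b1.
have m2 := ubridge_mass_gt0 regular (gf F2) b2.
case: ifPn => [/set_mem [/= hb hb']|/negP nbb].
  rewrite (ubridge_probE regular (gf F1) hb)
    (ubridge_probE regular (gf F2) hb') -EFinM.
  have alg (c u v p q : R) : p != 0 -> q != 0 ->
    c * (u * v) = c * (p * q) * (u / p * (v / q)).
    by move=> p0 q0; field; rewrite p0 q0.
  by congr (_%:E); apply: alg; rewrite gt_eqF.
(* For an incompatible pair, one of the two unordered bridge probabilities is 0. *)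
rewrite -EFinM; case: (pselect (ubridges (remove D F1) X Y b)) => [hb|nb];
  last first.
  by rewrite (ubridge_prob0 R g nb) mul0r mulr0.
rewrite (@ubridge_prob0 R G g _ _ X' Y' b') ?mulr0 // => hb'.
by apply: nbb; apply: mem_set.
Qed.
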